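(* For every group $G$ there is a short exact sequence $$0\to\mathbf g\otimes_{\mathbb Z[G]}\mathbf g\otimes_{\mathbb Z[G]}\mathbf g\to\mathrm{lim}^1(\mathbf{ffr}+\mathbf{frf}+\mathbf{rff}+\mathbf{rr})\to\mathrm{Tor}(G_{ab},G_{ab})\to 0,$$ a natural isomorphism $$\mathrm{lim}^2(\mathbf{ffr}+\mathbf{frf}+\mathbf{rff}+\mathbf{rr})\cong G_{ab}\otimes G_{ab},$$ and $\mathrm{lim}^i(\mathbf{ffr}+\mathbf{frf}+\mathbf{rff}+\mathbf{rr})=0$ for $i\ge 3$.
   Context: For a group $G$, $\mathrm{Pres}(G)$ is the category whose objects are epimorphisms $F\twoheadrightarrow G$ from free groups and whose morphisms are group homomorphisms over $G$. Functorial ideals of $\mathbb Z[F]$: $\mathbf f=\ker\{\mathbb Z[F]\to\mathbb Z\}$, $\mathbf r=\ker\{\mathbb Z[F]\to\mathbb Z[G]\}$. Words in $\mathbf f,\mathbf r$ denote products of ideals (e.g. $\mathbf{ffr}=\mathbf f\cdot\mathbf f\cdot\mathbf r$) and $+$ is the sum of ideals; such expressions are functors $\mathrm{Pres}(G)\to\mathrm{Ab}$. $\mathrm{lim}^i$ denotes the $i$-th right derived functor of the limit functor $\mathrm{Ab}^{\mathrm{Pres}(G)}\to\mathrm{Ab}$ (set-theoretic existence assumed, e.g. in a larger universe). $\mathbf g$ is the augmentation ideal of $\mathbb Z[G]$, $G_{ab}$ the abelianization of $G$; $\otimes$ without subscript and $\mathrm{Tor}=\mathrm{Tor}_1$ are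 over $\mathbb Z$. *)

(* Defs.v *)
From HB Require Import structures.
From mathcomp Require Import all_boot all_order all_algebra.
From mathcomp Require Import finmap boolp.
From mathcomp Require Import monalg.

Set Implicit Arguments.
Unset Strict Implicit.
Unset Printing Implicit Defensive.

Import GRing.Theory.
Local Open Scope quotient_scope.
Local Open Scope ring_scope.

Section Subgroups.
Variable V : zmodType.

Definition mk_sub (P : V -> Prop) (h : zmod_closed [pred x | `[< P x >]]) :
  zmodClosed V :=
  HB.pack (fun x : V => `[< P x >])
    (GRing.isZmodClosed.Build V (fun x : V => `[< P x >]) h).

Lemma mk_subE P h x : x \in @mk_sub P h = `[< P x >]. Proof. by []. Qed.

Definition subz (I : zmodClosed V) : Type := {x : V | x \in I}.

Definition span_pred (S : V -> Prop) (x : V) : Prop :=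
  forall I : zmodClosed V, (forall y, S y -> y \in I) -> x \in I.

Fact span_closed S : zmod_closed [pred x | `[< span_pred S x >]].
Proof.
split=> [|x y]; first by apply/asboolP => I _; apply: rpred0.
by move=> /asboolP hx /asboolP hy; apply/asboolP => I hI;
  apply: rpredB; [exact: hx|exact: hy].
Qed.

Definition span (S : V -> Prop) : zmodClosed V := mk_sub (span_closed S).

Lemma mem_span (S : V -> Prop) x : S x -> x \in span S.
Proof. by move=> Sx; apply/asboolP => I; apply. Qed.

Lemma span_sub (S : V -> Prop) (I : zmodClosed V) :
  (forall y, S y -> y \in I) -> forall x, x \in span S -> x \in I.
Proof. by move=> h x /asboolP; apply. Qed.

End Subgroups.

Section SubzInstance.
Variables (V : zmodType) (I : zmodClosed V).
HB.instance Definition _ := [isSub of subz I for @sval V (fun x => x \in I)].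
HB.instance Definition _ := [Choice of subz I by <:].
HB.instance Definition _ := [SubChoice_isSubZmodule of subz I by <:].
End SubzInstance.

Section SubzMap.
Variables (V W : zmodType) (I : zmodClosed V) (J : zmodClosed W).
Variables (f : {additive V -> W}) (h : forall x, x \in I -> f x \in J).

Definition subz_fun (x : subz I) : subz J := Sub (f (val x)) (h (valP x)).

Fact subz_fun_additive : zmod_morphism subz_fun.
Proof. by move=> x y; apply: val_inj; rewrite /= !raddfB. Qed.

HB.instance Definition _ :=
  GRing.isZmodMorphism.Build (subz I) (subz J) subz_fun subz_fun_additive.

Definition subz_map : {additive subz I -> subz J} := subz_fun.
End SubzMap.

Section Kernel.
Variables (V W : zmodType) (f : {additive V -> W}).

Fact ker_closed : zmod_closed [pred x | `[< f x = 0 >]].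
Proof.
split=> [|x y /asboolP fx /asboolP fy]; apply/asboolP; first exact: raddf0.
by rewrite raddfB fx fy subrr.
Qed.

Definition ker : zmodClosed V := mk_sub ker_closed.

Lemma mem_ker x : x \in ker <-> f x = 0.
Proof. by split=> [/asboolP|h]; last apply/asboolP. Qed.

End Kernel.

Section QuotientLift.
Variables (V W : zmodType) (I : zmodClosed V) (f : {additive V -> W}).
Hypothesis fI : forall x, x \in I -> f x = 0.

Definition quot_fun (q : Quotient.quot I) : W := f (repr q).

Lemma quot_funE x : quot_fun (\pi x) = f x.
Proof.
apply/eqP; rewrite -subr_eq0 -raddfB; apply/eqP/fI.
by rewrite Quotient.idealrBE reprK.
Qed.

Fact quot_fun_additive : zmod_morphism quot_fun.
Proof.
by move=> x y; rewrite -[x]reprK -[y]reprK -raddfB !quot_funE raddfB.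
Qed.

Definition quot_lift : {additive Quotient.quot I -> W} :=
  HB.pack quot_fun (GRing.isZmodMorphism.Build _ _ quot_fun quot_fun_additive).
End QuotientLift.

Section Homology.
Variables (U V W : zmodType) (f : {additive U -> V}) (g : {additive V -> W}).

Fact bnd_closed : zmod_closed [pred z : subz (ker g) | `[< exists y, f y = val z >]].
Proof.
split=> [|x y /asboolP[a ha] /asboolP[b hb]]; apply/asboolP.
  by exists 0; rewrite !raddf0.
by exists (a - b); rewrite !raddfB ha hb.
Qed.

Definition bnd : zmodClosed (subz (ker g)) := mk_sub bnd_closed.

(* ker g / im f, for composable U -> V -> W with g \o f = 0. *)
Definition homology : zmodType := Quotient.quot bnd.

End Homology.

Section HomologyMap.
Variables (U V W : zmodType) (f : {additive U -> V}) (g : {additive V -> W}).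
Variables (U' V' W' : zmodType).
Variables (f' : {additive U' -> V'}) (g' : {additive V' -> W'}).
Variables (u : {additive U -> U'}) (v : {additive V -> V'}).
Variables (w : {additive W -> W'}).
Hypothesis fu : forall x, f' (u x) = v (f x).
Hypothesis gv : forall x, g' (v x) = w (g x).

Fact hmap_ker x : x \in ker g -> v x \in ker g'.
Proof. by move=> /mem_ker h; apply/mem_ker; rewrite gv h raddf0. Qed.

Let pi_v : {additive subz (ker g) -> homology f' g'} :=
  \pi_(Quotient.quot (bnd f' g')) \o subz_map hmap_ker.

Fact hmap_bnd x : x \in bnd f g -> pi_v x = 0.
Proof.
move=> /asboolP[y hy]; apply/eqP; rewrite -[0](raddf0 \pi_(Quotient.quot (bnd f' g'))).
by rewrite /= -Quotient.idealrBE subr0; apply/asboolP; exists (u y); rewrite fu hy.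
Qed.

Definition homology_map : {additive homology f g -> homology f' g'} :=
  quot_lift hmap_bnd.
End HomologyMap.

Definition short_exact (A B C : zmodType)
    (a : {additive A -> B}) (b : {additive B -> C}) : Prop :=
  [/\ injective a,
      (forall y, b y = 0 <-> exists x, a x = y)
    & (forall z, exists y, b y = z)].

Definition dprod (I : Type) (V : I -> zmodType) : Type := forall i, V i.

Section DepProduct.
Variables (I : Type) (V : I -> zmodType).
Implicit Types x y z : dprod V.
HB.instance Definition _ := gen_eqMixin (dprod V).
HB.instance Definition _ := gen_choiceMixin (dprod V).
Definition dprod0 : dprod V := fun=> 0.
Definition dprodN x : dprod V := fun i => - x i.
Definition dprodD x y : dprod V := fun i => x i + y i.
Fact dprodA : associative dprodD.
Proof. by move=> x y z; apply/functional_extensionality_dep=> i; apply: addrA. Qed.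
Fact dprodC : commutative dprodD.
Proof. by move=> x y; apply/functional_extensionality_dep=> i; apply: addrC. Qed.
Fact dprod0D : left_id dprod0 dprodD.
Proof. by move=> x; apply/functional_extensionality_dep=> i; apply: add0r. Qed.
Fact dprodND : left_inverse dprod0 dprodN dprodD.
Proof. by move=> x; apply/functional_extensionality_dep=> i; apply: addNr. Qed.
HB.instance Definition _ :=
  GRing.isZmodule.Build (dprod V) dprodA dprodC dprod0D dprodND.
End DepProduct.

(* [{malg int[K]}] is the free abelian group on [K], with basis [<< k >>];
   [malg_ext h] is the additive extension of [h : K -> A]. *)
Section FreeAbelian.
Variables (K : choiceType) (A : zmodType) (h : K -> A).
Implicit Types g : {malg int[K]}.

Definition malg_ext_fun g : A := \sum_(k <- msupp g) h k *~ g@_k.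

Lemma malg_ext_funEw (d : {fset K}) g : (msupp g `<=` d)%fset ->
  malg_ext_fun g = \sum_(k <- d) h k *~ g@_k.
Proof.
move=> le; rewrite /malg_ext_fun (big_fset_incl _ le) => // k _ .
by rewrite -mcoeff_eq0 => /eqP ->; rewrite mulr0z.
Qed.

Fact malg_ext_additive : zmod_morphism malg_ext_fun.
Proof.
move=> g1 g2; pose d := (msupp g1 `|` msupp g2)%fset.
rewrite (@malg_ext_funEw d) ?msuppB_le // (@malg_ext_funEw d g1) ?fsubsetUl //.
rewrite (@malg_ext_funEw d g2) ?fsubsetUr // -sumrB.
by apply: eq_bigr => k _; rewrite mcoeffB mulrzBr.
Qed.

HB.instance Definition _ :=
  GRing.isZmodMorphism.Build {malg int[K]} A malg_ext_fun malg_ext_additive.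

Definition malg_ext : {additive {malg int[K]} -> A} := malg_ext_fun.

Lemma malg_extU k : malg_ext << k >> = h k.
Proof.
by rewrite /= (malg_ext_funEw msuppU_le) big_seq_fset1 mcoeffUU mulr1z.
Qed.

End FreeAbelian.

Lemma malg_additive_eq (K : choiceType) (A : zmodType)
    (f1 f2 : {additive {malg int[K]} -> A}) :
  (forall k, f1 << k >> = f2 << k >>) -> f1 =1 f2.
Proof.
move=> h g; rewrite [g]monalgE !raddf_sum; apply: eq_bigr => k _.
suff -> : << g@_k *g k >> = << k >> *~ g@_k :> {malg int[K]} by rewrite !raddfMz h.
apply/malgP => k'; rewrite raddfMz /= !mcoeffU.
by case: eqP => _; rewrite ?mulr1n ?mulr0n ?intz ?mul0rz.
Qed.

(* The tensor product of [M] and [N] over a ring [A] acting on the right of [M]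
   by [r] and on the left of [N] by [l]: generators [m (x) n], biadditivity and
   [ma (x) n = m (x) an]. Only the action maps enter the construction. *)
Section Tensor.
Variables (A : Type) (M N : zmodType) (r : M -> A -> M) (l : A -> N -> N).

Definition tgen (m : M) (n : N) : {malg int[(M * N)%type]} := mkmalgU (m, n) 1.

Inductive tensor_rel : {malg int[(M * N)%type]} -> Prop :=
| TensorDl m m' n : tensor_rel (tgen (m + m') n - (tgen m n + tgen m' n))
| TensorDr m n n' : tensor_rel (tgen m (n + n') - (tgen m n + tgen m n'))
| TensorA m a n : tensor_rel (tgen (r m a) n - tgen m (l a n)).

Definition tensor : zmodType := Quotient.quot (span tensor_rel).

Definition tpure (m : M) (n : N) : tensor := \pi_(tensor) (tgen m n).

Lemma tensor_rel_pi x y : tensor_rel (x - y) -> \pi_(tensor) x = \pi_(tensor) y.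
Proof. by move=> h; apply/eqP; rewrite -Quotient.idealrBE; apply: mem_span. Qed.

Lemma tpureDl m m' n : tpure (m + m') n = tpure m n + tpure m' n.
Proof. by rewrite /tpure (tensor_rel_pi (TensorDl m m' n)) raddfD. Qed.

Lemma tpureDr m n n' : tpure m (n + n') = tpure m n + tpure m n'.
Proof. by rewrite /tpure (tensor_rel_pi (TensorDr m n n')) raddfD. Qed.

Lemma tpureA m a n : tpure (r m a) n = tpure m (l a n).
Proof. exact: tensor_rel_pi (TensorA m a n). Qed.

Section Lift.
Variables (T : zmodType) (b : M -> N -> T).
Hypothesis bDl : forall m m' n, b (m + m') n = b m n + b m' n.
Hypothesis bDr : forall m n n', b m (n + n') = b m n + b m n'.
Hypothesis bA : forall m a n, b (r m a) n = b m (l a n).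

Let b_ext : {additive {malg int[(M * N)%type]} -> T} :=
  malg_ext (fun p : M * N => b p.1 p.2).

Fact tensor_lift_subproof x : x \in span tensor_rel -> b_ext x = 0.
Proof.
have bE m n : b_ext (tgen m n) = b m n by rewrite /b_ext malg_extU.
move=> /(@span_sub _ _ (ker b_ext)) h; apply/mem_ker/h => {h x} _ [] *.
all: by apply/mem_ker; rewrite raddfB ?(raddfD b_ext) !bE ?bDl ?bDr ?bA subrr.
Qed.

Definition tensor_lift : {additive tensor -> T} := quot_lift tensor_lift_subproof.

Lemma tensor_liftE m n : tensor_lift (tpure m n) = b m n.
Proof. exact: etrans (quot_funE tensor_lift_subproof _) (malg_extU _ _). Qed.

End Lift.
End Tensor.

Definition tensorZ (M N : zmodType) : zmodType :=
  tensor (fun (m : M) (k : int) => m *~ k) (fun (k : int) (n : N) => n *~ k).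

Section TensorZMap.
Variables (M N M' N' : zmodType) (f : {additive M -> M'}) (g : {additive N -> N'}).

Let b (m : M) (n : N) : tensorZ M' N' := tpure _ _ (f m) (g n).

Fact tensorZ_map_Dl m m' n : b (m + m') n = b m n + b m' n.
Proof. by rewrite /b raddfD tpureDl. Qed.
Fact tensorZ_map_Dr m n n' : b m (n + n') = b m n + b m n'.
Proof. by rewrite /b raddfD tpureDr. Qed.
Fact tensorZ_map_A m (k : int) n : b (m *~ k) n = b m (n *~ k).
Proof. by rewrite /b !raddfMz tpureA. Qed.

Definition tensorZ_map : {additive tensorZ M N -> tensorZ M' N'} :=
  tensor_lift tensorZ_map_Dl tensorZ_map_Dr tensorZ_map_A.
End TensorZMap.

Definition projective (P : zmodType) : Prop :=
  forall (M N : zmodType) (g : {additive M -> N}) (h : {additive P -> N}),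
    (forall y, exists x, g x = y) ->
    exists k : {additive P -> M}, forall x, g (k x) = h x.

Record proj_res (A : zmodType) := ProjRes {
  pr_ob :> nat -> zmodType;
  pr_d : forall n, {additive pr_ob n.+1 -> pr_ob n};
  pr_aug : {additive pr_ob 0 -> A};
  pr_proj : forall n, projective (pr_ob n);
  pr_aug_surj : forall a, exists x, pr_aug x = a;
  pr_exact0 : forall x, pr_aug x = 0 <-> exists y, pr_d 0 y = x;
  pr_exact : forall n x, pr_d n x = 0 <-> exists y, pr_d n.+1 y = x }.

(* Tor_1(A, B), computed with the resolution [P] of [A]. *)
Definition Tor (A : zmodType) (P : proj_res A) (B : zmodType) : zmodType :=
  homology (tensorZ_map (pr_d P 1) (idfun : {additive B -> B}))
           (tensorZ_map (pr_d P 0) (idfun : {additive B -> B})).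

Definition zgring (G : groupType) : Type := {malg int[G]}.

Section GroupRing.
Variable G : groupType.
Implicit Types x y z : zgring G.

HB.instance Definition _ := GRing.Zmodule.on (zgring G).

Definition zgU (g : G) : zgring G := mkmalgU g 1.

Lemma zgring_eq (A : zmodType) (f1 f2 : {additive zgring G -> A}) :
  (forall g, f1 (zgU g) = f2 (zgU g)) -> f1 =1 f2.
Proof. exact: malg_additive_eq. Qed.

Definition zg_mul x y : zgring G :=
  malg_ext (fun g : G => malg_ext (fun h : G => zgU (g * h)%g) y) x.

Lemma zg_mulBl x y z : zg_mul (x - y) z = zg_mul x z - zg_mul y z.
Proof. exact: raddfB. Qed.

Lemma zg_mulBr x y z : zg_mul x (y - z) = zg_mul x y - zg_mul x z.
Proof.
rewrite /zg_mul /= /malg_ext_fun -sumrB; apply: eq_bigr => k _.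
by rewrite -mulrzBl; congr (_ *~ _);
  exact: (raddfB (malg_ext (fun h => zgU (k * h)%g))).
Qed.

HB.instance Definition _ x :=
  GRing.isZmodMorphism.Build (zgring G) (zgring G) (zg_mul x) (zg_mulBr x).
Let zg_mulr y x := zg_mul x y.
HB.instance Definition _ y :=
  GRing.isZmodMorphism.Build (zgring G) (zgring G) (zg_mulr y)
    (fun x z => zg_mulBl x z y).

Lemma zg_mulUU g h : zg_mul (zgU g) (zgU h) = zgU (g * h)%g.
Proof. by rewrite /zg_mul !malg_extU. Qed.

Fact zg_mul1g : left_id (zgU 1%g) zg_mul.
Proof.
apply: (@zgring_eq _ (zg_mul (zgU 1%g)) idfun) => g /=.
by rewrite zg_mulUU mul1g.
Qed.

Fact zg_mulg1 : right_id (zgU 1%g) zg_mul.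
Proof.
apply: (@zgring_eq _ (zg_mulr (zgU 1%g)) idfun) => g /=.
by rewrite /zg_mulr zg_mulUU mulg1.
Qed.

Fact zg_mulDl : left_distributive zg_mul +%R.
Proof. by move=> x y z; apply: (raddfD (zg_mulr z)). Qed.

Fact zg_mulDr : right_distributive zg_mul +%R.
Proof. by move=> x y z; apply: (raddfD (zg_mul x)). Qed.

Fact zg_mulA : associative zg_mul.
Proof.
move=> x y z.
apply: (@zgring_eq _ (zg_mulr (zg_mul y z)) (zg_mulr z \o zg_mulr y)) => g /=.
apply: (@zgring_eq _ (zg_mul (zgU g) \o zg_mulr z)
                     (zg_mulr z \o zg_mul (zgU g))) => h /=.
apply: (@zgring_eq _ (zg_mul (zgU g) \o zg_mul (zgU h))
                     (zg_mul (zg_mul (zgU g) (zgU h)))) => k /=.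
by rewrite /zg_mulr !zg_mulUU mulgA.
Qed.

Fact zg_1neq0 : zgU 1%g != 0.
Proof. by rewrite /zgU monalgU_eq0. Qed.

HB.instance Definition _ :=
  GRing.Zmodule_isNzRing.Build (zgring G)
    zg_mulA zg_mul1g zg_mulg1 zg_mulDl zg_mulDr zg_1neq0.

Lemma zgUM g h : zgU (g * h)%g = zgU g * zgU h.
Proof. by rewrite -zg_mulUU. Qed.

End GroupRing.

Section GroupRingExt.
Variables (G : groupType) (R : pzRingType) (h : G -> R).
Hypothesis h1 : h 1%g = 1.
Hypothesis hM : forall x y, h (x * y)%g = h x * h y.

Definition zg_ext_fun : zgring G -> R := malg_ext h.

HB.instance Definition _ := GRing.Additive.copy zg_ext_fun (malg_ext h).

Lemma zg_extU g : zg_ext_fun (zgU g) = h g. Proof. exact: malg_extU. Qed.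

Fact zg_ext_monoid : monoid_morphism zg_ext_fun.
Proof.
split=> [|x y]; first by rewrite zg_extU.
apply: (@zgring_eq _ _ (zg_ext_fun \o (y \o* idfun))
                       (zg_ext_fun y \o* zg_ext_fun)) => g /=.
apply: (@zgring_eq _ _ (zg_ext_fun \o (zgU g \*o idfun))
                       (zg_ext_fun (zgU g) \*o zg_ext_fun)) => k /=.
by rewrite -zgUM !zg_extU hM.
Qed.

Definition zg_ext : {rmorphism zgring G -> R} :=
  HB.pack zg_ext_fun (GRing.isMonoidMorphism.Build _ _ zg_ext_fun zg_ext_monoid).

Lemma zg_extE g : zg_ext (zgU g) = h g. Proof. exact: zg_extU. Qed.
End GroupRingExt.

Section GroupRingMaps.
Variable G : groupType.

Definition aug : {rmorphism zgring G -> int} :=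
  zg_ext (h := fun=> 1) erefl (fun _ _ => esym (mulr1 1)).

Variables (H : groupType) (f : {multiplicative G -> H}).

Lemma mulg_morph1 : f 1%g = 1%g.
Proof. by apply: (@mulgI _ (f 1%g)); rewrite -gmulfM !mulg1. Qed.

Fact zg_map1 : zgU (f 1%g) = 1. Proof. by rewrite mulg_morph1. Qed.
Fact zg_mapM x y : zgU (f (x * y)%g) = zgU (f x) * zgU (f y).
Proof. by rewrite gmulfM zgUM. Qed.

Definition zg_map : {rmorphism zgring G -> zgring H} := zg_ext zg_map1 zg_mapM.

Lemma zg_mapU g : zg_map (zgU g) = zgU (f g). Proof. exact: zg_extE. Qed.
End GroupRingMaps.

Section Ideals.
Variable R : nzRingType.
Implicit Types I J : zmodClosed R.

Definition idealM I J : zmodClosed R :=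
  span (fun x => exists a b, [/\ a \in I, b \in J & x = a * b]).

Fact idealD_closed I J :
  zmod_closed [pred x | `[< exists a b, [/\ a \in I, b \in J & x = a + b] >]].
Proof.
split=> [|x y]; first by apply/asboolP; exists 0, 0; rewrite !rpred0 addr0.
move=> /asboolP[a [b [aI bJ ->]]] /asboolP[c [d [cI dJ ->]]].
apply/asboolP; exists (a - c), (b - d); rewrite !rpredB //; split=> //.
by rewrite opprD addrACA.
Qed.

Definition idealD I J : zmodClosed R := mk_sub (idealD_closed I J).
End Ideals.

Section IdealMaps.
Variables (R S : nzRingType) (f : {rmorphism R -> S}).
Variables (I J : zmodClosed R) (I' J' : zmodClosed S).
Hypothesis hI : forall x, x \in I -> f x \in I'.
Hypothesis hJ : forall x, x \in J -> f x \in J'.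

Fact comap_closed (K : zmodClosed S) : zmod_closed [pred x | `[< f x \in K >]].
Proof.
split=> [|x y /asboolP hx /asboolP hy]; apply/asboolP.
  by rewrite raddf0 rpred0.
by rewrite raddfB rpredB.
Qed.

Lemma idealM_map x : x \in idealM I J -> f x \in idealM I' J'.
Proof.
move=> hx; suff /asboolP : x \in mk_sub (comap_closed (idealM I' J')) by [].
apply: span_sub hx => _ [a [b [aI bJ ->]]]; apply/asboolP.
by rewrite rmorphM; apply: mem_span; exists (f a), (f b); rewrite hI ?hJ.
Qed.

Lemma idealD_map x : x \in idealD I J -> f x \in idealD I' J'.
Proof.
move=> /asboolP[a [b [aI bJ ->]]]; apply/asboolP.
by exists (f a), (f b); rewrite raddfD hI ?hJ.
Qed.
End IdealMaps.

Lemma aug_zg_map (G H : groupType) (f : {multiplicative G -> H}) x :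
  aug H (zg_map f x) = aug G x.
Proof.
apply: (@zgring_eq _ _ (aug H \o zg_map f) (aug G)) => g.
have E (K : groupType) k : aug K (zgU k) = 1 by exact: zg_extU.
exact: etrans (congr1 (aug H) (zg_mapU f g)) (etrans (E H _) (esym (E G _))).
Qed.

Lemma zg_map_comp (G H K L : groupType) (f : {multiplicative G -> H})
    (g : {multiplicative H -> L}) (f' : {multiplicative G -> K})
    (g' : {multiplicative K -> L}) :
  (forall x, g (f x) = g' (f' x)) ->
  forall x, zg_map g (zg_map f x) = zg_map g' (zg_map f' x).
Proof.
move=> e; apply: (@zgring_eq _ _ (zg_map g \o zg_map f) (zg_map g' \o zg_map f')) => x.
have {}e : zgU (g (f x)) = zgU (g' (f' x)) by rewrite e.
have E (A B C : groupType) (k : {multiplicative A -> B}) (l : {multiplicative B -> C}) y :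
  zg_map l (zg_map k (zgU y)) = zgU (l (k y)) by rewrite !zg_mapU.
exact: etrans (E _ _ _ f g x) (etrans e (esym (E _ _ _ f' g' x))).
Qed.

Lemma zg_map_id (G : groupType) (f : {multiplicative G -> G}) :
  f =1 id -> forall x, zg_map f x = x.
Proof.
move=> e; apply: (@zgring_eq _ _ (zg_map f) idfun) => x.
by apply: etrans (zg_mapU f x) _; rewrite e.
Qed.

Section AugmentationIdeal.
Variable G : groupType.

Definition augI : zmodType := subz (ker (aug G)).

Fact augI_mull (a : zgring G) (x : augI) : a * val x \in ker (aug G).
Proof.
have /mem_ker x0 := valP x; apply/mem_ker.
exact: etrans (rmorphM (aug G) _ _) (etrans (congr1 ( *%R (aug G a)) x0) (mulr0 _)).
Qed.
Fact augI_mulr (x : augI) (a : zgring G) : val x * a \in ker (aug G).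
Proof.
have /mem_ker x0 := valP x; apply/mem_ker.
exact: etrans (rmorphM (aug G) _ _) (etrans (congr1 ( *%R^~ (aug G a)) x0) (mul0r _)).
Qed.

Definition augI_lact (a : zgring G) (x : augI) : augI :=
  exist _ (a * val x) (augI_mull a x).
Definition augI_ract (x : augI) (a : zgring G) : augI :=
  exist _ (val x * a) (augI_mulr x a).

(* g (x)_{Z[G]} g, with the right action (x (x) y) a = x (x) ya *)
Definition augI2 : zmodType := tensor augI_ract augI_lact.

Section Ract.
Variable a : zgring G.
Let b (x y : augI) : augI2 := tpure _ _ x (augI_ract y a).

Fact augI2_Dl x x' y : b (x + x') y = b x y + b x' y.
Proof. exact: tpureDl. Qed.
Fact augI2_Dr x y y' : b x (y + y') = b x y + b x y'.
Proof.
rewrite /b -tpureDr; congr tpure; apply: val_inj.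
by rewrite /= mulrDl.
Qed.
Fact augI2_A x c y : b (augI_ract x c) y = b x (augI_lact c y).
Proof.
rewrite /b tpureA; congr tpure; apply: val_inj.
by rewrite /= mulrA.
Qed.

Definition augI2_ract_map : {additive augI2 -> augI2} :=
  tensor_lift augI2_Dl augI2_Dr augI2_A.
End Ract.

Definition augI2_ract (x : augI2) (a : zgring G) : augI2 := augI2_ract_map a x.

(* (g (x)_{Z[G]} g) (x)_{Z[G]} g *)
Definition augI3 : zmodType := tensor augI2_ract augI_lact.
End AugmentationIdeal.

Section Abelianization.
Variable G : groupType.
Local Open Scope group_scope.

Definition commutator_pred (x : G) : Prop :=
  forall S : {pred G}, group_closed S -> (forall a b, [~ a, b] \in S) -> x \in S.

Definition commutator_sub : {pred G} := fun x => `[< commutator_pred x >].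

Fact commutator_closed : group_closed commutator_sub.
Proof.
split=> [|x y /asboolP hx /asboolP hy]; apply/asboolP => S SG SC.
  by case: SG.
by case: (SG) => _; apply; [apply: hx|apply: hy].
Qed.

Fact commutator_in a b : [~ a, b] \in commutator_sub.
Proof. by apply/asboolP => S _; apply. Qed.

Let commM := group_closedM commutator_closed.
Let commV := group_closedV commutator_closed.

Fact commutator_conj x y : x \in commutator_sub -> x ^ y \in commutator_sub.
Proof.
move=> hx; have -> : x ^ y = x * [~ x, y] by rewrite commgEl mulVKg.
exact: commM hx (commutator_in _ _).
Qed.

Definition ab_equiv (x y : G) : bool := (x / y) \in commutator_sub.

Fact ab_equiv_class : equiv_class_of ab_equiv.
Proof.
split=> [x|x y|y x z]; rewrite /ab_equiv.
- by rewrite divgg; case: commutator_closed.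
- by apply/idP/idP => /commV; rewrite invgF.
- move=> h1 h2; have -> : x / z = (x / y) * (y / z) by rewrite mulgA mulgVK.
  exact: commM.
Qed.

Canonical ab_equiv_rel := EquivRelPack ab_equiv_class.

(* G / [G, G], written additively. *)
Definition Gab : Type := {eq_quot ab_equiv}.
HB.instance Definition _ : EqQuotient G ab_equiv Gab := EqQuotient.on Gab.
HB.instance Definition _ := Choice.on Gab.

Definition ab_pi (x : G) : Gab := \pi_Gab x.

Lemma ab_piP x y : ab_pi x = ab_pi y <-> x / y \in commutator_sub.
Proof. by split=> [/eqquotP|h]; last apply/eqquotP. Qed.

Definition ab0 : Gab := ab_pi 1.
Definition abN (u : Gab) : Gab := ab_pi (repr u)^-1.
Definition abD (u v : Gab) : Gab := ab_pi (repr u * repr v).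

Lemma ab_reprP x : exists2 c, c \in commutator_sub & repr (ab_pi x) = c * x.
Proof.
exists (repr (ab_pi x) / x); last by rewrite mulgVK.
by apply/ab_piP; rewrite /ab_pi reprK.
Qed.

Lemma ab_piD x y : ab_pi (x * y) = abD (ab_pi x) (ab_pi y).
Proof.
rewrite /abD; have [c hc ->] := ab_reprP x; have [d hd ->] := ab_reprP y.
apply/esym/ab_piP.
have -> : c * x * (d * y) / (x * y) = c * d ^ x^-1.
  have xVV : x^-1^-1 = x by exact: invgK.
  by rewrite invgM conjgE xVV !mulgA mulgK.
exact: commM hc (commutator_conj _ hd).
Qed.

Lemma ab_piN x : ab_pi x^-1 = abN (ab_pi x).
Proof.
rewrite /abN; have [c hc ->] := ab_reprP x; apply/ab_piP.
have -> : (c * x)^-1^-1 = c * x by exact: invgK.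
exact: commutator_conj.
Qed.

Fact abA : associative abD.
Proof.
move=> u v w; rewrite -[u]reprK -[v]reprK -[w]reprK.
by rewrite -!/(ab_pi _) -!ab_piD mulgA.
Qed.
Fact abC : commutative abD.
Proof.
move=> u v; rewrite -[u]reprK -[v]reprK -!/(ab_pi _) -!ab_piD.
apply/ab_piP; set x := repr u; set y := repr v.
have -> : x * y / (y * x) = [~ x^-1, y^-1] by rewrite (commgCV x y) mulgK.
exact: commutator_in.
Qed.
Fact ab0D : left_id ab0 abD.
Proof. by move=> u; rewrite -[u]reprK -!/(ab_pi _) -ab_piD mul1g. Qed.
Fact abND : left_inverse ab0 abN abD.
Proof. by move=> u; rewrite -[u]reprK -!/(ab_pi _) -ab_piN -ab_piD mulVg. Qed.

HB.instance Definition _ := GRing.isZmodule.Build Gab abA abC ab0D abND.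

Lemma ab_piM x y : ab_pi (x * y) = (ab_pi x + ab_pi y)%R.
Proof. exact: ab_piD. Qed.
End Abelianization.

Arguments commutator_sub : clear implicits.

Section AbelianizationMap.
Variables (G H : groupType) (f : {multiplicative G -> H}).

Definition ab_fun (u : Gab G) : Gab H := ab_pi (f (repr u)).

Fact commutator_map x : x \in commutator_sub G -> f x \in commutator_sub H.
Proof.
have fF a b : f (a / b)%g = (f a / f b)%g.
  by apply: (@mulIg _ (f b)); rewrite -gmulfM !mulgVK.
move=> /asboolP h; apply: (h [pred y | f y \in commutator_sub H]).
  split=> [|a b]; rewrite !inE.
    by rewrite mulg_morph1; case: (@commutator_closed H).
  by rewrite fF; case: (@commutator_closed H) => _; apply.
move=> a b; rewrite inE.
have fV c : f c^-1%g = (f c)^-1%g by rewrite -div1g fF mulg_morph1 div1g.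
by rewrite commgEl conjgE !gmulfM !fV; apply: commutator_in.
Qed.

Lemma ab_funE x : ab_fun (ab_pi x) = ab_pi (f x).
Proof.
rewrite /ab_fun; have [c hc ->] := ab_reprP x; apply/ab_piP.
by rewrite gmulfM mulgK commutator_map.
Qed.

Fact ab_fun_additive : zmod_morphism ab_fun.
Proof.
have fD u v : ab_fun (u + v) = ab_fun u + ab_fun v.
  rewrite -[u]reprK -[v]reprK -!/(ab_pi _) -ab_piM !ab_funE.
  by rewrite gmulfM ab_piM.
by move=> u v; apply: (@addIr _ (ab_fun v)); rewrite -fD !subrK.
Qed.

HB.instance Definition _ :=
  GRing.isZmodMorphism.Build (Gab G) (Gab H) ab_fun ab_fun_additive.
Definition ab_map : {additive Gab G -> Gab H} := ab_fun.
End AbelianizationMap.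

Record category := Category {
  ob :> Type;
  hom : ob -> ob -> Type;
  idc : forall c, hom c c;
  compc : forall a b c, hom b c -> hom a b -> hom a c;
  compcA : forall a b c d (h : hom c d) (g : hom b c) (f : hom a b),
    compc h (compc g f) = compc (compc h g) f;
  compc1 : forall a b (f : hom a b), compc f (idc a) = f;
  comp1c : forall a b (f : hom a b), compc (idc b) f = f }.

Record functor (C D : category) := Functor {
  fun_ob :> C -> D;
  fun_hom : forall a b, hom a b -> hom (fun_ob a) (fun_ob b);
  fun_id : forall a, fun_hom (idc a) = idc (fun_ob a);
  fun_comp : forall a b c (g : hom b c) (f : hom a b),
    fun_hom (compc g f) = compc (fun_hom g) (fun_hom f) }.

Record abfunctor (C : category) := AbFunctor {
  af_ob :> C -> zmodType;
  af_hom : forall a b, hom a b -> {additive af_ob a -> af_ob b};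
  af_id : forall a x, af_hom (idc a) x = x;
  af_comp : forall a b c (g : hom b c) (f : hom a b) x,
    af_hom (compc g f) x = af_hom g (af_hom f x) }.

Record nat_trans (C : category) (F G : abfunctor C) := NatTrans {
  nt_app :> forall c, {additive F c -> G c};
  nt_nat : forall a b (u : hom a b) x,
    nt_app b (af_hom F u x) = af_hom G u (nt_app a x) }.

Section Limit.
Variable C : category.

Fact lim_closed (F : abfunctor C) :
  zmod_closed [pred x : dprod F |
    `[< forall a b (u : hom a b), af_hom F u (x a) = x b >]].
Proof.
split=> [|x y /asboolP hx /asboolP hy]; apply/asboolP => a b u.
  exact: raddf0.
by rewrite [LHS](raddfB (af_hom F u) (x a) (y a)) hx hy.
Qed.

Definition lim_sub (F : abfunctor C) : zmodClosed (dprod F) :=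
  mk_sub (@lim_closed F).

Definition lim (F : abfunctor C) : zmodType := subz (lim_sub F).

Section LimMap.
Variables (F G : abfunctor C) (t : nat_trans F G).

Definition dprod_map_fun (x : dprod F) : dprod G := fun c => t c (x c).
Fact dprod_map_additive : zmod_morphism dprod_map_fun.
Proof.
by move=> x y; apply/functional_extensionality_dep => c; apply: raddfB.
Qed.
HB.instance Definition _ :=
  GRing.isZmodMorphism.Build (dprod F) (dprod G) dprod_map_fun dprod_map_additive.

Fact lim_map_subproof x : x \in lim_sub F -> dprod_map_fun x \in lim_sub G.
Proof.
move=> /asboolP h; apply/asboolP => a b u.
by rewrite /dprod_map_fun -nt_nat h.
Qed.

Definition lim_map : {additive lim F -> lim G} := subz_map lim_map_subproof.

Lemma lim_mapE x c : val (lim_map x) c = t c (val x c).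
Proof. by []. Qed.
End LimMap.

Definition injective_obj (I : abfunctor C) : Prop :=
  forall (A B : abfunctor C) (i : nat_trans A B) (h : nat_trans A I),
    (forall c, injective (i c)) ->
    exists k : nat_trans B I, forall c x, k c (i c x) = h c x.

(* Injective resolutions 0 -> F -> I^0 -> I^1 -> ... in Ab^C. *)
Record inj_res (F : abfunctor C) := InjRes {
  ir_ob :> nat -> abfunctor C;
  ir_d : forall n, nat_trans (ir_ob n) (ir_ob n.+1);
  ir_aug : nat_trans F (ir_ob 0);
  ir_inj : forall n, injective_obj (ir_ob n);
  ir_aug_inj : forall c, injective (ir_aug c);
  ir_exact0 : forall c x, ir_d 0 c x = 0 <-> exists y, ir_aug c y = x;
  ir_exact : forall n c x,
    ir_d n.+1 c x = 0 <-> exists y, ir_d n c y = x }.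

(* lim^n F, computed with the injective resolution R of F:
   the n-th cohomology of lim I^0 -> lim I^1 -> ... *)
Definition limD (F : abfunctor C) (R : inj_res F) (n : nat) : zmodType :=
  match n with
  | 0 => homology (\0 : {additive lim (R 0) -> lim (R 0)}) (lim_map (ir_d R 0))
  | m.+1 => homology (lim_map (ir_d R m)) (lim_map (ir_d R m.+1))
  end.

End Limit.

(* Functoriality of lim^n along a functor Phi : D -> C and a natural
   transformation F \o Phi -> G. *)
Section Reindex.
Variables (C D : category) (Phi : functor D C).

Section Pullback.
Variable F : abfunctor C.
Let pb_hom a b (u : hom a b) : {additive F (Phi a) -> F (Phi b)} :=
  af_hom F (fun_hom Phi u).
Fact pb_id a x : pb_hom (idc a) x = x.
Proof. by rewrite /pb_hom fun_id af_id. Qed.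
Fact pb_comp a b c (g : hom b c) (f : hom a b) x :
  pb_hom (compc g f) x = pb_hom g (pb_hom f x).
Proof. by rewrite /pb_hom fun_comp af_comp. Qed.
Definition pullback : abfunctor D := AbFunctor pb_id pb_comp.

Definition dprod_pull_fun (x : dprod F) : dprod pullback := fun d => x (Phi d).
Fact dprod_pull_additive : zmod_morphism dprod_pull_fun.
Proof. by []. Qed.
HB.instance Definition _ :=
  GRing.isZmodMorphism.Build (dprod F) (dprod pullback)
    dprod_pull_fun dprod_pull_additive.

Fact lim_pull_subproof x : x \in lim_sub F -> dprod_pull_fun x \in lim_sub pullback.
Proof. by move=> /asboolP h; apply/asboolP => a b u; apply: h. Qed.

Definition lim_pull : {additive lim F -> lim pullback} :=
  subz_map lim_pull_subproof.
End Pullback.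

Variables (F : abfunctor C) (G : abfunctor D) (t : nat_trans (pullback F) G).
Variables (I : inj_res F) (J : inj_res G).

Record res_map := ResMap {
  rm_app :> forall n, nat_trans (pullback (I n)) (J n);
  rm_aug : forall d x, rm_app 0 d (ir_aug I (Phi d) x) = ir_aug J d (t d x);
  rm_d : forall n d x,
    rm_app n.+1 d (ir_d I n (Phi d) x) = ir_d J n d (rm_app n d x) }.

Variable m : res_map.

Definition lim_res_map n : {additive lim (I n) -> lim (J n)} :=
  lim_map (m n) \o lim_pull (I n).

Fact lim_res_map_d n x :
  lim_map (ir_d J n) (lim_res_map n x) = lim_res_map n.+1 (lim_map (ir_d I n) x).
Proof.
apply: val_inj; apply/functional_extensionality_dep => d.
exact: esym (rm_d m (val x (Phi d))).
Qed.

Fact lim_res_map_0 (x : lim (I 0)) :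
  (\0 : {additive lim (J 0) -> lim (J 0)}) (lim_res_map 0 x) =
  lim_res_map 0 ((\0 : {additive lim (I 0) -> lim (I 0)}) x).
Proof. exact: esym (raddf0 (lim_res_map 0)). Qed.

Definition limD_map (n : nat) : {additive limD I n -> limD J n} :=
  match n with
  | 0 => homology_map lim_res_map_0 (lim_res_map_d (n := 0))
  | k.+1 => homology_map (lim_res_map_d (n := k)) (lim_res_map_d (n := k.+1))
  end.

End Reindex.

(* Groups range over a universe strictly below that of [zmodType], so that
   limits over Pres(G) are again of type [zmodType]; [groupType] itself lives
   in the same universe as [zmodType]. *)
Definition smallType : Type := Type.

Record smallGroup := SmallGroup {
  sg_sort : smallType;
  sg_class : Group.axioms_ sg_sort }.

Coercion sg_group (G : smallGroup) : groupType := Group.Pack (sg_class G).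

Definition is_free (F : smallGroup) : Prop :=
  exists (X : smallType) (i : X -> F),
    forall (H : smallGroup) (h : X -> H),
      (exists f : {multiplicative F -> H}, forall x, f (i x) = h x) /\
      (forall f g : {multiplicative F -> H},
         (forall x, f (i x) = g (i x)) -> f =1 g).

Record pres (G : smallGroup) := Pres {
  pres_src : smallGroup;
  pres_free : is_free pres_src;
  pres_map : {multiplicative pres_src -> G};
  pres_surj : forall g : G, exists x, pres_map x = g }.

(* Morphisms of presentations over a map f : G -> H. *)
Record pres_over (G H : smallGroup) (f : G -> H) (c : pres G) (d : pres H) :=
  PresOver {
    po_map :> {multiplicative pres_src c -> pres_src d};
    po_over : forall x, pres_map d (po_map x) = f (pres_map c x) }.

Lemma multiplicative_eq (G H : groupType) (f g : {multiplicative G -> H}) :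
  f =1 g -> f = g.
Proof.
case: f g => f [[fM]] [g [[gM]]] /= /funext fg; subst g.
by rewrite (Prop_irrelevance fM gM).
Qed.

Lemma pres_over_eq G H f c d (u v : @pres_over G H f c d) :
  (forall x, u x = v x) -> u = v.
Proof.
case: u v => u hu [v hv] /= uv; have e : u = v by apply: multiplicative_eq.
by subst v; rewrite (Prop_irrelevance hu hv).
Qed.

Section PresCategory.
Variable G : smallGroup.
Notation phom := (@pres_over G G idfun).

Fact pres_id_over (c : pres G) x :
  pres_map c ((idfun : {multiplicative pres_src c -> pres_src c}) x) =
  idfun (pres_map c x).
Proof. by []. Qed.
Definition pres_id (c : pres G) : phom c c := PresOver (@pres_id_over c).

Fact pres_comp_over a b c (v : phom b c) (u : phom a b) x :
  pres_map c ((v \o u : {multiplicative pres_src a -> pres_src c}) x) =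
  idfun (pres_map a x).
Proof. by rewrite /= !po_over. Qed.
Definition pres_comp a b c (v : phom b c) (u : phom a b) : phom a c :=
  PresOver (@pres_comp_over a b c v u).

Fact pres_compA a b c d (h : phom c d) (g : phom b c) (f : phom a b) :
  pres_comp h (pres_comp g f) = pres_comp (pres_comp h g) f.
Proof. exact: pres_over_eq. Qed.
Fact pres_comp1 a b (f : phom a b) : pres_comp f (pres_id a) = f.
Proof. exact: pres_over_eq. Qed.
Fact pres_comp1l a b (f : phom a b) : pres_comp (pres_id b) f = f.
Proof. exact: pres_over_eq. Qed.

Definition Pres_cat : category := Category pres_compA pres_comp1 pres_comp1l.
End PresCategory.

Section Ideal.
Variables (G : smallGroup) (c : pres G).
Definition idl_f : zmodClosed (zgring (pres_src c)) := ker (aug (pres_src c)).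
Definition idl_r : zmodClosed (zgring (pres_src c)) := ker (zg_map (pres_map c)).
Local Notation "I ** J" := (idealM I J) (at level 40, left associativity).
Local Notation "I ++ J" := (idealD I J).
Definition idl_main : zmodClosed (zgring (pres_src c)) :=
  (idl_f ** idl_f ** idl_r) ++ (idl_f ** idl_r ** idl_f)
  ++ (idl_r ** idl_f ** idl_f) ++ (idl_r ** idl_r).
End Ideal.

Section IdealMapOver.
Variables (G H : smallGroup) (f : {multiplicative G -> H}).
Variables (c : pres G) (d : pres H) (u : pres_over f c d).

Fact idl_f_map x : x \in idl_f c -> zg_map u x \in idl_f d.
Proof. by move=> /mem_ker x0; apply/mem_ker; apply: etrans (aug_zg_map u x) x0. Qed.

Fact idl_r_map x : x \in idl_r c -> zg_map u x \in idl_r d.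
Proof.
move=> /mem_ker x0; apply/mem_ker.
have e := zg_map_comp (f := u) (g := pres_map d) (f' := pres_map c) (g' := f)
  (po_over u) x.
exact: etrans e (etrans (congr1 (zg_map f) x0) (raddf0 _)).
Qed.

Fact idl_main_map x : x \in idl_main c -> zg_map u x \in idl_main d.
Proof.
have fP := idl_f_map; have rP := idl_r_map; move: x.
by do ![apply: idealD_map | apply: idealM_map].
Qed.

Definition main_map : {additive subz (idl_main c) -> subz (idl_main d)} :=
  subz_map idl_main_map.

Lemma main_mapE x : val (main_map x) = zg_map u (val x). Proof. by []. Qed.
End IdealMapOver.

Section MainFunctor.
Variable G : smallGroup.

Fact main_id (c : Pres_cat G) x :
  main_map (f := idfun) (idc c : pres_over _ _ _) x = x.
Proof. by apply: val_inj; rewrite main_mapE; apply: zg_map_id. Qed.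

Fact main_comp (a b c : Pres_cat G) (v : hom b c) (u : hom a b) x :
  main_map (f := idfun) (compc v u : pres_over _ _ _) x =
  main_map (f := idfun) (v : pres_over _ _ _)
    (main_map (f := idfun) (u : pres_over _ _ _) x).
Proof.
apply: val_inj; rewrite !main_mapE.
have := zg_map_comp (f := po_map u) (g := po_map v) (f' := idfun)
  (g' := po_map (compc v u : pres_over _ _ _)) (fun=> erefl) (val x).
by rewrite (zg_map_id (f := idfun)) // => ->.
Qed.

Definition main_functor : abfunctor (Pres_cat G) :=
  AbFunctor main_id main_comp.
End MainFunctor.

(* Data expressing the functoriality in G of limits over Pres(G): for
   f : G -> H, a functor Pres(H) -> Pres(G) together with morphisms of
   presentations Phi(d) -> d over f, natural in d. An example sends F ->> H to
   the free group on the underlying set of F x_H G; any two choices induce the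
   same map on lim^n. *)
Record pres_lift (G H : smallGroup) (f : {multiplicative G -> H}) := PresLift {
  pl_fun :> functor (Pres_cat H) (Pres_cat G);
  pl_over : forall d : Pres_cat H, pres_over f (pl_fun d) d;
  pl_nat : forall (a b : Pres_cat H) (u : hom a b) x,
    pl_over b (po_map (fun_hom pl_fun u) x) = po_map u (pl_over a x) }.

Section MainLift.
Variables (G H : smallGroup) (f : {multiplicative G -> H}) (L : pres_lift f).

Fact main_lift_nat (a b : Pres_cat H) (u : hom a b) x :
  main_map (pl_over L b) (af_hom (pullback L (main_functor G)) u x) =
  af_hom (main_functor H) u (main_map (pl_over L a) x).
Proof.
apply: val_inj; rewrite !main_mapE.
exact: (zg_map_comp (f := po_map (fun_hom L u)) (g := pl_over L b)
  (f' := pl_over L a) (g' := po_map u) (pl_nat (p := L) u) (val x)).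
Qed.

Definition main_lift : nat_trans (pullback L (main_functor G)) (main_functor H) :=
  @NatTrans _ (pullback L (main_functor G)) (main_functor H)
    (fun d => main_map (pl_over L d)) main_lift_nat.
End MainLift.

(* Main.v *)
Require Import Defs.
From HB Require Import structures.
From mathcomp Require Import all_boot all_order all_algebra.
From mathcomp Require Import finmap boolp monalg zify.

Set Implicit Arguments.
Unset Strict Implicit.
Unset Printing Implicit Defensive.

Import GRing.Theory.
Local Open Scope quotient_scope.
Local Open Scope ring_scope.

Local Notation hom := Defs.hom.

(* Let [c] be a weakly initial presentation and [c, c + c, c + c + c, ...] its
   copowers. Injective functors are acyclic for the cochain complex
   [F c -> F (c + c) -> ...], so a staircase argument identifies [lim^n F] with
   its [n]-th cohomology. Write [I = ffr + frf + rff + rr], [A = rf + fff],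
   [B = fr + fff], [N = fff + rr] and [D = r + ff]. Deleting the first summand
   contracts the complexes of [ff], [ff / A] and [ff / B], while on
   [(A & B) / I] and on [ff / (A + B)] parallel morphisms of presentations agree.
   Hence [lim^1 I = (A & B) / I], [lim^2 I = ff / (A + B) = f / D (x) f / D], which
   is [G_ab (x) G_ab], and [lim^i I = 0] for [i >= 3].

   In degree one, [(A & B) / I] is filtered by [N / I], and [f] being a free
   [Z[F]]-module gives [N / I = fff / (fff & I) = g (x) g (x) g]. The quotient
   [(A & B) / N] is the kernel of [D / ff (x) G_ab -> f / ff (x) G_ab], that is
   [Tor (G_ab, G_ab)], since [D / ff -> f / ff] is a free resolution of [G_ab]. *)

(** The degrees come from three short exact sequences: [I -> ff -> ff / I], then
    [(A & B) / I -> ff / I -> ff / (A & B)], then the Mayer-Vietoris sequence of [ff / A] and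
    [ff / B] over [ff / (A + B)]. As [ff], [ff / A] and [ff / B] have no cohomology, the constant
    functor [(A & B) / I] is shifted once and [ff / (A + B)] twice. The shape of [A] and [B] is
    dictated by the contraction: deleting a summand is not a map over [G] and spoils [r]. When [r]
    sits in one factor only, that factor is moved by a map over [G] and the other one by the
    deletion, and [fff] absorbs the mismatch. Additive maps out of products of ideals all come from
    the freeness of [f], through [fox_lift]. The delicate point in degree one is that [rr & fff]
    dies in the triple tensor product; this is flatness of subgroups of a free abelian group, made
    explicit by Euclid's algorithm. Lifts and primitives are kept as additive relations and become
    maps only through [graph_map], so naturality needs no coherent choices. *)

Lemma mulg_morphV (G H : groupType) (f : {multiplicative G -> H}) (x : G) :
  f x^-1%g = (f x)^-1%g.
Proof. by apply: (@mulgI _ (f x)); rewrite -gmulfM !mulgV mulg_morph1. Qed.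

(** * Free groups *)

Section FreeGroup.
Variable X : smallType.
Local Open Scope group_scope.

(* [list] and not [seq]: the alias is not universe polymorphic. *)
Definition word : smallType := list (X * bool).
HB.instance Definition _ := gen_eqMixin word.
HB.instance Definition _ := gen_choiceMixin word.

Inductive weq : word -> word -> Prop :=
| WeqCancel x b (s t : word) : weq (s ++ [:: (x, b), (x, ~~ b) & t]) (s ++ t)
| WeqRefl s : weq s s
| WeqSym s t : weq s t -> weq t s
| WeqTrans s t u : weq s t -> weq t u -> weq s u.

Lemma weq_cat s s' t t' : weq s s' -> weq t t' -> weq (s ++ t) (s' ++ t').
Proof.
move=> hs ht; apply: (@WeqTrans _ (s' ++ t)).
  elim: hs => [x b u v|u|u v _|u v w _ h1 _ h2]; last exact: WeqTrans h1 h2.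
  - by rewrite -!catA; apply: WeqCancel.
  - exact: WeqRefl.
  - exact: WeqSym.
elim: ht => [x b u v|u|u v _|u v w _ h1 _ h2]; last exact: WeqTrans h1 h2.
- by rewrite !catA; apply: WeqCancel.
- exact: WeqRefl.
- exact: WeqSym.
Qed.

Definition winv (s : word) : word := rev [seq (p.1, ~~ p.2) | p <- s].

Lemma winvK : involutive winv.
Proof.
move=> s; rewrite /winv map_rev revK -map_comp -[RHS]map_id.
by apply: eq_map => -[x b] /=; rewrite negbK.
Qed.

Lemma winv_cat s t : winv (s ++ t) = winv t ++ winv s.
Proof. by rewrite /winv map_cat rev_cat. Qed.

Lemma weq_inv s t : weq s t -> weq (winv s) (winv t).
Proof.
elim=> [x b u v|u|u v _|u v w _ h1 _ h2]; last exact: WeqTrans h1 h2.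
- have -> : winv (u ++ [:: (x, b), (x, ~~ b) & v]) =
            winv v ++ [:: (x, b), (x, ~~ b) & winv u].
    by rewrite winv_cat /winv /= negbK !rev_cons -!cats1 -!catA.
  by rewrite winv_cat; apply: WeqCancel.
- exact: WeqRefl.
- exact: WeqSym.
Qed.

Lemma weq_mulV s : weq (winv s ++ s) [::].
Proof.
elim: s => [|[x b] s ih]; first exact: WeqRefl.
rewrite -cat1s winv_cat -catA.
apply: WeqTrans ih; rewrite -[b in X in winv s ++ (_ ++ X)]negbK.
exact: (@WeqCancel x (~~ b)).
Qed.

Lemma weq_mul_inv s : weq (s ++ winv s) [::].
Proof. by rewrite -{1}[s]winvK; apply: weq_mulV. Qed.

Definition wcanon (s : word) : word := choose (fun t => `[< weq s t >]) s.

Lemma wcanonP s : weq s (wcanon s).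
Proof. by apply/asboolP/(@chooseP _ (fun t => `[< weq s t >]))/asboolP/WeqRefl. Qed.

(** [choose] depends only on the extension of the predicate once its default satisfies it, so a
    class has a single representative. *)
Lemma wcanon_eq s t : weq s t -> wcanon s = wcanon t.
Proof.
move=> h; rewrite /wcanon (@eq_choose _ _ (fun u => `[< weq t u >])).
  by apply: choose_id; apply/asboolP; [exact: WeqSym|exact: WeqRefl].
move=> u; apply/asboolP/asboolP; last exact: WeqTrans.
by apply: WeqTrans; apply: WeqSym.
Qed.

(* [{eq_quot _}] lives in the universe of [choiceType], which is above
   [smallType]; a subtype of words stays small. *)
Definition Fr : smallType := {s : word | wcanon s == s}.
HB.instance Definition _ := Choice.on Fr.

Fact wpi_subproof s : wcanon (wcanon s) == wcanon s.
Proof. by rewrite -(wcanon_eq (wcanonP s)). Qed.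
Definition wpi (s : word) : Fr := exist _ (wcanon s) (wpi_subproof s).

Lemma wpiP s t : wpi s = wpi t <-> weq s t.
Proof.
split=> [[e]|/wcanon_eq e]; last exact: val_inj.
by apply: WeqTrans (wcanonP s) _; rewrite e; apply: WeqSym (wcanonP t).
Qed.

Lemma wpiK u : wpi (val u) = u.
Proof. exact/val_inj/eqP/(valP u). Qed.

Lemma repr_wpi s : weq (val (wpi s)) s.
Proof. by apply/wpiP; rewrite wpiK. Qed.

Lemma wpi_ind (P : Fr -> Prop) : (forall s, P (wpi s)) -> forall u, P u.
Proof. by move=> h u; rewrite -[u]wpiK; apply: h. Qed.

Definition Fr1 : Fr := wpi [::].
Definition FrM (u v : Fr) : Fr := wpi (val u ++ val v).
Definition FrV (u : Fr) : Fr := wpi (winv (val u)).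

Lemma FrME s t : FrM (wpi s) (wpi t) = wpi (s ++ t).
Proof. by apply/wpiP/weq_cat; apply: repr_wpi. Qed.
Lemma FrVE s : FrV (wpi s) = wpi (winv s).
Proof. by apply/wpiP/weq_inv/repr_wpi. Qed.

Fact FrA : associative FrM.
Proof.
elim/wpi_ind=> s; elim/wpi_ind=> t; elim/wpi_ind=> u.
by rewrite !FrME catA.
Qed.
Fact Fr1M : left_id Fr1 FrM.
Proof. by elim/wpi_ind=> s; rewrite FrME. Qed.
Fact FrM1 : right_id Fr1 FrM.
Proof. by elim/wpi_ind=> s; rewrite FrME cats0. Qed.
Fact FrVM : left_inverse Fr1 FrV FrM.
Proof. by elim/wpi_ind=> s; rewrite FrVE FrME; apply/wpiP/weq_mulV. Qed.
Fact FrMV : right_inverse Fr1 FrV FrM.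
Proof. by elim/wpi_ind=> s; rewrite FrVE FrME; apply/wpiP/weq_mul_inv. Qed.

HB.instance Definition _ := isGroup.Build Fr FrA Fr1M FrM1 FrVM FrMV.

Definition gen (x : X) : Fr := wpi [:: (x, true)].

Lemma gen_inv x : (gen x)^-1 = wpi [:: (x, false)].
Proof. exact: FrVE. Qed.

Lemma Fr_ind (P : Fr -> Prop) :
    P 1 -> (forall x, P (gen x)) -> (forall u, P u -> P u^-1) ->
    (forall u v, P u -> P v -> P (u * v)) -> forall u, P u.
Proof.
move=> h1 hg hV hM; elim/wpi_ind; elim=> [|[x b] s ih] //.
have -> : wpi ((x, b) :: s) = wpi [:: (x, b)] * wpi s by rewrite -[RHS]/(FrM _ _) FrME.
by apply: hM => //; case: b; [exact: hg|rewrite -gen_inv; apply: hV].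
Qed.

Section Ext.
Variables (H : groupType) (h : X -> H).

Definition lett (p : X * bool) : H := if p.2 then h p.1 else (h p.1)^-1.
Definition ev (s : word) : H := \prod_(p <- s) lett p.

Lemma ev_cat s t : ev (s ++ t) = ev s * ev t.
Proof. exact: big_cat. Qed.

Lemma ev_weq s t : weq s t -> ev s = ev t.
Proof.
elim=> // [x b u v|u v w _ h1 _ h2]; last by rewrite h1.
rewrite !ev_cat /ev !big_cons; congr (_ * _).
by rewrite mulgA /lett; case: b => /=; rewrite (mulgV, mulVg) mul1g.
Qed.

Definition fr_ext_fun (u : Fr) : H := ev (val u).

Lemma fr_ext_funE s : fr_ext_fun (wpi s) = ev s.
Proof. exact: ev_weq (repr_wpi s). Qed.

Fact fr_ext_mul : {morph fr_ext_fun : u v / u * v}.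
Proof.
elim/wpi_ind=> s; elim/wpi_ind=> t.
by rewrite -[wpi s * _]/(FrM _ _) FrME !fr_ext_funE ev_cat.
Qed.

HB.instance Definition _ := monoid.isMultiplicative.Build Fr H fr_ext_fun fr_ext_mul.
Definition fr_ext : {multiplicative Fr -> H} := fr_ext_fun.

Lemma fr_extE x : fr_ext (gen x) = h x.
Proof. by rewrite /fr_ext /= fr_ext_funE /ev big_seq1. Qed.
End Ext.

Definition FrG : smallGroup := @SmallGroup Fr (Group.class Fr).
End FreeGroup.

(** Unlike in [is_free], the targets range over every [groupType]: the semidirect products built
    below carry large modules. Uniqueness is replaced by generation in the form of an induction
    principle, from which it follows. *)
Record free_basis (F : groupType) (X : Type) (g : X -> F) : Prop := FreeBasis {
  fb_ext : forall (H : groupType) (h : X -> H),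
    exists f : {multiplicative F -> H}, forall x, f (g x) = h x;
  fb_ind : forall P : F -> Prop,
    P 1%g -> (forall x, P (g x)) -> (forall u, P u -> P u^-1%g) ->
    (forall u v, P u -> P v -> P (u * v)%g) -> forall u, P u }.

Lemma Fr_basis (X : smallType) : free_basis (F := FrG X) (@gen X).
Proof.
by split=> [H h|]; [exists (fr_ext h) => x; apply: fr_extE|exact: Fr_ind].
Qed.

Lemma free_basis_eq (F : groupType) (X : Type) (g : X -> F) (H : groupType)
    (f1 f2 : {multiplicative F -> H}) :
  free_basis g -> (forall x, f1 (g x) = f2 (g x)) -> f1 =1 f2.
Proof.
move=> gB e; elim/(fb_ind gB) => // [|u eu|u v eu ev].
- by rewrite !mulg_morph1.
- by rewrite !mulg_morphV eu.
- by rewrite !gmulfM eu ev.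
Qed.

Lemma FrG_free (X : smallType) : is_free (FrG X).
Proof.
exists X, (@gen X) => H h; split; first exact: fb_ext (Fr_basis X) H h.
by move=> f1 f2; apply: free_basis_eq (Fr_basis X).
Qed.

(** * Fox calculus *)

Section CrossedHom.
Variables (F : groupType) (X : Type) (gn : X -> F) (gnB : free_basis gn).
Variables (M : zmodType) (act : F -> {additive M -> M}).
Hypothesis act1 : forall m, act 1%g m = m.
Hypothesis actM : forall u v m, act (u * v)%g m = act u (act v m).

(** A crossed homomorphism is the first component of a homomorphic section of the semidirect product
    of [M] and [F], and such a section can be prescribed on a basis. *)
Lemma crossed_hom (e : X -> M) :
  exists D : F -> M, (forall x, D (gn x) = e x) /\
    forall u v, D (u * v)%g = D u + act u (D v).
Proof.
pose sM (p q : M * F) := (p.1 + act p.2 q.1, (p.2 * q.2)%g).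
pose sV (p : M * F) := (- act p.2^-1%g p.1, p.2^-1%g).
have sA : associative sM.
  move=> [a u] [b v] [c w]; rewrite /sM /= mulgA actM.
  by rewrite [act u (_ + _)]raddfD addrA.
have s1 : left_id ((0 : M), (1%g : F)) sM.
  by move=> [a u]; rewrite /sM /= act1 add0r mul1g.
have s1' : right_id ((0 : M), (1%g : F)) sM.
  by move=> [a u]; rewrite /sM /= raddf0 addr0 mulg1.
have sVl : left_inverse ((0 : M), (1%g : F)) sV sM.
  by move=> [a u]; rewrite /sM /sV /= addNr mulVg.
have sVr : right_inverse ((0 : M), (1%g : F)) sV sM.
  by move=> [a u]; rewrite /sM /sV /= raddfN /= -actM mulgV act1 subrr.
pose E : groupType := HB.pack (M * F)%type (isGroup.Build _ sA s1 s1' sVl sVr).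
have [f fE] := fb_ext gnB (fun x => (e x, gn x) : E).
have f2 u : (f u).2 = u.
  elim/(fb_ind gnB): u => [|x|u eu|u v eu ev].
  - by rewrite mulg_morph1.
  - by rewrite fE.
  - by rewrite mulg_morphV /= eu.
  - by rewrite gmulfM /= eu ev.
exists (fun u => (f u).1); split=> [x|u v]; first by rewrite fE.
by rewrite gmulfM -{3}[u]f2.
Qed.
End CrossedHom.

Section QuotientMap.
Variables (V : zmodType) (I : zmodClosed V).

Definition qpi : {additive V -> Quotient.quot I} := \pi_(Quotient.quot I).

Lemma qpi_ind (P : Quotient.quot I -> Prop) : (forall x, P (qpi x)) -> forall q, P q.
Proof. by move=> h q; rewrite -[q]reprK; apply: h. Qed.

Lemma qpi_eq x y : qpi x = qpi y <-> x - y \in I.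
Proof. by rewrite Quotient.idealrBE; split=> [e|/eqP//]; apply/eqP. Qed.

Lemma qpi_eq0 x : qpi x = 0 <-> x \in I.
Proof. by have := qpi_eq x 0; rewrite raddf0 subr0. Qed.

Lemma qpi_lift (W : zmodType) (f : {additive V -> W}) (fI : forall x, x \in I -> f x = 0) x :
  quot_lift fI (qpi x) = f x.
Proof. exact: quot_funE. Qed.
End QuotientMap.
Arguments qpi {V} I.

Lemma malg_ind (K : choiceType) (P : {malg int[K]} -> Prop) :
    (forall k : K, P (mkmalgU k 1)) -> (forall x y, P x -> P y -> P (x - y)) ->
    P 0 -> forall x, P x.
Proof.
move=> hU hB h0.
have hN x : P x -> P (- x) by rewrite -sub0r; apply: hB.
have hD x y : P x -> P y -> P (x + y) by move=> hx /hN; rewrite -{2}[y]opprK; apply: hB.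
have hM x n : P x -> P (x *+ n) by move=> hx; elim: n => [//|n ih]; rewrite mulrS; apply: hD.
have hZ x (k : int) : P x -> P (x *~ k).
  by move=> hx; case: k => n; [apply: hM|rewrite NegzE mulrNz; apply/hN/hM].
move=> x; rewrite [x]monalgE; apply: (big_ind P) => // k _.
suff -> : << x@_k *g k >> = mkmalgU k 1 *~ x@_k :> {malg int[K]} by apply: hZ.
by apply/malgP => k'; rewrite raddfMz /= !mcoeffU;
  case: eqP => _; rewrite ?mulr1n ?mulr0n ?intz ?mul0rz.
Qed.

Lemma zg_ind (G : groupType) (P : zgring G -> Prop) :
    (forall g, P (zgU g)) -> (forall x y, P x -> P y -> P (x - y)) ->
  forall x, P x.
Proof.
move=> hU hB; apply: malg_ind => //.
by rewrite -(subrr (zgU 1%g)); apply: (hB _ _ (hU _) (hU _)).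
Qed.

Section RingMaps.
Variables (G H : groupType) (f : {multiplicative G -> H}).
Implicit Types x y : zgring G.

Lemma aug_zgU (g : G) : aug G (zgU g) = 1.
Proof. exact: zg_extU. Qed.
Lemma augB x y : aug G (x - y) = aug G x - aug G y.
Proof. exact: raddfB. Qed.
Lemma augM x y : aug G (x * y) = aug G x * aug G y.
Proof. exact: (rmorphM (aug G)). Qed.
Lemma zg_mapB x y : zg_map f (x - y) = zg_map f x - zg_map f y.
Proof. exact: raddfB. Qed.
Lemma zg_map_mul x y : zg_map f (x * y) = zg_map f x * zg_map f y.
Proof. exact: (rmorphM (zg_map f)). Qed.

Lemma mem_ker_aug x : x \in ker (aug G) <-> aug G x = 0.
Proof. exact: mem_ker. Qed.
Lemma mem_ker_zg x : x \in ker (zg_map f) <-> zg_map f x = 0.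
Proof. exact: mem_ker. Qed.

Lemma zgU_mulB1 (g h : G) : zgU g * (zgU h - 1) = zgU (g * h)%g - zgU g.
Proof. by rewrite mulrBr (mulr1 (zgU g)) -(zgUM g h). Qed.

Lemma aug_zgUB (g h : G) : zgU g - zgU h \in ker (aug G).
Proof. by apply/mem_ker_aug; rewrite augB !aug_zgU subrr. Qed.
End RingMaps.

Section FoxLift.
Variables (F : groupType) (X : Type) (gn : X -> F) (gnB : free_basis gn).
Variable T : zmodType.
Local Notation ZF := (zgring F).
Variable b : ZF -> ZF -> T.
Hypothesis bBl : forall x x' y, b (x - x') y = b x y - b x' y.
Hypothesis bBr : forall x y y', b x (y - y') = b x y - b x y'.
Variable U : ZF -> Prop.
Hypothesis UM : forall a (w : F), U a -> U (a * zgU w).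
Hypothesis bA : forall a (w : F) y, U a -> y \in ker (aug F) ->
  b (a * zgU w) y = b a (zgU w * y).

(** The augmentation ideal of a free group is a free left [Z[F]]-module on the elements [gn x - 1],
    so a product determines the tensor of its factors and a balanced pairing descends to products.
    [Phi] lives on the whole ring, but it is prescribed only on products of [U] with the
    augmentation ideal. *)
Lemma fox_lift : exists Phi : {additive ZF -> T},
  forall x y, U x -> y \in ker (aug F) -> Phi (x * y) = b x y.
Proof.
(* The left argument [a] is carried as a parameter: [D u a] is meant to be [b a (zgU u - 1)], and
   the action [a * zgU u] encodes [uv - 1 = (u - 1) + u (v - 1)]. *)
pose M : zmodType := dprod (fun _ : ZF => T).
pose act (u : F) (m : M) : M := fun a => m (a * zgU u).
have actB u : zmod_morphism (act u) by [].
pose actA u : {additive M -> M} :=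
  HB.pack (act u) (GRing.isZmodMorphism.Build M M (act u) (actB u)).
have [||D [Dg DM]] := @crossed_hom F X gn gnB M actA _ _ (fun x => fun a => b a (zgU (gn x) - 1)).
- by move=> m; apply/funext => a; rewrite /= /act mulr1.
- move=> u v m; apply/funext => a; rewrite /= /act -mulrA.
  by congr (m (_ * _)); rewrite -zgUM.
have {}DM u v a : D (u * v)%g a = D u a + D v (a * zgU u) by rewrite DM.
have D1 a : D 1%g a = 0.
  by have := DM 1%g 1%g a; rewrite mulg1 mulr1 -{1}[D 1%g a]addr0 => /addrI.
have DV u a : D u^-1%g a = - D u (a * zgU u^-1%g).
  by apply/eqP; rewrite -addr_eq0 -DM mulVg D1.
(* Additivity in [a] propagates from the generators for every [a], even outside [U], where [b] need
   not be balanced. *)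
have DB u : zmod_morphism (D u).
  elim/(fb_ind gnB): u => [|x|u eu|u v eu ev] a a'.
  - by rewrite !D1 subr0.
  - by rewrite !Dg bBl.
  - by rewrite !DV mulrBl eu opprB opprK addrC.
  - by rewrite !DM mulrBl eu ev opprD addrACA.
have [Psi PU] : exists Psi : ZF -> {additive ZF -> T},
    forall a u, Psi a (zgU u) = D u a.
  by exists (fun a => malg_ext (fun u : F => D u a)) => a u; exact: malg_extU.
pose b' a : {additive ZF -> T} :=
  HB.pack (b a) (GRing.isZmodMorphism.Build ZF T (b a) (bBr a)).
have b0 a : b a 0 = 0 by exact: (raddf0 (b' a)).
have bDr a y y' : b a (y + y') = b a y + b a y' by exact: (raddfD (b' a)).
have DE u a : U a -> D u a = b a (zgU u - 1).
  elim/(fb_ind gnB): u a => [|x|u eu|u v eu ev] a Ua.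
  - by rewrite D1 subrr b0.
  - by rewrite Dg.
  - rewrite DV eu; last exact: UM.
    rewrite bA //; last exact: aug_zgUB.
    rewrite -[LHS]sub0r -(b0 a) -bBr; congr (b a _).
    by rewrite zgU_mulB1 mulVg sub0r opprB.
  - rewrite DM eu // ev; last exact: UM.
    rewrite bA //; last exact: aug_zgUB.
    rewrite -bDr zgU_mulB1; congr (b a _).
    by rewrite addrC addrA subrK.
have PsiE a y : U a -> Psi a y = b a (y - (aug F y)%:~R).
  move=> Ua; elim/zg_ind: y => [u|y y' ey ey']; first by rewrite PU DE // aug_zgU.
  by rewrite raddfB ey ey' -bBr augB rmorphB opprD addrACA -opprD.
have PsiB a a' y : Psi (a - a') y = Psi a y - Psi a' y.
  elim/zg_ind: y => [u|y y' ey ey']; first by rewrite !PU DB.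
  by rewrite !raddfB ey ey' opprD addrACA -opprD.
(* At the parameter [1] the linear extension satisfies the Fox product rule; for [y] of augmentation
   zero only the term [Psi x y] survives, and there [PsiE] applies. *)
have PsiM x y : Psi 1 (x * y) = Psi 1 x *~ aug F y + Psi x y.
  elim/zg_ind: x => [u|x x' ex ex'].
    elim/zg_ind: y => [v|y y' ey ey'].
      by rewrite -(zgUM u v) !PU DM mul1r aug_zgU mulr1z.
    by rewrite (mulrBr (zgU u)) (raddfB (Psi 1) (zgU u * y)) ey ey' augB mulrzBr (raddfB (Psi (zgU u))) opprD addrACA.
  by rewrite mulrBl (raddfB (Psi 1)) ex ex' (raddfB (Psi 1)) mulrzBl PsiB opprD addrACA.
exists (Psi 1) => x y Ux /mem_ker_aug hy.
by rewrite PsiM (PsiE x y) // hy mulr0z add0r subr0.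
Qed.
End FoxLift.

(** For an additive relation, single-valuedness has to be checked at [0] only. The maps out of the
    limits are all obtained in this way from relations that quantify over lifts. *)
Lemma graph_map (A B : zmodType) (rel : A -> B -> Prop) :
    (forall a a' b b', rel a b -> rel a' b' -> rel (a - a') (b - b')) ->
    (forall a, exists b, rel a b) ->
    (forall b, rel 0 b -> b = 0) ->
  exists f : {additive A -> B}, (forall a, rel a (f a)) /\
    forall a b, rel a b -> f a = b.
Proof.
move=> hB hT h0.
have hU a b b' : rel a b -> rel a b' -> b = b'.
  by move=> h h'; apply/eqP; rewrite -subr_eq0; apply/eqP/h0; rewrite -(subrr a); apply: hB.
pose f a := sval (cid (hT a)).
have fP a : rel a (f a) by rewrite /f; case: cid.
have fB : zmod_morphism f by move=> a a'; apply: hU (fP _) _; apply: hB.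
exists (HB.pack_for {additive A -> B} f (GRing.isZmodMorphism.Build A B f fB)).
by split=> [a|a b /(hU _ _ _ (fP a))]; first exact: fP.
Qed.

(* The copowers c, c + c, c + c + c, ... of a weakly initial object c, with
   [n.+1] summands in degree [n]. *)
Record copowers (C : category) := Copowers {
  cp_ob :> nat -> C;
  cp_in : forall n, 'I_n.+1 -> hom (cp_ob 0%N) (cp_ob n);
  cp_in0 : cp_in (ord0 : 'I_1) = idc (cp_ob 0%N);
  cp_ext : forall n (e : C) (u : 'I_n.+1 -> hom (cp_ob 0%N) e),
    exists w : hom (cp_ob n) e, forall i, compc w (cp_in i) = u i;
  cp_eq : forall n (e : C) (w w' : hom (cp_ob n) e),
    (forall i : 'I_n.+1, compc w (cp_in i) = compc w' (cp_in i)) -> w = w';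
  cp_init : forall e : C, exists u : hom (cp_ob 0%N) e, True }.
Arguments cp_in {C} c {n} i : rename.

(** * Coface maps of the copowers and the alternating coboundary *)

Section Copowers.
Variables (C : category) (c : copowers C).
Local Notation inn := (cp_in c).

Definition copair n (e : C) (u : 'I_n.+1 -> hom (c 0%N) e) : hom (c n) e :=
  sval (cid (cp_ext u)).

Lemma copairE n (e : C) (u : 'I_n.+1 -> hom (c 0%N) e) i :
  compc (copair u) (inn i) = u i.
Proof. by rewrite /copair; case: cid. Qed.

Definition face n (i : 'I_n.+2) : hom (c n) (c n.+1) :=
  copair (fun k => inn (lift i k)).

Lemma faceE n (i : 'I_n.+2) k : compc (face i) (inn k) = inn (lift i k).
Proof. exact: copairE. Qed.

(** Adjoining [u] as a new first summand is the extra degeneracy that makes the complex of maps into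
    [e] contractible. *)
Definition mjoin n (e : C) (u : hom (c 0%N) e) (w : hom (c n) e) : hom (c n.+1) e :=
  copair (fun k => if unlift ord0 k is Some k' then compc w (inn k') else u).

Lemma mjoin_face0 n e u (w : hom (c n) e) : compc (mjoin u w) (face ord0) = w.
Proof.
by apply: cp_eq => i; rewrite -compcA faceE copairE liftK.
Qed.

Lemma mjoin_faceS n e u (w : hom (c n.+1) e) (i : 'I_n.+2) :
  compc (mjoin u w) (face (lift ord0 i)) = mjoin u (compc w (face i)).
Proof.
apply: cp_eq => k; rewrite -compcA faceE !copairE.
case: (unliftP ord0 k) => [k'|] ->.
  have -> : lift (lift ord0 i) (lift ord0 k') = lift ord0 (lift i k').
    by apply: val_inj; rewrite /= /bump; lia.
  by rewrite liftK -compcA faceE.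
have -> : lift (lift ord0 i) (ord0 : 'I_n.+2) = ord0 by apply: val_inj.
by rewrite unlift_none.
Qed.

Lemma mjoin_face1 e u (w : hom (c 0%N) e) :
  compc (mjoin u w) (face (lift ord0 ord0)) = u.
Proof.
apply: cp_eq => k; rewrite -compcA faceE !copairE.
have -> : lift (lift ord0 (ord0 : 'I_1)) k = (ord0 : 'I_2).
  by apply: val_inj; case: k => [[]].
by rewrite unlift_none (ord1 k) cp_in0 compc1.
Qed.

(** This is the cosimplicial identity; [j'] is [j] read in the smaller ordinal. *)
Lemma face_face n (j : 'I_n.+3) (i : 'I_n.+2) (j' : 'I_n.+2) : (j <= i)%N ->
  j' = j :> nat -> compc (face j) (face i) = compc (face (lift ord0 i)) (face j').
Proof.
move=> ji ej; apply: cp_eq => k; rewrite -!compcA !faceE; congr (inn _).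
by apply: val_inj; rewrite /= ej /bump; lia.
Qed.

Definition sgn (n : nat) : int := (-1) ^+ n.

Section Coboundary.
Variable F : abfunctor C.

Definition cobd_fun n (x : F (c n)) : F (c n.+1) :=
  \sum_(i < n.+2) af_hom F (face i) x *~ sgn i.

Fact cobd_additive n : zmod_morphism (@cobd_fun n).
Proof.
move=> x y; rewrite /cobd_fun -sumrB; apply: eq_bigr => i _.
by rewrite raddfB mulrzBl.
Qed.
Fact cobd_subproof n : {f : {additive F (c n) -> F (c n.+1)} | f =1 @cobd_fun n}.
Proof.
by exists (HB.pack_for {additive F (c n) -> F (c n.+1)} (@cobd_fun n)
  (GRing.isZmodMorphism.Build (F (c n)) (F (c n.+1)) (@cobd_fun n) (@cobd_additive n))).
Qed.
Definition cobd n : {additive F (c n) -> F (c n.+1)} := sval (cobd_subproof n).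

Lemma cobdE n x : cobd n x = \sum_(i < n.+2) af_hom F (face i) x *~ sgn i.
Proof. exact: (svalP (cobd_subproof n)). Qed.

Lemma cobd_cobd n x : cobd n.+1 (cobd n x) = 0.
Proof.
pose g (p : 'I_n.+3 * 'I_n.+2) : F (c n.+2) :=
  af_hom F (compc (face p.1) (face p.2)) x *~ (sgn p.1 * sgn p.2).
have -> : cobd n.+1 (cobd n x) = \sum_p g p.
  transitivity (\sum_j \sum_i g (j, i)); last first.
    by rewrite pair_bigA; apply: eq_bigr => -[].
  rewrite !cobdE; apply: eq_bigr => j _.
  rewrite raddf_sum mulrz_suml; apply: eq_bigr => i _.
  by rewrite raddfMz -af_comp /g /= -mulrzA mulrC.
rewrite (bigID (fun p : 'I_n.+3 * 'I_n.+2 => p.1 <= p.2)%N) /=.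
(* [h] sends [(j, i)] with [j <= i] to [(i + 1, j)], which lies in the other half of the index set;
   by [face_face] the composite is the same there, and the sign is opposite. *)
pose h (p : 'I_n.+3 * 'I_n.+2) : 'I_n.+3 * 'I_n.+2 := (lift ord0 p.2, inord p.1).
pose h' (p : 'I_n.+3 * 'I_n.+2) : 'I_n.+3 * 'I_n.+2 :=
  (widen_ord (leqnSn _) p.2, inord p.1.-1).
rewrite [X in _ + X](reindex_onto h h'); last first.
  move=> [j i] /=; rewrite -ltnNge => ij; rewrite /h /h' /=.
  have jn := ltn_ord j.
  congr pair; apply: val_inj; rewrite /= ?inordK //; last by lia.
  by rewrite /bump /= add1n prednK //; lia.
rewrite [X in _ + X](eq_bigl (fun p : 'I_n.+3 * 'I_n.+2 => p.1 <= p.2)%N); last first.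
  move=> [j i] /=; have jn := ltn_ord j; have ni := ltn_ord i.
  case: (leqP j i) => ji; last first.
    apply/negbTE/negP => /andP[hij /eqP[/(congr1 val) /= e _]].
    by move: hij; rewrite /bump /= e; lia.
  have eij : (inord j : 'I_n.+2) = j :> nat by rewrite inordK //; lia.
  apply/andP; split; first by rewrite /bump /= add1n -ltnNge eij; lia.
  apply/eqP; rewrite /h' /h /=; congr pair; apply: val_inj; rewrite /= ?eij //.
  by rewrite add0n inord_val.
rewrite -big_split /=; apply: big1 => -[j i] /= ji.
have jn := ltn_ord j; have ni := ltn_ord i.
have eij : (inord j : 'I_n.+2) = j :> nat by rewrite inordK //; lia.
rewrite /g /h /= (face_face ji eij) -mulrzDr /sgn /= eij.
by rewrite /bump /= add1n exprS -mulrA mulN1r [X in _ - X]mulrC subrr mulr0z.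
Qed.
End Coboundary.

Lemma cobd_nat (F G : abfunctor C) (t : nat_trans F G) n x :
  t (c n.+1) (cobd F n x) = cobd G n (t (c n) x).
Proof.
rewrite !cobdE raddf_sum; apply: eq_bigr => i _.
by rewrite raddfMz nt_nat.
Qed.

Lemma cobd0E (F : abfunctor C) x :
  cobd F 0%N x = af_hom F (face ord0) x - af_hom F (face (lift ord0 ord0)) x.
Proof. by rewrite cobdE big_ord_recl big_ord1 /sgn /= mulr1z mulrN1z. Qed.

Lemma lim_cobd0 (F : abfunctor C) (x : lim F) : cobd F 0%N (val x (c 0%N)) = 0.
Proof.
have /asboolP hx := valP x.
by rewrite cobd0E !hx subrr.
Qed.

(** Two maps [u], [v] out of [c 0] are the composites of [mjoin u v] with the two faces, so a
    cocycle has the same image under both; weak initiality then spreads it over all objects. *)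
Lemma cobd0_lim (F : abfunctor C) (y : F (c 0%N)) : cobd F 0%N y = 0 ->
  exists x : lim F, val x (c 0%N) = y.
Proof.
rewrite cobd0E => /eqP; rewrite subr_eq0 => /eqP y01.
have ind e (u v : hom (c 0%N) e) : af_hom F u y = af_hom F v y.
  rewrite -[v](mjoin_face0 u v) -{1}[u](mjoin_face1 u v) !af_comp.
  by rewrite y01.
pose x : dprod F := fun e => af_hom F (sval (cid (cp_init c e))) y.
have hx : x \in lim_sub F.
  by apply/asboolP => a b u; rewrite /x -af_comp; apply: ind.
by exists (Sub x hx); rewrite SubK /x (ind _ _ (idc (c 0%N))) af_id.
Qed.
End Copowers.

(** * Higher limits as cohomology of copowers *)

Section InjectiveAcyclic.
Variables (C : category) (c : copowers C).

(* [fz n] is the free functor Z[hom (c n) -]; evaluating at it is taking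
   maps out of it, and its faces form a resolution of the constant Z. *)
Section FreeFunctor.
Variable n : nat.

Definition hset (e : C) : Type := hom (c n) e.
HB.instance Definition _ e := gen_eqMixin (hset e).
HB.instance Definition _ e := gen_choiceMixin (hset e).

Definition fzU e (w : hom (c n) e) : {malg int[hset e]} := mkmalgU (w : hset e) 1.

Definition fz_hom a b (u : hom a b) : {additive {malg int[hset a]} -> {malg int[hset b]}} :=
  malg_ext (fun w : hset a => fzU (compc u w)).

Lemma fz_homU a b (u : hom a b) w : fz_hom u (fzU w) = fzU (compc u w).
Proof. exact: malg_extU. Qed.

Lemma fz_ind e (P : {malg int[hset e]} -> Prop) :
    (forall w : hom (c n) e, P (fzU w)) -> (forall x y, P x -> P y -> P (x - y)) ->
    P 0 -> forall x, P x.
Proof. by move=> hU; apply: malg_ind => w; apply: hU. Qed.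

Fact fz_id a x : fz_hom (idc a) x = x.
Proof.
elim/fz_ind: x => [w|x y ex ey|]; first by rewrite fz_homU comp1c.
  by rewrite raddfB ex ey.
exact: raddf0.
Qed.

Fact fz_comp a b d (v : hom b d) (u : hom a b) x :
  fz_hom (compc v u) x = fz_hom v (fz_hom u x).
Proof.
elim/fz_ind: x => [w|x y ex ey|]; first by rewrite !fz_homU compcA.
  by rewrite !raddfB ex ey.
by rewrite !raddf0.
Qed.

Definition fz : abfunctor C := AbFunctor fz_id fz_comp.

Definition yon (F : abfunctor C) (y : F (c n)) e : {additive fz e -> F e} :=
  malg_ext (fun w : hset e => af_hom F (w : hom (c n) e) y).

Lemma yonU (F : abfunctor C) (y : F (c n)) e w : yon y e (fzU w) = af_hom F w y.
Proof. exact: malg_extU. Qed.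

Fact yon_nat (F : abfunctor C) (y : F (c n)) a b (u : hom a b) x :
  yon y b (af_hom fz u x) = af_hom F u (yon y a x).
Proof.
elim/fz_ind: x => [w|x z ex ez|]; first by rewrite [af_hom _ _ _]fz_homU !yonU af_comp.
  by rewrite !raddfB ex ez.
by rewrite !raddf0.
Qed.
End FreeFunctor.

Arguments fzU {n e} w.

Definition fz_bnd n e : {additive fz n.+1 e -> fz n e} :=
  malg_ext (fun w : hset n.+1 e =>
    \sum_(i < n.+2) fzU (compc (w : hom (c n.+1) e) (face c i)) *~ sgn i).

Lemma fz_bndU n e (w : hom (c n.+1) e) :
  fz_bnd n e (fzU w) = \sum_(i < n.+2) fzU (compc w (face c i)) *~ sgn i.
Proof. exact: malg_extU. Qed.

Fact fz_bnd_nat n a b (u : hom a b) x :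
  fz_bnd n b (af_hom (fz n.+1) u x) = af_hom (fz n) u (fz_bnd n a x).
Proof.
elim/fz_ind: x => [w|x y ex ey|].
- rewrite [af_hom (fz n.+1) u _]fz_homU !fz_bndU raddf_sum; apply: eq_bigr => i _.
  by rewrite raddfMz [af_hom _ _ _]fz_homU compcA.
- by rewrite !raddfB ex ey.
- by rewrite !raddf0.
Qed.

Lemma yon_bnd n (F : abfunctor C) (y : F (c n)) e x :
  yon y e (fz_bnd n e x) = yon (cobd c F n y) e x.
Proof.
elim/fz_ind: x => [w|x z ex ez|].
- rewrite fz_bndU yonU cobdE !raddf_sum; apply: eq_bigr => i _.
  by rewrite !raddfMz yonU af_comp.
- by rewrite !raddfB ex ez.
- by rewrite !raddf0.
Qed.

(* The contraction is given by adjoining a fixed first vertex. *)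
Lemma fz_exact n e (x : fz n.+1 e) : fz_bnd n e x = 0 ->
  exists y, fz_bnd n.+1 e y = x.
Proof.
have [u _] := cp_init c e.
pose s k : {additive fz k e -> fz k.+1 e} :=
  malg_ext (fun w : hset k e => fzU (mjoin u (w : hom (c k) e))).
have sU k w : s k (fzU w) = fzU (mjoin u w) by exact: malg_extU.
have sE : fz_bnd n.+1 e (s n.+1 x) = x - s n (fz_bnd n e x).
  elim/fz_ind: x => [w|x y ex ey|]; last by rewrite !raddf0 addr0.
    rewrite sU !fz_bndU big_ord_recl mjoin_face0 /sgn /= mulr1z; congr (_ + _).
    rewrite (raddf_sum (s n)) -sumrN; apply: eq_bigr => i _.
    by rewrite mjoin_faceS raddfMz sU /bump /= add1n exprS mulN1r mulrNz.
  by rewrite !raddfB ex ey !opprD addrACA.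
by move=> x0; exists (s n.+1 x); rewrite sE x0 raddf0 subr0.
Qed.

(** Under the Yoneda correspondence [cobd] is composition with [fz_bnd]. By [fz_exact] a cocycle
    kills the cycles of [fz n.+1], hence defines a map on their quotient, which embeds in [fz n];
    injectivity extends this map, and its value at the identity is the primitive. *)
Lemma injective_acyclic (R : abfunctor C) : injective_obj R ->
  forall n (y : R (c n.+1)), cobd c R n.+1 y = 0 -> exists x, cobd c R n x = y.
Proof.
move=> Rinj n y dy.
have yk e x : fz_bnd n e x = 0 -> yon y e x = 0.
  move=> /fz_exact[z <-]; rewrite yon_bnd dy.
  elim/fz_ind: z => [w|p q ep eq|]; first by rewrite yonU raddf0.
    by rewrite raddfB ep eq subrr.
  exact: raddf0.
(* the quotient of [fz n.+1] by the cycles embeds in [fz n] *)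
pose Q e : zmodType := Quotient.quot (ker (fz_bnd n e)).
pose qp e : {additive fz n.+1 e -> Q e} := qpi (ker (fz_bnd n e)).
have qind e (P : Q e -> Prop) : (forall x, P (qp e x)) -> forall q, P q by exact: qpi_ind.
have Qk a b (u : hom a b) x : x \in ker (fz_bnd n a) -> (qp b \o af_hom (fz n.+1) u) x = 0.
  move=> /mem_ker x0; apply/qpi_eq0/mem_ker.
  by rewrite fz_bnd_nat x0 raddf0.
pose Qh a b (u : hom a b) : {additive Q a -> Q b} := quot_lift (Qk a b u).
have QhE a b (u : hom a b) x : Qh a b u (qp a x) = qp b (af_hom (fz n.+1) u x).
  exact: (qpi_lift (Qk a b u) x).
have Qid a x : Qh a a (idc a) x = x.
  by elim/qind: x => x; rewrite QhE af_id.
have Qcomp a b d (g : hom b d) (f : hom a b) x :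
    Qh a d (compc g f) x = Qh b d g (Qh a b f x).
  by elim/qind: x => x; rewrite !QhE af_comp.
pose QF : abfunctor C := @AbFunctor C Q Qh Qid Qcomp.
have ik e x : x \in ker (fz_bnd n e) -> fz_bnd n e x = 0 by move/mem_ker.
have hk e x : x \in ker (fz_bnd n e) -> yon y e x = 0 by move/mem_ker/yk.
pose ii e : {additive Q e -> fz n e} := quot_lift (ik e).
pose hh e : {additive Q e -> R e} := quot_lift (hk e).
have iiE e x : ii e (qp e x) = fz_bnd n e x by exact: (qpi_lift (ik e) x).
have hhE e x : hh e (qp e x) = yon y e x by exact: (qpi_lift (hk e) x).
have iN a b (u : hom a b) x : ii b (af_hom QF u x) = af_hom (fz n) u (ii a x).
  by elim/qind: x => x; rewrite [af_hom QF u _]QhE !iiE fz_bnd_nat.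
have hN a b (u : hom a b) x : hh b (af_hom QF u x) = af_hom R u (hh a x).
  by elim/qind: x => x; rewrite [af_hom QF u _]QhE !hhE yon_nat.
have iinj e : injective (ii e).
  elim/qind=> p; elim/qind=> q; rewrite !iiE => e0.
  by apply/qpi_eq/mem_ker; rewrite raddfB e0 subrr.
have [k kE] := Rinj QF (fz n) (@NatTrans C QF (fz n) ii iN) (@NatTrans C QF R hh hN) iinj.
exists (k (c n) (fzU (idc (c n)))).
have kb : k (c n.+1) (fz_bnd n (c n.+1) (fzU (idc (c n.+1)))) = y.
  rewrite -iiE; apply: etrans (kE _ _) _; apply: etrans (hhE _ _) _.
  by rewrite yonU af_id.
rewrite -[RHS]kb fz_bndU cobdE raddf_sum; apply: eq_bigr => i _.
rewrite raddfMz -nt_nat; congr (k _ _ *~ _).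
by rewrite [LHS]fz_homU compc1 comp1c.
Qed.
End InjectiveAcyclic.

Lemma lim_valB (C : category) (F : abfunctor C) (x y : lim F) e :
  val (x - y) e = val x e - val y e.
Proof. by rewrite (raddfB val x y). Qed.

Section Comparison.
Variables (C : category) (c : copowers C) (F : abfunctor C) (R : inj_res F).

Definition cob m : F (c m) -> Prop :=
  match m with
  | 0%N => fun y => y = 0
  | m'.+1 => fun y => exists y', cobd c F m' y' = y
  end.

(** The value is [p + q], but the recursion moves one unit from [p] to [q], so that the types along
    a staircase agree by conversion. *)
Fixpoint chain_idx p q := if p is p'.+1 then chain_idx p' q.+1 else q.

(* A staircase through the double complex [R p (c q)], from a class in
   degree (p, q) down to a class of [F] in degree (0, p + q). *)
Fixpoint chain p q : R p (c q) -> F (c (chain_idx p q)) -> Prop :=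
  match p with
  | 0%N => fun xi y => ir_aug R (c q) y = xi
  | p'.+1 => fun xi y => exists u : R p' (c q),
      ir_d R p' (c q) u = xi /\ chain (cobd c (R p') q u) y
  end.

Lemma chainB p q (xi xi' : R p (c q)) y y' :
  chain xi y -> chain xi' y' -> chain (xi - xi') (y - y').
Proof.
elim: p q xi xi' y y' => [|p ih] q xi xi' y y' /=; first by move=> <- <-; rewrite raddfB.
move=> [u [<- hu]] [u' [<- hu']]; exists (u - u'); split; first by rewrite raddfB.
by rewrite raddfB; apply: ih.
Qed.

Lemma ir_dd p e (x : R p e) : ir_d R p.+1 e (ir_d R p e x) = 0.
Proof. by apply/ir_exact; exists x. Qed.

Lemma ir_d_aug e (y : F e) : ir_d R 0%N e (ir_aug R e y) = 0.
Proof. by apply/ir_exact0; exists y. Qed.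

Lemma chain_cocycle p q (xi : R p (c q)) y :
  chain xi y -> cobd c (R p) q xi = 0 -> cobd c F _ y = 0.
Proof.
elim: p q xi y => [|p ih] q xi y /=.
  move=> <-; rewrite -cobd_nat -[X in _ = X](raddf0 (ir_aug R (c q.+1))).
  by move/(@ir_aug_inj _ _ R).
by move=> [u [<- hu]] _; apply: (ih _ _ _ hu); apply: cobd_cobd.
Qed.

Lemma chain_total p q (xi : R p (c q)) :
  ir_d R p (c q) xi = 0 -> cobd c (R p) q xi = 0 -> exists y, chain xi y.
Proof.
elim: p q xi => [|p ih] q xi dxi hxi /=; first by have [y hy] := (@ir_exact0 _ _ R (c q) xi).1 dxi; exists y.
have [u hu] := (@ir_exact _ _ R p (c q) xi).1 dxi.
have [||y hy] := ih q.+1 (cobd c (R p) q u); last by exists y, u.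
  by rewrite cobd_nat hu.
exact: cobd_cobd.
Qed.

Lemma chain_surj p q (y : F (c (chain_idx p q))) : cobd c F _ y = 0 ->
  exists xi : R p (c q), [/\ cobd c (R p) q xi = 0, ir_d R p (c q) xi = 0 & chain xi y].
Proof.
elim: p q y => [|p ih] q y dy.
  by exists (ir_aug R (c q) y); rewrite -cobd_nat dy raddf0 ir_d_aug.
have [xi [xi1 xi2 hxi]] := ih q.+1 y dy.
have [u hu] := injective_acyclic (@ir_inj _ _ R p) xi1.
exists (ir_d R p (c q) u); split; last by exists u; rewrite hu.
  by rewrite -cobd_nat hu.
exact: ir_dd.
Qed.

(** With [v'] lifting [v] through the resolution, [u - cobd v'] is again killed by the resolution
    and has the same coboundary as [u]; the ambiguity descends step by step until it is a coboundary
    of [F]. *)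
Lemma chain_cob p q (v : R p (c q)) y :
  ir_d R p (c q) v = 0 -> chain (cobd c (R p) q v) y -> cob y.
Proof.
elim: p q v y => [|p ih] q v y /=.
  move=> /ir_exact0[y' <-]; rewrite -cobd_nat => /(@ir_aug_inj _ _ R) ->.
  by exists y'.
move=> /ir_exact[v' <-] [u [hu hy]].
apply: (ih q.+1 (u - cobd c (R p) q v')).
  by rewrite raddfB cobd_nat hu subrr.
by rewrite raddfB cobd_cobd subr0.
Qed.

Lemma cob_chain p q (xi : R p (c q.+1)) y : chain xi y -> cob y ->
  exists v : R p (c q), ir_d R p (c q) v = 0 /\ xi = cobd c (R p) q v.
Proof.
elim: p q xi y => [|p ih] q xi y /=.
  move=> <- [y' <-]; exists (ir_aug R (c q) y').
  by rewrite ir_d_aug cobd_nat.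
move=> [u [<- hu]] /(ih _ _ _ hu)[v [dv uv]].
have [v' hv'] : exists v', cobd c (R p) q v' = u - v.
  by apply: injective_acyclic; [exact: ir_inj|rewrite raddfB uv subrr].
exists (ir_d R p (c q) v'); split; first exact: ir_dd.
by rewrite -cobd_nat hv' raddfB dv subr0.
Qed.

(** The staircase involves choices, so the comparison stays a relation: additive, total, onto the
    cocycles, and matching zero with the coboundaries. The cochain has degree [p + 1]. *)
Definition lim_rel p (xi : limD R p.+1) (y : F (c (chain_idx p 1))) : Prop :=
  exists x : subz (ker (lim_map (ir_d R p.+1))),
    qpi (bnd (lim_map (ir_d R p)) _) x = xi /\
    chain (p := p.+1) (q := 0) (val (val x) (c 0%N)) y.

Lemma lim_relB p (xi xi' : limD R p.+1) y y' :
  lim_rel xi y -> lim_rel xi' y' -> lim_rel (xi - xi') (y - y').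
Proof.
move=> [x [<- hx]] [x' [<- hx']]; exists (x - x'); split; first by rewrite raddfB.
by rewrite (raddfB val x x') lim_valB; exact: (chainB (p := p.+1) hx hx').
Qed.

Lemma lim_rel_cocycle p (xi : limD R p.+1) y : lim_rel xi y -> cobd c F _ y = 0.
Proof.
move=> [x [_ hx]]; apply: (chain_cocycle hx).
exact: (lim_cobd0 c (val x)).
Qed.

Lemma lim_rel_total p (xi : limD R p.+1) : exists y, lim_rel xi y.
Proof.
elim/qpi_ind: xi => x.
have [||y hy] := @chain_total p.+1 0 (val (val x) (c 0%N)).
- have /mem_ker x0 := valP x.
  exact: (congr1 (fun z : lim (R p.+2) => val z (c 0%N)) x0).
- exact: (lim_cobd0 c (val x)).
by exists y, x.
Qed.

Lemma lim_rel_surj p (y : F (c (chain_idx p 1))) : cobd c F _ y = 0 ->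
  exists xi : limD R p.+1, lim_rel xi y.
Proof.
move=> /(@chain_surj p.+1 0)[xi [xi1 xi2 hxi]].
have [x hx] := cobd0_lim xi1.
have x0 : x \in ker (lim_map (ir_d R p.+1)).
  apply/mem_ker; apply: val_inj; apply/functional_extensionality_dep => e.
  rewrite lim_mapE; have /asboolP hl := valP x.
  by have [u _] := cp_init c e; rewrite -(hl _ _ u) hx nt_nat xi2 raddf0.
by exists (qpi _ (Sub x x0)), (Sub x x0); rewrite SubK hx.
Qed.

(** An element of a limit is determined by its value at the weakly initial object, so identities
    verified at [c 0] spread to all objects by naturality. *)
Lemma lim_rel0 p (xi : limD R p.+1) y : lim_rel xi y -> (xi = 0 <-> cob y).
Proof.
move=> [x [<- hx]]; split.
  move=> /qpi_eq0/asboolP[w hw]; case: hx => u [hu hy].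
  have hwu : ir_d R p (c 0%N) (val w (c 0%N)) = val (val x) (c 0%N).
    by rewrite -hw.
  apply: (@chain_cob p 0 (u - val w (c 0%N))); first by rewrite raddfB hu hwu subrr.
  by rewrite raddfB [X in _ - X](lim_cobd0 c w) subr0.
case: hx => u [hu hy] /(cob_chain hy)[v [dv uv]].
have [w hw] : exists w : lim (R p), val w (c 0%N) = u - v.
  by apply: cobd0_lim; rewrite raddfB uv subrr.
apply/qpi_eq0/asboolP; exists w.
apply: val_inj; apply/functional_extensionality_dep => e.
have [t _] := cp_init c e; have /asboolP hl := valP w; have /asboolP hl' := valP (val x).
by rewrite lim_mapE -(hl _ _ t) hw nt_nat raddfB dv subr0 hu (hl' _ _ t).
Qed.
End Comparison.

(** * The ideals *)

Section IdealLemmas.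
Variable R : nzRingType.
Implicit Types I J : zmodClosed R.

Lemma mem_idealM I J a b : a \in I -> b \in J -> a * b \in idealM I J.
Proof. by move=> ha hb; apply: mem_span; exists a, b. Qed.

Lemma idealM_ind I J (P : R -> Prop) :
    (forall a b, a \in I -> b \in J -> P (a * b)) ->
    (forall x y, P x -> P y -> P (x - y)) -> P 0 ->
  forall x, x \in idealM I J -> P x.
Proof.
move=> hM hB h0 x hx.
have hP : zmod_closed [pred x | `[< P x >]].
  by split=> [|y z /asboolP hy /asboolP hz]; apply/asboolP => //; apply: hB.
suff /asboolP : x \in mk_sub hP by [].
by apply: span_sub hx => _ [a [b [ha hb ->]]]; apply/asboolP/hM.
Qed.

Lemma memMBr I a x y : a * x \in I -> a * y \in I -> a * (x - y) \in I.
Proof. by move=> hx hy; rewrite mulrBr rpredB. Qed.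
Lemma memMDr I a x y : a * x \in I -> a * y \in I -> a * (x + y) \in I.
Proof. by move=> hx hy; rewrite mulrDr rpredD. Qed.

Lemma mem_idealDl I J a : a \in I -> a \in idealD I J.
Proof. by move=> ha; apply/asboolP; exists a, 0; rewrite addr0 rpred0. Qed.

Lemma mem_idealDr I J a : a \in J -> a \in idealD I J.
Proof. by move=> ha; apply/asboolP; exists 0, a; rewrite add0r rpred0. Qed.

Lemma idealD_ind I J (P : R -> Prop) :
    (forall a, a \in I -> P a) -> (forall a, a \in J -> P a) ->
    (forall x y, P x -> P y -> P (x + y)) ->
  forall x, x \in idealD I J -> P x.
Proof. by move=> hI hJ hD x /asboolP[a [b [ha hb ->]]]; apply: hD; [apply: hI|apply: hJ]. Qed.

Lemma idealM_mull I J : (forall x a, a \in I -> x * a \in I) ->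
  forall x a, a \in idealM I J -> x * a \in idealM I J.
Proof.
move=> hI x a; move: a; apply: idealM_ind => [a b ha hb|a b ha hb|].
- by rewrite mulrA; apply: mem_idealM => //; apply: hI.
- by rewrite mulrBr rpredB.
- by rewrite mulr0 rpred0.
Qed.

Lemma idealM_mulr I J : (forall a x, a \in J -> a * x \in J) ->
  forall a x, a \in idealM I J -> a * x \in idealM I J.
Proof.
move=> hJ a x; move: a; apply: idealM_ind => [a b ha hb|a b ha hb|].
- by rewrite -mulrA; apply: mem_idealM => //; apply: hJ.
- by rewrite mulrBl rpredB.
- by rewrite mul0r rpred0.
Qed.
End IdealLemmas.

Section Presentation.
Variables (G : smallGroup) (c : pres G).
Local Notation ZF := (zgring (pres_src c)).
Local Notation f := (idl_f c).
Local Notation r := (idl_r c).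

Definition idl_ff := idealM f f.
Definition idl_fff := idealM idl_ff f.
Definition idl_A := idealD (idealM r f) idl_fff.
Definition idl_B := idealD (idealM f r) idl_fff.
Definition idl_AB := idealD idl_A idl_B.
Definition idl_N := idealD idl_fff (idealM r r).
Definition idl_D := idealD r idl_ff.

Lemma f_mull (a x : ZF) : x \in f -> a * x \in f.
Proof. by move=> /mem_ker_aug hx; apply/mem_ker_aug; rewrite augM hx mulr0. Qed.
Lemma f_mulr (x a : ZF) : x \in f -> x * a \in f.
Proof. by move=> /mem_ker_aug hx; apply/mem_ker_aug; rewrite augM hx mul0r. Qed.
Lemma r_mulr (x a : ZF) : x \in r -> x * a \in r.
Proof. by move=> /mem_ker_zg hx; apply/mem_ker_zg; rewrite zg_map_mul hx mul0r. Qed.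
Lemma r_f (x : ZF) : x \in r -> x \in f.
Proof.
move=> /mem_ker_zg hx; apply/mem_ker_aug.
by rewrite -(aug_zg_map (pres_map c)) hx; apply: raddf0.
Qed.

Lemma ffM a b : a \in f -> b \in f -> a * b \in idl_ff.
Proof. exact: mem_idealM. Qed.
Lemma fffM a b d : a \in f -> b \in f -> d \in f -> a * b * d \in idl_fff.
Proof. by move=> ha hb hd; apply: mem_idealM => //; apply: ffM. Qed.

Lemma idl_fff_ind (P : ZF -> Prop) :
    (forall a b d, a \in f -> b \in f -> d \in f -> P (a * b * d)) ->
    (forall x y, P x -> P y -> P (x - y)) -> P 0 ->
  forall x, x \in idl_fff -> P x.
Proof.
move=> hM hB h0; apply: idealM_ind => // a b ha hb; move: a ha.
apply: (@idealM_ind _ _ _ (fun a => P (a * b))) => [a d ha hd|x y hx hy|].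
- exact: hM.
- by rewrite mulrBl; apply: hB.
- by rewrite mul0r.
Qed.

Lemma ff_f x : x \in idl_ff -> x \in f.
Proof.
move: x; apply: idealM_ind => [a b ha hb|a b ha hb|]; last exact: rpred0.
  exact: f_mulr.
exact: rpredB.
Qed.

Lemma fff_ff x : x \in idl_fff -> x \in idl_ff.
Proof.
move: x; apply: idealM_ind => [a b ha hb|a b ha hb|]; last exact: rpred0.
  by apply: ffM => //; apply: ff_f.
exact: rpredB.
Qed.

Lemma rr_sub (K : zmodClosed ZF) :
  (forall a b, a \in r -> b \in r -> a * b \in K) ->
  forall x, x \in idealM r r -> x \in K.
Proof. by move=> h; apply: idealM_ind => //; [exact: rpredB|exact: rpred0]. Qed.

Lemma main_rr a b : a \in r -> b \in r -> a * b \in idl_main c.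
Proof. by move=> ha hb; apply/mem_idealDr/mem_idealDr/mem_idealDr/mem_idealM. Qed.
Lemma main_rff a b d : a \in r -> b \in f -> d \in f -> a * b * d \in idl_main c.
Proof.
move=> ha hb hd; apply/mem_idealDr/mem_idealDr/mem_idealDl.
by apply: mem_idealM => //; apply: mem_idealM.
Qed.
Lemma main_frf a b d : a \in f -> b \in r -> d \in f -> a * b * d \in idl_main c.
Proof.
move=> ha hb hd; apply/mem_idealDr/mem_idealDl.
by apply: mem_idealM => //; apply: mem_idealM.
Qed.
Lemma main_ffr a b d : a \in f -> b \in f -> d \in r -> a * b * d \in idl_main c.
Proof.
move=> ha hb hd; apply/mem_idealDl.
by apply: mem_idealM => //; apply: mem_idealM.
Qed.

Lemma idl_main_ind (P : ZF -> Prop) :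
    (forall a b d, a \in f -> b \in f -> d \in r -> P (a * b * d)) ->
    (forall a b d, a \in f -> b \in r -> d \in f -> P (a * b * d)) ->
    (forall a b d, a \in r -> b \in f -> d \in f -> P (a * b * d)) ->
    (forall a b, a \in r -> b \in r -> P (a * b)) ->
    (forall x y, P x -> P y -> P (x - y)) -> P 0 ->
  forall x, x \in idl_main c -> P x.
Proof.
move=> h1 h2 h3 h4 hB h0.
have hD x y : P x -> P y -> P (x + y).
  by move=> hx hy; rewrite -[y]opprK; apply: (hB _ _ hx); rewrite -sub0r; apply: hB.
have h3M (I J K : zmodClosed ZF) :
    (forall a b d, a \in I -> b \in J -> d \in K -> P (a * b * d)) ->
    forall x, x \in idealM (idealM I J) K -> P x.
  move=> h; apply: idealM_ind => // a b ha hb; move: a ha.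
  apply: (@idealM_ind _ _ _ (fun a => P (a * b))) => [a d ha hd|x y hx hy|].
  - exact: h.
  - by rewrite mulrBl; apply: hB.
  - by rewrite mul0r.
apply: idealD_ind => //; first exact: h3M.
apply: idealD_ind => //; first exact: h3M.
by apply: idealD_ind => //; [exact: h3M|exact: idealM_ind].
Qed.

Lemma rf_A a b : a \in r -> b \in f -> a * b \in idl_A.
Proof. by move=> ha hb; apply/mem_idealDl/mem_idealM. Qed.
Lemma fff_A x : x \in idl_fff -> x \in idl_A.
Proof. exact: mem_idealDr. Qed.
Lemma fr_B a b : a \in f -> b \in r -> a * b \in idl_B.
Proof. by move=> ha hb; apply/mem_idealDl/mem_idealM. Qed.
Lemma fff_B x : x \in idl_fff -> x \in idl_B.
Proof. exact: mem_idealDr. Qed.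
Lemma A_AB x : x \in idl_A -> x \in idl_AB.
Proof. exact: mem_idealDl. Qed.
Lemma B_AB x : x \in idl_B -> x \in idl_AB.
Proof. exact: mem_idealDr. Qed.
Lemma fff_N x : x \in idl_fff -> x \in idl_N.
Proof. exact: mem_idealDl. Qed.
Lemma rr_N a b : a \in r -> b \in r -> a * b \in idl_N.
Proof. by move=> ha hb; apply/mem_idealDr/mem_idealM. Qed.
Lemma r_D x : x \in r -> x \in idl_D.
Proof. exact: mem_idealDl. Qed.
Lemma ff_D x : x \in idl_ff -> x \in idl_D.
Proof. exact: mem_idealDr. Qed.

Lemma idl_A_ind (P : ZF -> Prop) :
    (forall a b, a \in r -> b \in f -> P (a * b)) ->
    (forall x, x \in idl_fff -> P x) ->
    (forall x y, P x -> P y -> P (x - y)) -> P 0 ->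
  forall x, x \in idl_A -> P x.
Proof.
move=> h1 h2 hB h0; apply: idealD_ind => //; first exact: idealM_ind.
by move=> x y hx hy; rewrite -[y]opprK; apply: (hB _ _ hx); rewrite -sub0r; apply: hB.
Qed.

Lemma idl_B_ind (P : ZF -> Prop) :
    (forall a b, a \in f -> b \in r -> P (a * b)) ->
    (forall x, x \in idl_fff -> P x) ->
    (forall x y, P x -> P y -> P (x - y)) -> P 0 ->
  forall x, x \in idl_B -> P x.
Proof.
move=> h1 h2 hB h0; apply: idealD_ind => //; first exact: idealM_ind.
by move=> x y hx hy; rewrite -[y]opprK; apply: (hB _ _ hx); rewrite -sub0r; apply: hB.
Qed.

Lemma A_ff x : x \in idl_A -> x \in idl_ff.
Proof.
move: x; apply: idl_A_ind => [a b /r_f|x|x y|]; first exact: ffM.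
- exact: fff_ff.
- exact: rpredB.
- exact: rpred0.
Qed.
Lemma B_ff x : x \in idl_B -> x \in idl_ff.
Proof.
move: x; apply: idl_B_ind => [a b ha /r_f|x|x y|]; first exact: ffM.
- exact: fff_ff.
- exact: rpredB.
- exact: rpred0.
Qed.

Lemma main_A x : x \in idl_main c -> x \in idl_A.
Proof.
move: x; apply: idl_main_ind => [a b d ha hb /r_f hd|a b d ha /r_f hb hd|a b d /r_f ha hb hd||x y|].
- exact/fff_A/fffM.
- exact/fff_A/fffM.
- exact/fff_A/fffM.
- by move=> a b ha /r_f; apply: rf_A.
- exact: rpredB.
- exact: rpred0.
Qed.
Lemma main_B x : x \in idl_main c -> x \in idl_B.
Proof.
move: x; apply: idl_main_ind => [a b d ha hb /r_f hd|a b d ha /r_f hb hd|a b d /r_f ha hb hd||x y|].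
- exact/fff_B/fffM.
- exact/fff_B/fffM.
- exact/fff_B/fffM.
- by move=> a b /r_f; apply: fr_B.
- exact: rpredB.
- exact: rpred0.
Qed.

Lemma main_N x : x \in idl_main c -> x \in idl_N.
Proof.
move: x; apply: idl_main_ind => [a b d ha hb /r_f hd|a b d ha /r_f hb hd|a b d /r_f ha hb hd||x y|].
- exact/fff_N/fffM.
- exact/fff_N/fffM.
- exact/fff_N/fffM.
- exact: rr_N.
- exact: rpredB.
- exact: rpred0.
Qed.

Lemma D_f x : x \in idl_D -> x \in f.
Proof. by move: x; apply: idealD_ind => [x|x|x y]; [exact: r_f|exact: ff_f|exact: rpredD]. Qed.

Lemma Df_A a b : a \in idl_D -> b \in f -> a * b \in idl_A.
Proof.
move=> ha hb; move: a ha; apply: idealD_ind => [a ha|a ha|x y hx hy].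
- exact: rf_A.
- exact/fff_A/mem_idealM.
- by rewrite mulrDl rpredD.
Qed.

Lemma f_ff_fff a b : a \in f -> b \in idl_ff -> a * b \in idl_fff.
Proof.
move=> ha; move: b; apply: idealM_ind => [x y hx hy|x y hx hy|].
- by rewrite mulrA; apply: fffM.
- exact: (memMBr hx hy).
- by rewrite mulr0 rpred0.
Qed.

Lemma fD_B a b : a \in f -> b \in idl_D -> a * b \in idl_B.
Proof.
move=> ha; move: b; apply: idealD_ind => [b hb|b hb|x y hx hy].
- exact: fr_B.
- exact/fff_B/f_ff_fff.
- exact: (memMDr hx hy).
Qed.

Lemma DD_N a b : a \in idl_D -> b \in idl_D -> a * b \in idl_N.
Proof.
move=> ha hb; move: a ha; apply: idealD_ind => [a ha|a ha|x y hx hy].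
- move: b hb; apply: idealD_ind => [b hb|b hb|x y hx hy]; first exact: rr_N.
    by apply/fff_N/f_ff_fff => //; apply: r_f.
  exact: (memMDr hx hy).
- exact/fff_N/mem_idealM/D_f.
- by rewrite mulrDl rpredD.
Qed.

Lemma D_mulr a x : a \in idl_D -> a * x \in idl_D.
Proof.
move: a; apply: idealD_ind => [a ha|a ha|a b ha hb].
- exact/r_D/r_mulr.
- by apply: ff_D; apply: idealM_mulr ha => ? ?; apply: f_mulr.
- by rewrite mulrDl rpredD.
Qed.

Lemma idl_AB_ind (P : ZF -> Prop) :
    (forall x, x \in idl_A -> P x) -> (forall x, x \in idl_B -> P x) ->
    (forall x y, P x -> P y -> P (x + y)) ->
  forall x, x \in idl_AB -> P x.
Proof. exact: idealD_ind. Qed.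
End Presentation.

(** * Behaviour of the ideals under maps of presentations *)

Section Maps.
Variables (G H : smallGroup) (f : {multiplicative G -> H}).
Variables (c : pres G) (d : pres H).

Lemma over_zg (u : pres_over f c d) z :
  zg_map (pres_map d) (zg_map u z) = zg_map f (zg_map (pres_map c) z).
Proof. exact: (zg_map_comp (f := po_map u) (f' := pres_map c) (po_over u)). Qed.

Lemma f_zg_map (u : {multiplicative pres_src c -> pres_src d}) z :
  z \in idl_f c -> zg_map u z \in idl_f d.
Proof. by move=> /mem_ker_aug hz; apply/mem_ker_aug; rewrite aug_zg_map. Qed.

Lemma ff_zg_map (u : {multiplicative pres_src c -> pres_src d}) z :
  z \in idl_ff c -> zg_map u z \in idl_ff d.
Proof. by apply: idealM_map; apply: f_zg_map. Qed.

Lemma fff_zg_map (u : {multiplicative pres_src c -> pres_src d}) z :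
  z \in idl_fff c -> zg_map u z \in idl_fff d.
Proof. by apply: idealM_map; [apply: ff_zg_map|apply: f_zg_map]. Qed.

Lemma A_zg_map (u : pres_over f c d) z : z \in idl_A c -> zg_map u z \in idl_A d.
Proof.
apply: idealD_map; last exact: fff_zg_map.
by apply: idealM_map; [exact: idl_r_map|exact: f_zg_map].
Qed.

Lemma B_zg_map (u : pres_over f c d) z : z \in idl_B c -> zg_map u z \in idl_B d.
Proof.
apply: idealD_map; last exact: fff_zg_map.
by apply: idealM_map; [exact: f_zg_map|exact: idl_r_map].
Qed.

Lemma AB_zg_map (u : pres_over f c d) z : z \in idl_AB c -> zg_map u z \in idl_AB d.
Proof. by apply: idealD_map; [exact: A_zg_map|exact: B_zg_map]. Qed.
End Maps.

Lemma subrACA (V : zmodType) (x y z t : V) : (x - y) - (z - t) = (x - z) - (y - t).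
Proof. by rewrite !opprD !opprK addrACA. Qed.

Section RingIdentities.
Variable R : pzRingType.
Implicit Types a b c : R.

Lemma mul2_diff a a' b b' : a * b - a' * b' = (a - a') * b + a' * (b - b').
Proof. by rewrite mulrBl mulrBr addrA subrK. Qed.

Lemma mul3_diff a a' b b' c c' :
  a * b * c - a' * b' * c' =
  (a - a') * b * c + a' * (b - b') * c + a' * b' * (c - c').
Proof. by rewrite mul2_diff [X in X * c]mul2_diff mulrDl. Qed.

Lemma fox_diff a a' w w' b :
  (a * w - a' * w') * b - (a - a') * (w * b) = a' * (w - w') * b.
Proof. by rewrite mulrA -mulrBl mul2_diff addrAC subrr add0r. Qed.
End RingIdentities.

(** For arbitrary homomorphisms [s] and [h], the difference of [s w] and [h w] has augmentation
    zero, so moving [w] across the product costs an element of [fff]. Neither homomorphism has to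
    lie over [G]. *)
Lemma prod_lift (G G' : smallGroup) (c : pres G) (d : pres G')
    (X : Type) (gn : X -> pres_src c) (gnB : free_basis gn)
    (s h : {multiplicative pres_src c -> pres_src d}) (K : zmodClosed (zgring (pres_src d))) :
    (forall x, x \in idl_fff d -> x \in K) ->
  exists Phi : {additive zgring (pres_src c) -> Quotient.quot K},
    forall a b, a \in idl_f c -> b \in idl_f c ->
      Phi (a * b) = qpi K (zg_map s a * zg_map h b).
Proof.
move=> hK.
apply: (@fox_lift _ _ _ gnB _ (fun a b => qpi K (zg_map s a * zg_map h b)) _ _
  (fun a => a \in idl_f c)).
- by move=> x x' y; rewrite zg_mapB mulrBl raddfB.
- by move=> x y y'; rewrite zg_mapB mulrBr raddfB.
- by move=> a w ha; apply: f_mulr.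
- move=> a w y ha hy; apply/qpi_eq/hK.
  rewrite !zg_map_mul mulrA -mulrBl -mulrBr.
  apply: fffM; [exact: f_zg_map| |exact: f_zg_map].
  by rewrite !zg_mapU; apply: aug_zgUB.
Qed.

Lemma zg_map0 (G H : groupType) (f : {multiplicative G -> H}) : zg_map f 0 = 0.
Proof. exact: raddf0. Qed.

Section Parallel.
Variables (G : smallGroup) (c d : pres G).
Variables (u v : pres_over (idfun : {multiplicative G -> G}) c d).

Lemma over_diff z : zg_map u z - zg_map v z \in idl_r d.
Proof.
apply/mem_ker_zg.
apply: etrans (zg_mapB _ _ _) _; apply/eqP; rewrite subr_eq0; apply/eqP.
exact: etrans (over_zg u z) (esym (over_zg v z)).
Qed.

Lemma ff_parallel z : z \in idl_ff c -> zg_map u z - zg_map v z \in idl_AB d.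
Proof.
move: z; apply: idealM_ind => [a b ha hb|a b ha hb|].
- rewrite !zg_map_mul mul2_diff rpredD //.
    by apply/A_AB/rf_A; [exact: over_diff|exact: f_zg_map].
  by apply/B_AB/fr_B; [exact: f_zg_map|exact: over_diff].
- by rewrite !zg_mapB subrACA rpredB.
- by rewrite !zg_map0 subrr rpred0.
Qed.

Variables (X : Type) (gn : X -> pres_src c) (gnB : free_basis gn).

(* On [A] the difference [u - v] agrees modulo [I] with [a * b |-> (u a - v a) * u b],
   which kills [B]. *)
Lemma AB_parallel z : z \in idl_A c -> z \in idl_B c ->
  zg_map u z - zg_map v z \in idl_main d.
Proof.
have [Phi PhiE] : exists Phi : {additive zgring (pres_src c) -> Quotient.quot (idl_main d)},
    forall a b, a \in idl_f c -> b \in idl_f c ->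
      Phi (a * b) = qpi (idl_main d) ((zg_map u a - zg_map v a) * zg_map u b).
  apply: (@fox_lift _ _ _ gnB _
    (fun a b => qpi (idl_main d) ((zg_map u a - zg_map v a) * zg_map u b)) _ _
    (fun a => a \in idl_f c)).
  - by move=> x x' y; rewrite !zg_mapB subrACA mulrBl raddfB.
  - by move=> x y y'; rewrite zg_mapB mulrBr raddfB.
  - by move=> a w ha; apply: f_mulr.
  - move=> a w y ha hy; apply/qpi_eq.
    rewrite (zg_map_mul u a) (zg_map_mul v a) (zg_map_mul u _ y) fox_diff.
    by apply: main_frf; [exact: f_zg_map|exact: over_diff|exact: f_zg_map].
have PhiF x : x \in idl_fff c -> Phi x = 0.
  move: x; apply: idl_fff_ind => [a b e ha hb he|x y hx hy|]; last exact: raddf0.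
    rewrite PhiE //; last exact: f_mulr.
    apply/qpi_eq0; rewrite !zg_map_mul mul2_diff mulrDl rpredD //.
      by apply: main_rff; [exact: over_diff|exact: f_zg_map|exact: f_zg_map].
    by apply: main_frf; [exact: f_zg_map|exact: over_diff|exact: f_zg_map].
  by rewrite raddfB hx hy subrr.
have PhiA x : x \in idl_A c -> Phi x = qpi _ (zg_map u x - zg_map v x).
  move: x; apply: idl_A_ind => [a b ha hb|x hx|x y hx hy|].
  - rewrite PhiE //; last exact: r_f.
    apply/esym/qpi_eq; rewrite !zg_map_mul mul2_diff addrAC subrr add0r.
    by apply: main_rr; [exact: idl_r_map|exact: over_diff].
  - rewrite PhiF //; apply/esym/qpi_eq0.
    move: x hx; apply: idl_fff_ind => [a b e ha hb he|x y hx hy|].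
    + have [ha' hb' he'] : [/\ zg_map v a \in idl_f d, zg_map u b \in idl_f d
                              & zg_map u e \in idl_f d].
        by split; exact: f_zg_map.
      have hb2 : zg_map v b \in idl_f d by exact: f_zg_map.
      rewrite !zg_map_mul mul3_diff; apply: rpredD; first apply: rpredD.
      * by apply: main_rff; [exact: over_diff|exact: hb'|exact: he'].
      * by apply: main_frf; [exact: ha'|exact: over_diff|exact: he'].
      * by apply: main_ffr; [exact: ha'|exact: hb2|exact: over_diff].
    + by rewrite !zg_mapB subrACA rpredB.
    + by rewrite !zg_map0 subrr rpred0.
  - rewrite (raddfB Phi) hx hy -(raddfB (qpi (idl_main d))); congr (qpi _ _).
    by rewrite subrACA !zg_mapB.
  - by rewrite !zg_map0 subrr !raddf0.
have PhiB x : x \in idl_B c -> Phi x = 0.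
  move: x; apply: idl_B_ind => [a b ha hb|x hx|x y hx hy|]; last exact: raddf0.
  - rewrite PhiE //; last exact: r_f.
    by apply/qpi_eq0/main_rr; [exact: over_diff|exact: idl_r_map].
  - exact: PhiF.
  - by rewrite raddfB hx hy subrr.
by move=> hA hB; apply/qpi_eq0; rewrite -PhiA // PhiB.
Qed.
End Parallel.

(* [sc_kill] deletes the generators of the first summand; it is a group
   morphism but not a morphism over [G]. *)
Record std_copowers (G : smallGroup) := StdCopowers {
  sc_cp :> copowers (Pres_cat G);
  sc_basis : forall n, exists (X : choiceType) (g : X -> pres_src (sc_cp n : pres G)),
    free_basis g;
  sc_kill : forall n, {multiplicative pres_src (sc_cp n.+1 : pres G) ->
                                      pres_src (sc_cp n : pres G)};
  sc_kill_face0 : forall n x, sc_kill n (po_map (face sc_cp ord0 : hom (sc_cp n) _) x) = x;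
  sc_kill_face1 : forall x,
    sc_kill 0%N (po_map (face sc_cp (lift ord0 ord0) : hom (sc_cp 0%N) _) x) = 1%g;
  sc_kill_faceS : forall n (i : 'I_n.+2) x,
    sc_kill n.+1 (po_map (face sc_cp (lift ord0 i)) x) = po_map (face sc_cp i) (sc_kill n x) }.

(** * Free groups on copies of the underlying set of the group *)

Section Construction.
Variable G : smallGroup.

(* Indices are taken in a subtype of [nat], as ['I_n] is not small. *)
Definition Sn (n : nat) : smallType := {k : nat | (k < n.+1)%N}.
Definition o2s n (i : 'I_n.+1) : Sn n := exist _ (nat_of_ord i) (ltn_ord i).
Definition s2o n (k : Sn n) : 'I_n.+1 := Ordinal (proj2_sig k).
Lemma s2oK n : cancel (@s2o n) (@o2s n).
Proof. by move=> [k hk]; congr exist; apply: eq_irrelevance. Qed.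
Lemma o2sK n : cancel (@o2s n) (@s2o n).
Proof. by move=> i; apply: val_inj. Qed.

(** With generators indexed by all elements of [G], weak initiality amounts to choosing a preimage
    of each element; [n + 1] copies of the generators give the copower. *)
Definition Xn (n : nat) : smallType := (sg_sort G * Sn n)%type.
Definition sgen n (g : sg_sort G) (i : 'I_n.+1) : FrG (Xn n) := @gen (Xn n) (g, o2s i).

Lemma Xn_ind n (P : Xn n -> Prop) : (forall g i, P (g, o2s i)) -> forall p, P p.
Proof. by move=> h [g k]; rewrite -[k]s2oK; apply: h. Qed.

Definition cn_map n : {multiplicative FrG (Xn n) -> G} := fr_ext (fun p : Xn n => p.1 : G).

Lemma cn_mapE n (p : Xn n) : cn_map n (gen p) = p.1.
Proof. exact: fr_extE. Qed.

Lemma cn_surj n (g : G) : exists x, cn_map n x = g.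
Proof. by exists (sgen g ord0); rewrite cn_mapE. Qed.

Definition cn n : pres G := Pres (FrG_free (Xn n)) (@cn_surj n).

Section MapOut.
Variables (n : nat) (e : pres G) (t : Xn n -> pres_src e).
Hypothesis tE : forall p, pres_map e (t p) = p.1.

Fact cn_out_over (x : pres_src (cn n)) : pres_map e (fr_ext t x) = idfun (pres_map (cn n) x).
Proof.
apply: (free_basis_eq (f1 := pres_map e \o fr_ext t) (f2 := pres_map (cn n)) (Fr_basis (Xn n))).
by move=> p; rewrite [RHS]cn_mapE /= fr_extE tE.
Qed.
Definition cn_out : pres_over idfun (cn n) e :=
  @PresOver G G idfun (cn n) e (fr_ext t) cn_out_over.

Lemma cn_outE p : cn_out (gen p) = t p.
Proof. exact: fr_extE. Qed.
End MapOut.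

Lemma cn_hom_eq n (e : pres G) (u v : pres_over idfun (cn n) e) :
  (forall g i, u (sgen g i) = v (sgen g i)) -> u = v.
Proof.
move=> h; apply: pres_over_eq; apply: free_basis_eq (Fr_basis (Xn n)) _.
by elim/Xn_ind; apply: h.
Qed.

Definition cn_in n (i : 'I_n.+1) : pres_over idfun (cn 0) (cn n) :=
  cn_out (n := 0) (e := cn n) (t := fun p => sgen p.1 i) (fun p => cn_mapE (n := n) (p.1, o2s i)).

Lemma cn_inE n (i : 'I_n.+1) g k : cn_in i (sgen g k) = sgen g i.
Proof. exact: cn_outE. Qed.

Lemma cn_in0 : cn_in (ord0 : 'I_1) = idc (cn 0 : Pres_cat G).
Proof. by apply: cn_hom_eq => g i; rewrite cn_inE (ord1 i). Qed.

Lemma cn_ext n (e : Pres_cat G) (u : 'I_n.+1 -> hom (cn 0 : Pres_cat G) e) :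
  exists w : hom (cn n : Pres_cat G) e, forall i, compc w (cn_in i : hom (cn 0 : Pres_cat G) (cn n)) = u i.
Proof.
pose t (p : Xn n) : pres_src (e : pres G) := po_map (u (s2o p.2)) (@sgen 0 p.1 ord0).
have tE p : pres_map (e : pres G) (t p) = p.1.
  by rewrite (po_over (u (s2o p.2))) cn_mapE.
exists (cn_out tE : hom (cn n : Pres_cat G) e) => i.
apply: cn_hom_eq => g k; rewrite (ord1 k).
apply: etrans (congr1 (cn_out tE) (cn_inE i g ord0)) _.
by rewrite cn_outE /t o2sK.
Qed.

Lemma cn_eq n (e : Pres_cat G) (w w' : hom (cn n : Pres_cat G) e) :
  (forall i : 'I_n.+1, compc w (cn_in i : hom (cn 0 : Pres_cat G) (cn n)) =
     compc w' (cn_in i : hom (cn 0 : Pres_cat G) (cn n))) -> w = w'.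
Proof.
move=> h; apply: cn_hom_eq => g i.
have e1 : compc w (cn_in i : hom (cn 0 : Pres_cat G) (cn n)) = _ := h i.
have := congr1 (fun v : pres_over idfun (cn 0) e => v (@sgen 0 g ord0)) e1.
have E (v : hom (cn n : Pres_cat G) e) :
    po_map (compc v (cn_in i : hom (cn 0 : Pres_cat G) (cn n))) (@sgen 0 g ord0) = po_map v (sgen g i).
  exact: (congr1 (po_map v) (cn_inE i g ord0)).
by rewrite !E.
Qed.

Lemma cn_init (e : Pres_cat G) : exists u : hom (cn 0 : Pres_cat G) e, True.
Proof.
pose t (p : Xn 0) := sval (cid (pres_surj (e : pres G) p.1)).
have tE p : pres_map (e : pres G) (t p) = p.1 by rewrite /t; case: cid.
by exists (cn_out tE).
Qed.

Definition cn_cp : copowers (Pres_cat G) :=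
  @Copowers (Pres_cat G) (cn : nat -> Pres_cat G) cn_in cn_in0 cn_ext cn_eq cn_init.

Lemma cn_faceE n (i : 'I_n.+2) g k :
  po_map (face cn_cp i : hom (cn_cp n) _) (sgen g k) = sgen g (lift i k).
Proof.
have := congr1 (fun v : pres_over idfun (cn 0) (cn n.+1) => v (@sgen 0 g ord0))
  (faceE cn_cp i k).
rewrite [RHS]cn_inE => <-.
by congr (po_map _ _); rewrite [RHS]cn_inE.
Qed.

Definition kill_gen n (p : Xn n.+1) : FrG (Xn n) :=
  if unlift ord0 (s2o p.2) is Some i then sgen p.1 i else 1%g.
Definition kill n : {multiplicative FrG (Xn n.+1) -> FrG (Xn n)} := fr_ext (@kill_gen n).

Lemma killE n g k : kill n (sgen g k) = if unlift ord0 k is Some i then sgen g i else 1%g.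
Proof. by rewrite /kill /sgen [LHS]fr_extE /kill_gen o2sK. Qed.

Lemma cn_mor_eq n (H : groupType) (u v : {multiplicative FrG (Xn n) -> H}) :
  (forall g i, u (sgen g i) = v (sgen g i)) -> u =1 v.
Proof. by move=> h; apply: free_basis_eq (Fr_basis (Xn n)) _; elim/Xn_ind; apply: h. Qed.

Lemma kill_face0 n x : kill n (po_map (face cn_cp ord0 : hom (cn_cp n) _) x) = x.
Proof.
pose w : {multiplicative FrG (Xn n) -> FrG (Xn n.+1)} := po_map (face cn_cp ord0 : hom (cn_cp n) _).
apply: (@cn_mor_eq n _ (kill n \o w) idfun) => g k.
by rewrite [LHS](congr1 (kill n) (cn_faceE ord0 g k)) killE liftK.
Qed.

Lemma kill_face1 x :
  kill 0 (po_map (face cn_cp (lift ord0 ord0) : hom (cn_cp 0%N) _) x) = 1%g.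
Proof.
pose w : {multiplicative FrG (Xn 0) -> FrG (Xn 1)} :=
  po_map (face cn_cp (lift ord0 ord0) : hom (cn_cp 0%N) _).
apply: (@cn_mor_eq 0 _ (kill 0 \o w) (@one_fun _ _)) => g k.
rewrite [LHS](congr1 (kill 0) (cn_faceE (lift ord0 ord0) g k)) killE.
have -> : lift (lift ord0 (ord0 : 'I_1)) k = (ord0 : 'I_2).
  by apply: val_inj; case: k => [[]].
by rewrite unlift_none.
Qed.

Lemma kill_faceS n (i : 'I_n.+2) x :
  kill n.+1 (po_map (face cn_cp (lift ord0 i)) x) = po_map (face cn_cp i) (kill n x).
Proof.
pose w : {multiplicative FrG (Xn n.+1) -> FrG (Xn n.+2)} :=
  po_map (face cn_cp (lift ord0 i) : hom (cn_cp n.+1) _).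
pose w' : {multiplicative FrG (Xn n) -> FrG (Xn n.+1)} := po_map (face cn_cp i : hom (cn_cp n) _).
apply: (@cn_mor_eq n.+1 _ (kill n.+1 \o w) (w' \o kill n)) => g k.
rewrite [LHS](congr1 (kill n.+1) (cn_faceE (lift ord0 i) g k)) killE.
rewrite [RHS](congr1 w' (killE g k)).
case: (unliftP ord0 k) => [k'|] ->.
  have -> : lift (lift ord0 i) (lift ord0 k') = lift ord0 (lift i k').
    by apply: val_inj; rewrite /= /bump; lia.
  by rewrite liftK; apply/esym/cn_faceE.
have -> : lift (lift ord0 i) (ord0 : 'I_n.+2) = ord0 by apply: val_inj.
by rewrite unlift_none mulg_morph1.
Qed.
End Construction.

Lemma std_exists (G : smallGroup) : std_copowers G.
Proof.
refine (@StdCopowers G (cn_cp G) _ (@kill G) (@kill_face0 G) (@kill_face1 G) (@kill_faceS G)).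
move=> n.
pose X : choiceType := HB.pack (Xn G n) (gen_choiceMixin (Xn G n)) (gen_eqMixin (Xn G n)).
by exists X, (@gen (Xn G n)); apply: Fr_basis.
Qed.

Lemma sgnS n : sgn n.+1 = - sgn n.
Proof. by rewrite /sgn exprS mulN1r. Qed.

Lemma altsum_recl (V : zmodType) n (a : 'I_n.+1 -> V) :
  \sum_(i < n.+1) a i *~ sgn i = a ord0 - \sum_(i < n) a (lift ord0 i) *~ sgn i.
Proof.
rewrite big_ord_recl {1}/sgn mulr1z -sumrN; congr (_ + _).
by apply: eq_bigr => i _; rewrite lift0 sgnS mulrNz.
Qed.

Section ZFunctor.
Variable G : smallGroup.

Definition zf_ob (c : Pres_cat G) : zmodType := zgring (pres_src c).
Definition zf_hom (a b : Pres_cat G) (u : hom a b) : {additive zf_ob a -> zf_ob b} :=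
  zg_map (po_map u).

Fact zf_id (a : Pres_cat G) x : zf_hom (idc a) x = x.
Proof. exact: (zg_map_id (f := idfun)). Qed.

Fact zf_comp (a b c : Pres_cat G) (g : hom b c) (f : hom a b) x :
  zf_hom (compc g f) x = zf_hom g (zf_hom f x).
Proof.
have := zg_map_comp (f := po_map f) (g := po_map g) (f' := idfun)
  (g' := po_map (compc g f : pres_over _ _ _)) (fun=> erefl) x.
by rewrite (zg_map_id (f := idfun)) // => ->.
Qed.

(** Ambient functor for the cochains of all the ideals: coboundaries are computed on ring elements,
    and membership in an ideal is a separate hypothesis. *)
Definition zfunctor : abfunctor (Pres_cat G) := AbFunctor zf_id zf_comp.

Definition main_val (c : Pres_cat G) : {additive main_functor G c -> zfunctor c} := val.
Fact main_val_nat (a b : Pres_cat G) (u : hom a b) x :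
  main_val b (af_hom (main_functor G) u x) = af_hom zfunctor u (main_val a x).
Proof. exact: main_mapE. Qed.
Definition main_incl : nat_trans (main_functor G) zfunctor :=
  @NatTrans _ (main_functor G) zfunctor main_val main_val_nat.
End ZFunctor.

(** * Cochains in the group rings and the deletion homotopy *)

Section Cochains.
Variables (G : smallGroup) (S : std_copowers G).
Local Notation cp n := (cp_ob (sc_cp S) n : pres G).
Local Notation Z n := (zgring (pres_src (cp n))).
Local Notation face n i := (face (sc_cp S) i : pres_over idfun (cp n) (cp n.+1)).

Definition dz n : {additive Z n -> Z n.+1} := cobd S (zfunctor G) n.

Lemma dzE n (z : Z n) : dz n z = \sum_(i < n.+2) zg_map (face n i) z *~ sgn i.
Proof. exact: (@cobdE _ S (zfunctor G) n z). Qed.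

Lemma dz_dz n (z : Z n) : dz n.+1 (dz n z) = 0.
Proof. exact: (@cobd_cobd _ S (zfunctor G)). Qed.

Lemma dz_main n (x : subz (idl_main (cp n))) :
  val (cobd S (main_functor G) n x) = dz n (val x).
Proof. exact: (@cobd_nat _ S _ _ (main_incl G) n x). Qed.

Lemma dz0E (z : Z 0) :
  dz 0 z = zg_map (face 0%N ord0) z - zg_map (face 0%N (lift ord0 ord0)) z.
Proof. exact: (@cobd0E _ S (zfunctor G)). Qed.

Lemma dz_mem (K : forall c : pres G, zmodClosed (zgring (pres_src c))) n (z : Z n) :
    (forall (a b : pres G) (u : pres_over idfun a b) x, x \in K a -> zg_map u x \in K b) ->
  z \in K (cp n) -> dz n z \in K (cp n.+1).
Proof.
move=> hK hz; rewrite dzE; apply: rpred_sum => i _; apply: rpredMz.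
exact: (hK _ _ _ _ hz).
Qed.

Lemma ff_dz n (z : Z n) : z \in idl_ff (cp n) -> dz n z \in idl_ff (cp n.+1).
Proof. by apply: (@dz_mem (@idl_ff G)) => a b u x; apply: ff_zg_map. Qed.
Lemma A_dz n (z : Z n) : z \in idl_A (cp n) -> dz n z \in idl_A (cp n.+1).
Proof. by apply: (@dz_mem (@idl_A G)) => a b u x; apply: (@A_zg_map _ _ idfun). Qed.
Lemma B_dz n (z : Z n) : z \in idl_B (cp n) -> dz n z \in idl_B (cp n.+1).
Proof. by apply: (@dz_mem (@idl_B G)) => a b u x; apply: (@B_zg_map _ _ idfun). Qed.

Definition zkill n : {additive Z n.+1 -> Z n} := zg_map (sc_kill S n).

Lemma zkill_face0 n (z : Z n) : zkill n (zg_map (face n ord0) z) = z.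
Proof.
elim/zg_ind: z => [g|x y hx hy]; last by rewrite zg_mapB (raddfB (zkill _)) hx hy.
by rewrite zg_mapU [LHS]zg_mapU sc_kill_face0.
Qed.

(** The second face in degree zero lands in the deleted summand, so the composite is the
    augmentation; this is why the contraction reaches degree zero on [f]. *)
Lemma zkill_face1 (z : Z 0) : z \in idl_f (cp 0%N) ->
  zkill 0 (zg_map (face 0%N (lift ord0 ord0)) z) = 0.
Proof.
move=> /mem_ker_aug; suff -> : zkill 0 (zg_map (face 0%N (lift ord0 ord0)) z) = (aug _ z)%:~R.
  by move=> ->.
elim/zg_ind: z => [g|x y hx hy]; last by rewrite zg_mapB (raddfB (zkill _)) hx hy augB rmorphB.
by rewrite zg_mapU [LHS]zg_mapU sc_kill_face1 aug_zgU.
Qed.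

Lemma zkill_faceS n (i : 'I_n.+2) (z : Z n.+1) :
  zkill n.+1 (zg_map (face n.+1 (lift ord0 i)) z) = zg_map (face n i) (zkill n z).
Proof.
elim/zg_ind: z => [g|x y hx hy]; last by rewrite zg_mapB (raddfB (zkill n.+1)) (raddfB (zkill n)) zg_mapB hx hy.
by rewrite zg_mapU [LHS]zg_mapU [zkill n _]zg_mapU zg_mapU sc_kill_faceS.
Qed.

Lemma zkill_dz n (z : Z n.+1) : zkill n.+1 (dz n.+1 z) = z - dz n (zkill n z).
Proof.
transitivity (\sum_i zkill n.+1 (zg_map (face n.+1 i) z) *~ sgn i).
  by rewrite dzE (raddf_sum (zkill n.+1)); apply: eq_bigr => i _; rewrite (raddfMz (zkill n.+1)).
transitivity (zkill n.+1 (zg_map (face n.+1 ord0) z) -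
    \sum_i zkill n.+1 (zg_map (face n.+1 (lift ord0 i)) z) *~ sgn i).
  exact: (altsum_recl (fun i => zkill n.+1 (zg_map (face n.+1 i) z))).
apply: (congr2 (fun a b : Z n.+1 => a - b)); first exact: zkill_face0.
apply: etrans (esym (dzE _)).
by apply: eq_bigr => i _; apply: (congr1 (fun a : Z n.+1 => a *~ sgn i)); apply: zkill_faceS.
Qed.

Lemma zkill_dz0 (z : Z 0) : z \in idl_f (cp 0%N) -> zkill 0 (dz 0 z) = z.
Proof.
move=> hf; rewrite dz0E; apply: etrans (raddfB (zkill 0) _ _) _.
apply: etrans (congr2 (fun a b : Z 0 => a - b) (zkill_face0 z) (zkill_face1 hf)) _.
exact: subr0.
Qed.

(** Every group homomorphism preserves the augmentation ideal, so the deletion acts on powers of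
    [f], although it does not lie over [G]. *)
Lemma zkill_ff n (z : Z n.+1) : z \in idl_ff (cp n.+1) -> zkill n z \in idl_ff (cp n).
Proof. exact: ff_zg_map. Qed.

Lemma dz_cycle n (z : Z n.+1) : dz n.+1 z = 0 -> z = dz n (zkill n z).
Proof.
move=> hd; apply/eqP; rewrite -subr_eq0; apply/eqP.
exact: etrans (esym (zkill_dz z)) (etrans (congr1 (zkill n.+1) hd) (raddf0 (zkill n.+1))).
Qed.

Lemma dz_inj0 (z : Z 0) : z \in idl_f (cp 0%N) -> dz 0 z = 0 -> z = 0.
Proof.
move=> hf hd; exact: etrans (esym (zkill_dz0 hf)) (etrans (congr1 (zkill 0) hd) (raddf0 (zkill 0))).
Qed.
End Cochains.

(** * Contractions *)

Section QuotientAcyclic.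
Variables (G : smallGroup) (S : std_copowers G).
Local Notation cp n := (cp_ob (sc_cp S) n : pres G).
Local Notation Z n := (zgring (pres_src (cp n))).
Local Notation face n i := (face (sc_cp S) i : pres_over idfun (cp n) (cp n.+1)).

(* Contraction of [ff / K] sending [a * b] to [sigma a * tau b]; for the two
   filtrations [A] and [B] one of [sigma], [tau] is the deletion of the first
   summand and the other one a morphism over [G]. *)
Variable K : forall c : pres G, zmodClosed (zgring (pres_src c)).
Variables sigma tau : forall n, {multiplicative pres_src (cp n.+1) -> pres_src (cp n)}.
Hypothesis fffK : forall c x, x \in idl_fff c -> x \in K c.
Hypothesis H0 : forall n (a b : Z n), a \in idl_f (cp n) -> b \in idl_f (cp n) ->
  zg_map (sigma n) (zg_map (face n ord0) a) * zg_map (tau n) (zg_map (face n ord0) b) - a * b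
    \in K (cp n).
Hypothesis H1 : forall a b : Z 0, a \in idl_f (cp 0%N) -> b \in idl_f (cp 0%N) ->
  zg_map (sigma 0) (zg_map (face 0%N (lift ord0 ord0)) a) *
  zg_map (tau 0) (zg_map (face 0%N (lift ord0 ord0)) b) \in K (cp 0%N).
Hypothesis HS : forall n (i : 'I_n.+2) (a b : Z n.+1),
  a \in idl_f (cp n.+1) -> b \in idl_f (cp n.+1) ->
  zg_map (sigma n.+1) (zg_map (face n.+1 (lift ord0 i)) a) *
  zg_map (tau n.+1) (zg_map (face n.+1 (lift ord0 i)) b) -
  zg_map (face n i) (zg_map (sigma n) a * zg_map (tau n) b) \in K (cp n.+1).
Hypothesis HK : forall n (Phi : {additive Z n.+1 -> Quotient.quot (K (cp n))}),
  (forall a b, a \in idl_f (cp n.+1) -> b \in idl_f (cp n.+1) ->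
     Phi (a * b) = qpi (K (cp n)) (zg_map (sigma n) a * zg_map (tau n) b)) ->
  forall z, z \in K (cp n.+1) -> Phi z = 0.

Lemma quot_acyclic0 (z : Z 0) : z \in idl_ff (cp 0%N) -> dz S 0 z \in K (cp 1%N) ->
  z \in K (cp 0%N).
Proof.
have [X [g gB]] := sc_basis S 1.
have [Phi PhiE] := prod_lift gB (sigma 0) (tau 0) (@fffK (cp 0%N)).
move=> zff /(HK PhiE); suff -> : Phi (dz S 0 z) = qpi (K (cp 0%N)) z by move/qpi_eq0.
move: z zff; apply: idealM_ind => [a b ha hb|x y hx hy|].
- have fa i : zg_map (face 0%N i) a \in idl_f (cp 1%N) by exact: f_zg_map.
  have fb i : zg_map (face 0%N i) b \in idl_f (cp 1%N) by exact: f_zg_map.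
  have PE i : Phi (zg_map (face 0%N i) (a * b)) =
      qpi (K (cp 0%N)) (zg_map (sigma 0) (zg_map (face 0%N i) a) *
                        zg_map (tau 0) (zg_map (face 0%N i) b)).
    by rewrite zg_map_mul; exact: (PhiE _ _ (fa i) (fb i)).
  rewrite dz0E (raddfB Phi).
  apply: etrans (congr2 (fun u v : Quotient.quot (K (cp 0%N)) => u - v)
    (PE ord0) (PE (lift ord0 ord0))) _.
  apply: etrans (congr1 (fun v => _ - v) ((qpi_eq0 (K (cp 0%N)) _).2 (H1 ha hb))) _.
  by rewrite subr0; apply/qpi_eq; apply: H0.
- by rewrite (raddfB (dz S 0)) (raddfB Phi) hx hy -raddfB.
- by rewrite (raddf0 (dz S 0)) (raddf0 Phi) raddf0.
Qed.

Lemma quot_acyclicS n (z : Z n.+1) : z \in idl_ff (cp n.+1) -> dz S n.+1 z \in K (cp n.+2) ->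
  exists y, y \in idl_ff (cp n) /\ z - dz S n y \in K (cp n.+1).
Proof.
have [X [g gB]] := sc_basis S n.+2.
have [Phi PhiE] := prod_lift gB (sigma n.+1) (tau n.+1) (@fffK (cp n.+1)).
move=> zff /(HK PhiE).
(* The contraction takes values in [ff / K], while the primitive must lie in [ff]; it is therefore
   chosen on each product and assembled through the induction. *)
suff [y [yff ->]] : exists y, y \in idl_ff (cp n) /\
    Phi (dz S n.+1 z) = qpi (K (cp n.+1)) (z - dz S n y).
  by move/qpi_eq0 => h; exists y.
move: z zff; apply: idealM_ind => [a b ha hb|x x' [y [hy ey]] [y' [hy' ey']]|].
- exists (zg_map (sigma n) a * zg_map (tau n) b); split.
    by apply: ffM; exact: f_zg_map.
  have fa i : zg_map (face n.+1 i) a \in idl_f (cp n.+2) by exact: f_zg_map.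
  have fb i : zg_map (face n.+1 i) b \in idl_f (cp n.+2) by exact: f_zg_map.
  have PE i : Phi (zg_map (face n.+1 i) (a * b)) =
      qpi (K (cp n.+1)) (zg_map (sigma n.+1) (zg_map (face n.+1 i) a) *
                         zg_map (tau n.+1) (zg_map (face n.+1 i) b)).
    by rewrite zg_map_mul; exact: (PhiE _ _ (fa i) (fb i)).
  transitivity (\sum_i Phi (zg_map (face n.+1 i) (a * b)) *~ sgn i).
    by rewrite dzE (raddf_sum Phi); apply: eq_bigr => i _; rewrite (raddfMz Phi).
  apply: etrans (altsum_recl (fun i => Phi (zg_map (face n.+1 i) (a * b)))) _.
  rewrite (raddfB (qpi (K (cp n.+1)))).
  apply: (congr2 (fun a b : Quotient.quot (K (cp n.+1)) => a - b)).
    by rewrite PE; apply/qpi_eq/H0.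
  rewrite dzE (raddf_sum (qpi (K (cp n.+1)))); apply: eq_bigr => i _.
  rewrite (raddfMz (qpi (K (cp n.+1)))); congr (_ *~ _).
  by rewrite PE; apply/qpi_eq/HS.
- exists (y - y'); split; first exact: rpredB.
  by rewrite (raddfB (dz S n.+1)) (raddfB Phi) ey ey' -raddfB (raddfB (dz S n)) subrACA.
- exists 0; split; first exact: rpred0.
  by rewrite (raddf0 (dz S n.+1)) (raddf0 Phi) (raddf0 (dz S n)) subr0 raddf0.
Qed.
End QuotientAcyclic.

Section Acyclicity.
Variables (G : smallGroup) (S : std_copowers G).
Local Notation cp n := (cp_ob (sc_cp S) n : pres G).
Local Notation Z n := (zgring (pres_src (cp n))).
Local Notation face n i := (face (sc_cp S) i : pres_over idfun (cp n) (cp n.+1)).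

Lemma over_zg1 (c d : pres G) (u : pres_over idfun c d) z :
  zg_map (pres_map d) (zg_map u z) = zg_map (pres_map c) z.
Proof.
elim/zg_ind: z => [g|x y hx hy]; last by rewrite !zg_mapB hx hy.
by rewrite !zg_mapU po_over.
Qed.

Lemma r_diff (d : pres G) (z w : zgring (pres_src d)) :
  zg_map (pres_map d) z = zg_map (pres_map d) w -> z - w \in idl_r d.
Proof. by move=> e; apply/mem_ker_zg; rewrite zg_mapB e subrr. Qed.

(** This folds every summand onto the first one. It lies over [G], hence preserves [r], and replaces
    the deletion on the factor that carries [r]. *)
Definition retr n : pres_over idfun (cp n.+1) (cp n) :=
  copair (c := S) (n := n.+1) (e := cp n) (fun=> cp_in S ord0).

Lemma A_kill n (Phi : {additive Z n.+1 -> Quotient.quot (idl_A (cp n))}) :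
  (forall a b, a \in idl_f (cp n.+1) -> b \in idl_f (cp n.+1) ->
     Phi (a * b) = qpi (idl_A (cp n)) (zg_map (retr n) a * zg_map (sc_kill S n) b)) ->
  forall z, z \in idl_A (cp n.+1) -> Phi z = 0.
Proof.
move=> PhiE; apply: idl_A_ind => [a b ha hb|x|x y hx hy|]; last exact: raddf0.
- rewrite (PhiE _ _ (r_f ha) hb); apply/qpi_eq0/rf_A; last exact: f_zg_map.
  exact: (idl_r_map (f := idfun)).
- move: x; apply: idl_fff_ind => [a b d ha hb hd|x y hx hy|]; last exact: raddf0.
    rewrite (PhiE _ _ (f_mulr b ha) hd); apply/qpi_eq0/fff_A; rewrite zg_map_mul.
    by apply: fffM; exact: f_zg_map.
  by rewrite (raddfB Phi) hx hy subrr.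
- by rewrite (raddfB Phi) hx hy subrr.
Qed.

Lemma B_kill n (Phi : {additive Z n.+1 -> Quotient.quot (idl_B (cp n))}) :
  (forall a b, a \in idl_f (cp n.+1) -> b \in idl_f (cp n.+1) ->
     Phi (a * b) = qpi (idl_B (cp n)) (zg_map (sc_kill S n) a * zg_map (retr n) b)) ->
  forall z, z \in idl_B (cp n.+1) -> Phi z = 0.
Proof.
move=> PhiE; apply: idl_B_ind => [a b ha hb|x|x y hx hy|]; last exact: raddf0.
- rewrite (PhiE _ _ ha (r_f hb)); apply/qpi_eq0/fr_B; first exact: f_zg_map.
  exact: (idl_r_map (f := idfun)).
- move: x; apply: idl_fff_ind => [a b d ha hb hd|x y hx hy|]; last exact: raddf0.
    rewrite (PhiE _ _ (f_mulr b ha) hd); apply/qpi_eq0/fff_B; rewrite zg_map_mul.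
    by apply: fffM; exact: f_zg_map.
  by rewrite (raddfB Phi) hx hy subrr.
- by rewrite (raddfB Phi) hx hy subrr.
Qed.

Lemma retr_face0 n (a : Z n) : zg_map (retr n) (zg_map (face n ord0) a) - a \in idl_r (cp n).
Proof. by apply: r_diff; rewrite (over_zg1 (retr n)) (over_zg1 (face n ord0)). Qed.

Lemma retr_faceS n (i : 'I_n.+2) (a : Z n.+1) :
  zg_map (retr n.+1) (zg_map (face n.+1 (lift ord0 i)) a) -
  zg_map (face n i) (zg_map (retr n) a) \in idl_r (cp n.+1).
Proof.
apply: r_diff; rewrite (over_zg1 (retr n.+1)) (over_zg1 (face n.+1 _)).
by rewrite (over_zg1 (face n i)) (over_zg1 (retr n)).
Qed.

Let kf0 n (b : Z n) : zg_map (sc_kill S n) (zg_map (face n ord0) b) = b.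
Proof. exact: zkill_face0. Qed.
Let kfS n (i : 'I_n.+2) (b : Z n.+1) :
  zg_map (sc_kill S n.+1) (zg_map (face n.+1 (lift ord0 i)) b) =
  zg_map (face n i) (zg_map (sc_kill S n) b).
Proof. exact: zkill_faceS. Qed.
Let kf1 (b : Z 0) : b \in idl_f (cp 0%N) ->
  zg_map (sc_kill S 0) (zg_map (face 0%N (lift ord0 ord0)) b) = 0.
Proof. exact: zkill_face1. Qed.

Let A0 n (a b : Z n) : a \in idl_f (cp n) -> b \in idl_f (cp n) ->
  zg_map (retr n) (zg_map (face n ord0) a) * zg_map (sc_kill S n) (zg_map (face n ord0) b) -
    a * b \in idl_A (cp n).
Proof. by move=> ha hb; rewrite kf0 -mulrBl; apply: rf_A => //; exact: retr_face0. Qed.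
Let A1 (a b : Z 0) : a \in idl_f (cp 0%N) -> b \in idl_f (cp 0%N) ->
  zg_map (retr 0) (zg_map (face 0%N (lift ord0 ord0)) a) *
  zg_map (sc_kill S 0) (zg_map (face 0%N (lift ord0 ord0)) b) \in idl_A (cp 0%N).
Proof. by move=> ha hb; rewrite (kf1 hb) mulr0 rpred0. Qed.
Let AS n (i : 'I_n.+2) (a b : Z n.+1) : a \in idl_f (cp n.+1) -> b \in idl_f (cp n.+1) ->
  zg_map (retr n.+1) (zg_map (face n.+1 (lift ord0 i)) a) *
  zg_map (sc_kill S n.+1) (zg_map (face n.+1 (lift ord0 i)) b) -
  zg_map (face n i) (zg_map (retr n) a * zg_map (sc_kill S n) b) \in idl_A (cp n.+1).
Proof.
move=> ha hb; rewrite kfS zg_map_mul -mulrBl.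
by apply: rf_A; [exact: retr_faceS|do 2!apply: f_zg_map].
Qed.

Lemma A_acyclic0 (z : Z 0) : z \in idl_ff (cp 0%N) -> dz S 0 z \in idl_A (cp 1%N) ->
  z \in idl_A (cp 0%N).
Proof. exact: (quot_acyclic0 (K := @idl_A G) (@fff_A G) A0 A1 A_kill). Qed.
Lemma A_acyclicS n (z : Z n.+1) : z \in idl_ff (cp n.+1) -> dz S n.+1 z \in idl_A (cp n.+2) ->
  exists y, y \in idl_ff (cp n) /\ z - dz S n y \in idl_A (cp n.+1).
Proof. exact: (quot_acyclicS (K := @idl_A G) (@fff_A G) A0 AS A_kill). Qed.

Let B0 n (a b : Z n) : a \in idl_f (cp n) -> b \in idl_f (cp n) ->
  zg_map (sc_kill S n) (zg_map (face n ord0) a) * zg_map (retr n) (zg_map (face n ord0) b) -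
    a * b \in idl_B (cp n).
Proof. by move=> ha hb; rewrite kf0 -mulrBr; apply: fr_B => //; exact: retr_face0. Qed.
Let B1 (a b : Z 0) : a \in idl_f (cp 0%N) -> b \in idl_f (cp 0%N) ->
  zg_map (sc_kill S 0) (zg_map (face 0%N (lift ord0 ord0)) a) *
  zg_map (retr 0) (zg_map (face 0%N (lift ord0 ord0)) b) \in idl_B (cp 0%N).
Proof. by move=> ha hb; rewrite (kf1 ha) mul0r rpred0. Qed.
Let BS n (i : 'I_n.+2) (a b : Z n.+1) : a \in idl_f (cp n.+1) -> b \in idl_f (cp n.+1) ->
  zg_map (sc_kill S n.+1) (zg_map (face n.+1 (lift ord0 i)) a) *
  zg_map (retr n.+1) (zg_map (face n.+1 (lift ord0 i)) b) -
  zg_map (face n i) (zg_map (sc_kill S n) a * zg_map (retr n) b) \in idl_B (cp n.+1).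
Proof.
move=> ha hb; rewrite kfS zg_map_mul -mulrBr.
by apply: fr_B; [do 2!apply: f_zg_map|exact: retr_faceS].
Qed.

Lemma B_acyclic0 (z : Z 0) : z \in idl_ff (cp 0%N) -> dz S 0 z \in idl_B (cp 1%N) ->
  z \in idl_B (cp 0%N).
Proof. exact: (quot_acyclic0 (K := @idl_B G) (@fff_B G) B0 B1 B_kill). Qed.
Lemma B_acyclicS n (z : Z n.+1) : z \in idl_ff (cp n.+1) -> dz S n.+1 z \in idl_B (cp n.+2) ->
  exists y, y \in idl_ff (cp n) /\ z - dz S n y \in idl_B (cp n.+1).
Proof. exact: (quot_acyclicS (K := @idl_B G) (@fff_B G) B0 BS B_kill). Qed.
End Acyclicity.

Lemma sum_sgn n : \sum_(i < n) sgn i = (odd n)%:Z.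
Proof.
elim: n => [|n ih]; first by rewrite big_ord0.
by rewrite big_ord_recr /= ih /sgn -signr_odd; case: (odd n).
Qed.

Lemma zg_map_pres_comp (G : smallGroup) (a b c : pres G)
    (v : pres_over idfun b c) (u : pres_over idfun a b) z :
  zg_map (pres_comp v u) z = zg_map v (zg_map u z).
Proof.
elim/zg_ind: z => [g|x y hx hy]; last by rewrite !zg_mapB hx hy.
by rewrite !zg_mapU.
Qed.

Lemma zg_map_pres_id (G : smallGroup) (a : pres G) z : zg_map (pres_id a) z = z.
Proof. exact: (zg_map_id (f := idfun)). Qed.

Lemma rpred_subr (V : zmodType) (I : zmodClosed V) (x y : V) :
  x \in I -> x - y \in I -> y \in I.
Proof. by move=> hx hxy; rewrite -[y](subKr x); apply: rpredB. Qed.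

(** * Functors on which parallel morphisms agree *)

Section Constant.
Variables (G : smallGroup) (S : std_copowers G).
Local Notation cp n := (cp_ob (sc_cp S) n : pres G).
Local Notation Z n := (zgring (pres_src (cp n))).
Local Notation face n i := (face (sc_cp S) i : pres_over idfun (cp n) (cp n.+1)).

(* [Q / P] is a functor on which parallel morphisms agree. *)
Variable P : forall c : pres G, zmodClosed (zgring (pres_src c)).
Variable Q : forall c : pres G, zgring (pres_src c) -> Prop.
Hypothesis Pmap : forall (a b : pres G) (u : pres_over idfun a b) x, x \in P a -> zg_map u x \in P b.
Hypothesis Qmap : forall (a b : pres G) (u : pres_over idfun a b) x, Q x -> Q (zg_map u x).
Hypothesis Q0 : forall c : pres G, Q (0 : zgring (pres_src c)).
Hypothesis QP : forall n m (u v : pres_over idfun (cp n) (cp m)) (x : Z n),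
  Q x -> zg_map u x - zg_map v x \in P (cp m).

(** The [n + 2] alternating signs add up to [1] for odd [n] and to [0] for even [n]. *)
Lemma dz_const n (z : Z n) (w : Z n.+1) :
    (forall i, zg_map (face n i) z - w \in P (cp n.+1)) ->
  dz S n z - w *~ odd n \in P (cp n.+1).
Proof.
move=> h; have -> : w *~ odd n = \sum_(i < n.+2) w *~ sgn i.
  by rewrite -mulrz_sumr sum_sgn /= negbK.
rewrite dzE -sumrB; apply: rpred_sum => i _.
by rewrite -mulrzBl; apply: rpredMz.
Qed.

(** Modulo [P] the coboundary out of degree [n] is an identity for odd [n] and zero for even [n]. In
    the odd case the folded [z] is a primitive; in the even case the next coboundary is an identity,
    so [z] itself lies in [P] and [0] is a primitive. *)
Lemma const_acyclic n (z : Z n.+1) : Q z -> dz S n.+1 z \in P (cp n.+2) ->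
  exists w, Q w /\ z - dz S n w \in P (cp n.+1).
Proof.
move=> Qz hd.
have [on|en] := boolP (odd n).
  exists (zg_map (retr S n) z); split; first exact: Qmap.
  rewrite -opprB rpredN.
  have : dz S n (zg_map (retr S n) z) - z *~ odd n \in P (cp n.+1).
    apply: dz_const => i.
    have := QP (pres_comp (face n i) (retr S n)) (pres_id _) Qz.
    by rewrite zg_map_pres_id zg_map_pres_comp.
  by rewrite on mulr1z.
exists 0; split; first exact: Q0.
rewrite (raddf0 (dz S n)) subr0.
pose w := zg_map (face n.+1 ord0) z.
have hw : w \in P (cp n.+2).
  have : dz S n.+1 z - w *~ odd n.+1 \in P (cp n.+2) by apply: dz_const => i; exact: QP.
  by rewrite /= en mulr1z; apply: rpred_subr.
have := QP (pres_comp (retr S n.+1) (face n.+1 ord0)) (pres_id _) Qz.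
rewrite zg_map_pres_id zg_map_pres_comp; apply: rpred_subr.
exact: Pmap hw.
Qed.
End Constant.

Section Vanishing.
Variables (G : smallGroup) (S : std_copowers G).
Local Notation cp n := (cp_ob (sc_cp S) n : pres G).
Local Notation Z n := (zgring (pres_src (cp n))).

Lemma main_const n (z : Z n.+1) : z \in idl_A (cp n.+1) -> z \in idl_B (cp n.+1) ->
    dz S n.+1 z \in idl_main (cp n.+2) ->
  exists w, [/\ w \in idl_A (cp n), w \in idl_B (cp n) & z - dz S n w \in idl_main (cp n.+1)].
Proof.
move=> zA zB hd.
have [||||w [[wA wB] hw]] := @const_acyclic G S (@idl_main G)
  (fun c z => z \in idl_A c /\ z \in idl_B c) _ _ _ _ n z (conj zA zB) hd.
- by move=> a b u x; apply: (@idl_main_map _ _ idfun).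
- move=> a b u x [xA xB]; split; [exact: (@A_zg_map _ _ idfun)|exact: (@B_zg_map _ _ idfun)].
- by move=> c; split; apply: rpred0.
- move=> k m u v x [xA xB]; have [X [g gB]] := sc_basis S k.
  exact: (AB_parallel u v gB xA xB).
by exists w.
Qed.

Lemma AB_const n (z : Z n.+1) : z \in idl_ff (cp n.+1) ->
    dz S n.+1 z \in idl_AB (cp n.+2) ->
  exists w, w \in idl_ff (cp n) /\ z - dz S n w \in idl_AB (cp n.+1).
Proof.
apply: (@const_acyclic G S (@idl_AB G) (fun c z => z \in idl_ff c)).
- by move=> a b u x; apply: (@AB_zg_map _ _ idfun).
- by move=> a b u x; apply: ff_zg_map.
- by move=> c; apply: rpred0.
- by move=> k m u v x; apply: ff_parallel.
Qed.

Lemma main_AB_dz n (y : Z n.+1) (y' y'' : Z n) :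
    y - dz S n y' \in idl_A (cp n.+1) -> y - dz S n y'' \in idl_B (cp n.+1) ->
  dz S n (y' - y'') \in idl_AB (cp n.+1).
Proof.
move=> hA hB; rewrite raddfB.
have -> : dz S n y' - dz S n y'' = (y - dz S n y'') - (y - dz S n y').
  by rewrite subrACA subrr sub0r opprB.
by apply: rpredB; [exact: B_AB|exact: A_AB].
Qed.

(** This is the Mayer-Vietoris step: if [y' - y'' = a + b] with [a] in [A] and [b] in [B], the
    common value [y' - a = y'' + b] is a primitive modulo both. *)
Lemma glue n (y : Z n.+1) (y' y'' : Z n) :
    y' \in idl_ff (cp n) -> y - dz S n y' \in idl_A (cp n.+1) ->
    y - dz S n y'' \in idl_B (cp n.+1) -> y' - y'' \in idl_AB (cp n) ->
  exists w, [/\ w \in idl_ff (cp n), y - dz S n w \in idl_A (cp n.+1)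
               & y - dz S n w \in idl_B (cp n.+1)].
Proof.
move=> hy' hA hB /asboolP[a [b [ha hb e]]].
have e' : y' - a = y'' + b by apply/eqP; rewrite subr_eq -addrA [b + a]addrC -e addrC subrK.
exists (y' - a); split; first by apply: rpredB => //; exact: A_ff.
  by rewrite raddfB opprB addrA addrAC rpredD //; apply: A_dz.
by rewrite e' raddfD opprD addrA rpredB //; apply: B_dz.
Qed.

(** The primitives modulo [A] and modulo [B] differ by a cocycle of [ff / (A + B)] in degree
    [n + 1], which is positive, so it is a coboundary and can be absorbed. In degree zero this
    difference survives and becomes the class that computes [lim^2]. *)
Lemma main_vanish n (y : Z n.+2) : y \in idl_ff (cp n.+2) ->
    dz S n.+2 y \in idl_main (cp n.+3) ->
  exists w, w \in idl_ff (cp n.+1) /\ y - dz S n.+1 w \in idl_main (cp n.+2).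
Proof.
move=> yff hd.
have [y' [hy' yA]] := A_acyclicS yff (main_A hd).
have [y'' [hy'' yB]] := B_acyclicS yff (main_B hd).
have [m [hm mAB]] := AB_const (rpredB hy' hy'') (main_AB_dz yA yB).
have [||||w [hw wA wB]] := @glue n.+1 y (y' - dz S n m) y''.
- by apply: rpredB => //; apply: ff_dz.
- by rewrite raddfB dz_dz subr0.
- exact: yB.
- by rewrite addrAC.
have [|k [kA kB hk]] := main_const wA wB.
  by rewrite raddfB dz_dz subr0.
exists (w + k); split; first by apply: rpredD => //; apply: A_ff.
by rewrite raddfD opprD addrA.
Qed.
End Vanishing.

(** * The second limit *)

Section Tensors.
Variables (A : Type) (M N : zmodType) (r : M -> A -> M) (l : A -> N -> N).
Local Notation tp := (tpure r l).

Lemma tpureBl m m' n : tp (m - m') n = tp m n - tp m' n.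
Proof. by apply/eqP; rewrite eq_sym subr_eq -tpureDl subrK. Qed.
Lemma tpureBr m n n' : tp m (n - n') = tp m n - tp m n'.
Proof. by apply/eqP; rewrite eq_sym subr_eq -tpureDr subrK. Qed.
Lemma tpure0l n : tp 0 n = 0.
Proof. by rewrite -(subrr 0) tpureBl subrr. Qed.
Lemma tpure0r m : tp m 0 = 0.
Proof. by rewrite -(subrr 0) tpureBr subrr. Qed.

Lemma tensor_ind (P : tensor r l -> Prop) :
    (forall m n, P (tp m n)) -> (forall x y, P x -> P y -> P (x - y)) ->
  forall t, P t.
Proof.
move=> hU hB; apply: qpi_ind; apply: malg_ind => [[m n]|x y hx hy|].
- exact: hU.
- by rewrite raddfB; apply: hB.
- by rewrite raddf0 -(tpure0l 0); apply: hU.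
Qed.
End Tensors.

Lemma tensorZ_lift (M N T : zmodType) (b : M -> N -> T) :
    (forall m m' n, b (m + m') n = b m n + b m' n) ->
    (forall m n n', b m (n + n') = b m n + b m n') ->
  exists Psi : {additive tensorZ M N -> T}, forall m n, Psi (tpure _ _ m n) = b m n.
Proof.
move=> bDl bDr.
have b0l n : b 0 n = 0 by apply: (addrI (b 0 n)); rewrite -bDl !addr0.
have b0r m : b m 0 = 0 by apply: (addrI (b m 0)); rewrite -bDr !addr0.
have bNl m n : b (- m) n = - b m n by apply/eqP; rewrite -addr_eq0 -bDl addNr b0l.
have bNr m n : b m (- n) = - b m n by apply/eqP; rewrite -addr_eq0 -bDr addNr b0r.
have bMl k m n : b (m *+ k) n = b m n *+ k.
  by elim: k => [|k ih]; rewrite ?mulr0n ?b0l // !mulrS bDl ih.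
have bMr k m n : b m (n *+ k) = b m n *+ k.
  by elim: k => [|k ih]; rewrite ?mulr0n ?b0r // !mulrS bDr ih.
have bA m (k : int) n : b (m *~ k) n = b m (n *~ k).
  case: k => k; first by rewrite -!pmulrn bMl bMr.
  by rewrite NegzE !mulrNz bNl bNr -!pmulrn bMl bMr.
by exists (tensor_lift bDl bDr bA) => m n; apply: tensor_liftE.
Qed.

Lemma tensorZ_map_pure (M N M' N' : zmodType) (f : {additive M -> M'})
    (g : {additive N -> N'}) m n :
  tensorZ_map f g (tpure _ _ m n) = tpure _ _ (f m) (g n).
Proof. exact: tensor_liftE. Qed.

(** [s] and [t] are meant to be set-theoretic sections: their additivity defects need only vanish
    after multiplication, modulo [K]. *)
Lemma tensorZ_quot_lift (R : nzRingType) (K : zmodClosed R) (M N : zmodType)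
    (s : M -> R) (t : N -> R) :
    (forall m m' n, (s (m + m') - (s m + s m')) * t n \in K) ->
    (forall m n n', s m * (t (n + n') - (t n + t n')) \in K) ->
  exists Psi : {additive tensorZ M N -> Quotient.quot K},
    forall m n, Psi (tpure _ _ m n) = qpi K (s m * t n).
Proof.
move=> hl hr; apply: tensorZ_lift => [m m' n|m n n'].
  by rewrite -raddfD; apply/qpi_eq; rewrite -mulrDl -mulrBl.
by rewrite -raddfD; apply/qpi_eq; rewrite -mulrDr -mulrBr.
Qed.

Section Abelianized.
Variable G : groupType.

Definition abz : {additive zgring G -> Gab G} := malg_ext (@ab_pi G).
Lemma abzU g : abz (zgU g) = ab_pi g.
Proof. exact: malg_extU. Qed.

Lemma abz_mul x y : abz (x * y) = abz x *~ aug G y + abz y *~ aug G x.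
Proof.
elim/zg_ind: x => [g|x x' hx hx'].
  elim/zg_ind: y => [h|y y' hy hy'].
    by rewrite -zgUM !abzU !aug_zgU !mulr1z ab_piM.
  by rewrite mulrBr (raddfB abz (zgU g * y)) hy hy' (raddfB abz y) augB mulrzBr mulrzBl
    opprD addrACA.
by rewrite mulrBl (raddfB abz (x * y)) hx hx' (raddfB abz x) augB mulrzBr mulrzBl
  opprD addrACA.
Qed.
End Abelianized.

Lemma abz_map (G H : groupType) (f : {multiplicative G -> H}) z :
  abz H (zg_map f z) = ab_map f (abz G z).
Proof.
elim/zg_ind: z => [g|x y hx hy].
  rewrite zg_mapU !abzU; exact: esym (ab_funE f g).
by rewrite zg_mapB (raddfB (abz H)) hx hy -raddfB -(raddfB (abz G)).
Qed.

Lemma mulB1B1 (R : pzRingType) (x y : R) : (x - 1) * (y - 1) = x * y - (x + y - 1).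
Proof. by rewrite mulrBl mul1r mulrBr mulr1 -[LHS]addrA -opprD [x + (y - 1)]addrA. Qed.

Lemma mulB1_diff (R : pzRingType) (a b u : R) : (a - 1) * u - (b - 1) * u = a * u - b * u.
Proof. by rewrite -mulrBl subrACA subrr subr0 mulrBl. Qed.

Lemma comm_B1 (R : pzRingType) (x y : R) :
  (x - 1) * (y - 1) - (y - 1) * (x - 1) = x * y - y * x.
Proof. by rewrite !mulB1B1 subrACA [y + x]addrC subrr subr0. Qed.

Section PresAb.
Variables (G : smallGroup) (c : pres G).
Local Notation ZF := (zgring (pres_src c)).
Local Notation f := (idl_f c).
Local Notation r := (idl_r c).

Definition pab_fun (z : ZF) : Gab G := abz G (zg_map (pres_map c) z).
Fact pab_additive : zmod_morphism pab_fun.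
Proof. by move=> x y; rewrite /pab_fun zg_mapB raddfB. Qed.
HB.instance Definition _ := GRing.isZmodMorphism.Build ZF (Gab G) pab_fun pab_additive.
Definition pab : {additive ZF -> Gab G} := pab_fun.

Lemma pabU w : pab (zgU w) = ab_pi (pres_map c w).
Proof. by rewrite /pab /= /pab_fun zg_mapU abzU. Qed.

Lemma pab_mul x y : pab (x * y) = pab x *~ aug _ y + pab y *~ aug _ x.
Proof. by rewrite /pab /= /pab_fun zg_map_mul abz_mul !aug_zg_map. Qed.

Lemma pab_f_mul a x : a \in f -> pab (a * x) = pab a *~ aug _ x.
Proof. by move=> /mem_ker_aug ha; rewrite pab_mul ha mulr0z addr0. Qed.

Lemma pab_r z : z \in r -> pab z = 0.
Proof. by move=> /mem_ker_zg hz; rewrite /pab /= /pab_fun hz raddf0. Qed.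

Lemma pab_ff z : z \in idl_ff c -> pab z = 0.
Proof.
move: z; apply: idealM_ind => [a b ha hb|x y hx hy|]; last exact: raddf0.
  by rewrite pab_f_mul //; move/mem_ker_aug: hb => ->.
by rewrite raddfB hx hy subrr.
Qed.

Lemma same_image_r w w' : pres_map c w = pres_map c w' -> zgU w - zgU w' \in r.
Proof. by move=> e; apply/mem_ker_zg; rewrite zg_mapB !zg_mapU e subrr. Qed.

Lemma comm_ff u v : zgU [~ u, v]%g - 1 \in idl_ff c.
Proof.
have -> : zgU [~ u, v]%g - 1 = zgU (u^-1 * v^-1)%g *
    ((zgU u - 1) * (zgU v - 1) - (zgU v - 1) * (zgU u - 1)).
  rewrite comm_B1 -(zgUM u v) -(zgUM v u) mulrBr.
  rewrite -(zgUM (u^-1 * v^-1)%g (u * v)%g) -(zgUM (u^-1 * v^-1)%g (v * u)%g).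
  congr (zgU _ - zgU _).
    by rewrite commgEl conjgE !mulgA.
  by rewrite -mulgA mulKg mulVg.
apply: idealM_mull => [x a|]; first exact: f_mull.
have f1 (w : pres_src c) : zgU w - 1 \in f by exact: aug_zgUB.
by apply: rpredB; apply: ffM; exact: f1.
Qed.

(** The elements all of whose lifts [w] have [w - 1] in [D] form a subgroup containing the
    commutators. Quantifying over all lifts is harmless, since two lifts differ by an element of
    [r]. *)
Lemma commutator_D x : x \in commutator_sub G ->
  forall w, pres_map c w = x -> zgU w - 1 \in idl_D c.
Proof.
move=> /asboolP hx.
pose S : {pred G} := fun x => `[< forall w, pres_map c w = x -> zgU w - 1 \in idl_D c >].
suff /asboolP : x \in S by [].
apply: hx; first split.
- apply/asboolP => w hw; apply/r_D; apply: (@same_image_r w 1%g).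
  by rewrite hw mulg_morph1.
- move=> a b /asboolP ha /asboolP hb; apply/asboolP => w hw.
  have [u hu] := pres_surj c b.
  have -> : zgU w - 1 = (zgU (w * u)%g - 1) * zgU u^-1%g - (zgU u - 1) * zgU u^-1%g.
    rewrite mulB1_diff -(zgUM (w * u)%g u^-1%g) -(zgUM u u^-1%g).
    by rewrite mulgK mulgV.
  apply: rpredB; apply: D_mulr; last exact: hb.
  by apply: ha; rewrite gmulfM hw hu mulgVK.
- move=> a b; apply/asboolP => w hw.
  have [u hu] := pres_surj c a; have [v hv] := pres_surj c b.
  have -> : zgU w - 1 = (zgU w - zgU [~ u, v]%g) + (zgU [~ u, v]%g - 1) by rewrite addrA subrK.
  apply: rpredD; last exact/ff_D/comm_ff.
  apply/r_D/same_image_r; rewrite hw -hu -hv.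
  by rewrite !commgEl !conjgE !gmulfM !mulg_morphV.
Qed.

Lemma ab_pi_D w w' : ab_pi (pres_map c w) = ab_pi (pres_map c w') -> zgU w - zgU w' \in idl_D c.
Proof.
move=> /ab_piP h.
have -> : zgU w - zgU w' = (zgU (w / w')%g - 1) * zgU w'.
  by rewrite mulrBl mul1r -(zgUM (w / w')%g w') mulgVK.
apply/D_mulr/(commutator_D h).
by rewrite gmulfM mulg_morphV.
Qed.

Lemma pab_repr (g : Gab G) : exists w, ab_pi (pres_map c w) = g.
Proof.
have [w hw] := pres_surj c (repr g).
by exists w; rewrite hw /ab_pi reprK.
Qed.

(** The inverse of [f / D -> Gab] sends a class to [w - 1] for any lift [w]; it is well defined by
    [ab_pi_D], and additive because the defect is a product of two elements of [f]. *)
Lemma D_pab z : z \in f -> pab z = 0 -> z \in idl_D c.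
Proof.
pose s g := sval (cid (pab_repr g)).
have sE g : ab_pi (pres_map c (s g)) = g by rewrite /s; case: cid.
pose i g : Quotient.quot (idl_D c) := qpi (idl_D c) (zgU (s g) - 1).
have iE w : i (ab_pi (pres_map c w)) = qpi (idl_D c) (zgU w - 1).
  by apply/qpi_eq; rewrite subrACA subrr subr0; apply: ab_pi_D; rewrite sE.
have iB g g' : i (g - g') = i g - i g'.
  rewrite -[g]sE -[g']sE; set w := s g; set w' := s g'.
  have -> : ab_pi (pres_map c w) - ab_pi (pres_map c w') = ab_pi (pres_map c (w / w')%g).
    by rewrite gmulfM mulg_morphV ab_piM; congr (_ + _); rewrite ab_piN.
  rewrite !iE -raddfB.
  have -> : zgU w - 1 - (zgU w' - 1) = zgU w - zgU w' :> ZF by rewrite subrACA subrr subr0.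
  apply/qpi_eq.
  have -> : zgU (w / w')%g - 1 - (zgU w - zgU w') = (zgU w - zgU w') * (zgU w'^-1%g - 1).
    by rewrite mulrBr (mulr1 (zgU w - zgU w')) mulrBl -(zgUM w w'^-1%g) -(zgUM w' w'^-1%g) mulgV.
  by apply/ff_D/ffM; apply: aug_zgUB.
have iZ x : i (pab x) = qpi (idl_D c) (x - (aug _ x)%:~R).
  elim/zg_ind: x => [w|x y hx hy]; first by rewrite pabU iE aug_zgU.
  by rewrite (raddfB pab) iB hx hy -raddfB augB rmorphB subrACA.
move=> /mem_ker_aug zf z0; apply/qpi_eq0.
have := iZ z; rewrite zf subr0 z0 => <-.
by rewrite -(subrr (0 : Gab G)) iB subrr.
Qed.

Lemma pab_surj (g : Gab G) : exists z, z \in f /\ pab z = g.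
Proof.
have [w hw] := pab_repr g; exists (zgU w - 1); split; first exact: aug_zgUB.
have p1 : pab 1 = 0 by apply: etrans (pabU 1%g) _; rewrite mulg_morph1.
by rewrite (raddfB pab) p1 subr0 pabU hw.
Qed.

Definition psec (g : Gab G) : ZF := sval (cid (pab_surj g)).
Lemma psec_f g : psec g \in f.
Proof. by rewrite /psec; case: cid => z []. Qed.
Lemma psecE g : pab (psec g) = g.
Proof. by rewrite /psec; case: cid => z []. Qed.

Lemma psecD g g' : psec (g + g') - (psec g + psec g') \in idl_D c.
Proof.
apply: D_pab; first by apply: rpredB; [exact: psec_f|apply: rpredD; exact: psec_f].
by rewrite (raddfB pab) (raddfD pab) !psecE subrr.
Qed.

Lemma psec_pab a : a \in f -> psec (pab a) - a \in idl_D c.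
Proof.
move=> ha; apply: D_pab; first by apply: rpredB => //; exact: psec_f.
by rewrite (raddfB pab) psecE subrr.
Qed.

Variables (X : Type) (gn : X -> pres_src c) (gnB : free_basis gn).

(** Only the values on [ff] are determined by this property; keeping it as a predicate lets
    different choices of [Phi] be compared there. *)
Definition tens2_spec (Phi : {additive ZF -> tensorZ (Gab G) (Gab G)}) : Prop :=
  forall a b, a \in f -> b \in f -> Phi (a * b) = tpure _ _ (pab a) (pab b).

Lemma tens2_ex : exists Phi, tens2_spec Phi.
Proof.
apply: (@fox_lift _ _ _ gnB _ (fun a b => tpure _ _ (pab a) (pab b)) _ _ (fun a => a \in f)).
- by move=> x x' y; rewrite (raddfB pab) tpureBl.
- by move=> x y y'; rewrite (raddfB pab) tpureBr.
- by move=> a w; apply: f_mulr.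
- move=> a w y ha hy; have hy0 := (mem_ker_aug y).1 hy.
  by rewrite (pab_f_mul _ ha) (pab_mul (zgU w) y) hy0 mulr0z add0r !aug_zgU !mulr1z.
Qed.

Section Spec.
Variables (Phi : {additive ZF -> tensorZ (Gab G) (Gab G)}) (PhiE : tens2_spec Phi).

Lemma tens2_fff z : z \in idl_fff c -> Phi z = 0.
Proof.
move: z; apply: idealM_ind => [a b ha hb|x y hx hy|]; last exact: raddf0.
  by rewrite PhiE //; [rewrite pab_ff // tpure0l|exact: ff_f].
by rewrite raddfB hx hy subrr.
Qed.

Lemma tens2_AB z : z \in idl_AB c -> Phi z = 0.
Proof.
move: z; apply: idl_AB_ind => [||x y hx hy]; last by rewrite raddfD hx hy addr0.
- apply: idl_A_ind => [a b ha hb|x|x y hx hy|]; last exact: raddf0.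
  + by rewrite PhiE //; [rewrite pab_r // tpure0l|exact: r_f].
  + exact: tens2_fff.
  + by rewrite raddfB hx hy subrr.
- apply: idl_B_ind => [a b ha hb|x|x y hx hy|]; last exact: raddf0.
  + by rewrite PhiE //; [rewrite [pab b]pab_r // tpure0r|exact: r_f].
  + exact: tens2_fff.
  + by rewrite raddfB hx hy subrr.
Qed.

(** The inverse multiplies sections of [f -> Gab]: the defect of the left section falls into [D f],
    inside [A], and that of the right one into [f D], inside [B]. *)
Lemma tens2_eq0 z : z \in idl_ff c -> Phi z = 0 -> z \in idl_AB c.
Proof.
have [Psi PsiE] := @tensorZ_quot_lift _ (idl_AB c) _ _ psec psec
  (fun m m' n => A_AB (Df_A (psecD m m') (psec_f n)))
  (fun m n n' => B_AB (fD_B (psec_f m) (psecD n n'))).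
move=> hz z0; apply/qpi_eq0; rewrite -(raddf0 Psi) -z0; apply/esym.
move: z {z0} hz; apply: idealM_ind => [a b ha hb|x y hx hy|]; last by rewrite !raddf0.
  rewrite (PhiE ha hb) PsiE; apply/qpi_eq; rewrite mul2_diff; apply: rpredD.
    by apply/A_AB/Df_A; [exact: psec_pab|exact: psec_f].
  by apply/B_AB/fD_B; [exact: ha|exact: psec_pab].
by rewrite (raddfB Phi) (raddfB Psi) hx hy -raddfB.
Qed.

Lemma tens2_surj t : exists z, z \in idl_ff c /\ Phi z = t.
Proof.
elim/tensor_ind: t => [g g'|t t' [z [hz <-]] [z' [hz' <-]]].
  exists (psec g * psec g'); split; first by apply: ffM; exact: psec_f.
  by rewrite PhiE ?psecE //; exact: psec_f.
by exists (z - z'); split; [exact: rpredB|rewrite raddfB].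
Qed.
End Spec.
End PresAb.

Lemma tens2_nat (G H : smallGroup) (f : {multiplicative G -> H}) (c : pres G) (d : pres H)
    (u : pres_over f c d) Phi Psi :
  @tens2_spec G c Phi -> @tens2_spec H d Psi -> forall z, z \in idl_ff c ->
  Psi (zg_map u z) = tensorZ_map (ab_map f) (ab_map f) (Phi z).
Proof.
move=> PhiE PsiE.
have pabu a : pab d (zg_map u a) = ab_map f (pab c a).
  by rewrite /pab /= /pab_fun over_zg [LHS]abz_map.
apply: idealM_ind => [a b ha hb|x y hx hy|].
- rewrite zg_map_mul PsiE; [|exact: f_zg_map|exact: f_zg_map].
  by rewrite PhiE // tensorZ_map_pure !pabu.
- by rewrite zg_mapB (raddfB Psi) hx hy -raddfB -(raddfB Phi).
- by rewrite zg_map0 !raddf0.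
Qed.

(** * Naturality of the comparison along a functor *)

Section ChainMap.
Variables (C D : category) (Phi : functor D C) (c : copowers C) (d : copowers D).

(** [Phi] need not preserve copowers; maps out of the copowers of [c] are enough, and one map [v0]
    on the first summand determines them all compatibly. *)
Lemma copower_map : exists v : forall n, hom (c n) (Phi (d n)),
  forall n (i : 'I_n.+2), compc (v n.+1) (face c i) = compc (fun_hom Phi (face d i)) (v n).
Proof.
have [v0 _] := cp_init c (Phi (d 0%N)).
pose v n : hom (c n) (Phi (d n)) := copair (fun i => compc (fun_hom Phi (cp_in d i)) v0).
exists v => n i; apply: cp_eq => k.
rewrite -!compcA faceE /v !copairE compcA -fun_comp; congr (compc (fun_hom Phi _) _).
exact/esym/faceE.
Qed.

Variables (v : forall n, hom (c n) (Phi (d n))).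
Hypothesis vf : forall n (i : 'I_n.+2),
  compc (v n.+1) (face c i) = compc (fun_hom Phi (face d i)) (v n).
Variables (F : abfunctor C) (E : abfunctor D) (t : nat_trans (pullback Phi F) E).

Definition cmap n : {additive F (c n) -> E (d n)} := t (d n) \o af_hom F (v n).

Lemma cmapE n x : cmap n x = t (d n) (af_hom F (v n) x).
Proof. by []. Qed.

Lemma cobd_cmap n x : cobd d E n (cmap n x) = cmap n.+1 (cobd c F n x).
Proof.
rewrite !cobdE (raddf_sum (cmap n.+1)); apply: eq_bigr => i _.
rewrite (raddfMz (cmap n.+1)); congr (_ *~ _).
rewrite !cmapE -nt_nat; congr (t _ _).
by rewrite -af_comp vf; apply: esym; apply: (@af_comp _ F).
Qed.
End ChainMap.

Section LimRelMap.
Variables (C D : category) (Phi : functor D C) (c : copowers C) (d : copowers D).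
Variables (v : forall n, hom (c n) (Phi (d n))).
Hypothesis vf : forall n (i : 'I_n.+2),
  compc (v n.+1) (face c i) = compc (fun_hom Phi (face d i)) (v n).
Variables (F : abfunctor C) (E : abfunctor D) (t : nat_trans (pullback Phi F) E).
Variables (I : inj_res F) (J : inj_res E) (m : res_map t I J).

Lemma chain_map p q (xi : I p (c q)) y : chain xi y ->
  chain (R := J) (cmap v (m p) q xi) (cmap v t (chain_idx p q) y).
Proof.
elim: p q xi y => [|p ih] q xi y.
  have e : ir_aug J (d q) (cmap v t q y) = cmap v (m 0%N) q (ir_aug I (c q) y).
    by rewrite !cmapE -(rm_aug m) nt_nat.
  by move=> <-; exact: e.
move=> [u [<- hu]].
have e : ir_d J p (d q) (cmap v (m p) q u) = cmap v (m p.+1) q (ir_d I p (c q) u).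
  by rewrite !cmapE -rm_d nt_nat.
exists (cmap v (m p) q u); split; first exact: e.
by have := ih _ _ _ hu; rewrite -cobd_cmap.
Qed.

Lemma lim_rel_map p (xi : limD I p.+1) y : lim_rel (c := c) xi y ->
  lim_rel (c := d) (limD_map m p.+1 xi) (cmap v t (chain_idx p 1) y).
Proof.
move=> [x [<- hx]].
exists (subz_map (hmap_ker (lim_res_map_d m (n := p.+1))) x); split.
  exact/esym/(quot_funE (hmap_bnd (f := lim_map (ir_d I p)) (f' := lim_map (ir_d J p))
     (lim_res_map_d m (n := p)) (lim_res_map_d m (n := p.+1)))).
have := chain_map hx; congr (chain _ _).
rewrite cmapE; congr (m _ _ _).
by have /asboolP -> := valP (val x).
Qed.
End LimRelMap.

Lemma subr_swap (V : zmodType) (x y k : V) : x - y = k - (y + k - x).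
Proof. by rewrite opprB [RHS]addrCA; congr (x + _); rewrite opprD addrCA subrr addr0. Qed.

Section SecondLimit.
Variables (G : smallGroup) (S : std_copowers G).
Local Notation cp n := (cp_ob (sc_cp S) n : pres G).
Local Notation Z n := (zgring (pres_src (cp n))).

(** Two connecting maps are unrolled here: [z] bounds [y] in [ff], and the primitives [y'], [y''] of
    [y] modulo [A] and modulo [B] differ by the class in [ff / (A + B)]. *)
Definition rel2 (z : Z 2) (t : tensorZ (Gab G) (Gab G)) : Prop :=
  exists y y' y'', [/\ [/\ y \in idl_ff (cp 1%N), y' \in idl_ff (cp 0%N) & y'' \in idl_ff (cp 0%N)],
    dz S 1 y = z, y - dz S 0 y' \in idl_A (cp 1%N), y - dz S 0 y'' \in idl_B (cp 1%N) &
    exists2 Phi, tens2_spec (c := cp 0%N) Phi & Phi (y' - y'') = t].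

Lemma tens2_uniq (c : pres G) Phi Psi : tens2_spec (c := c) Phi -> tens2_spec (c := c) Psi ->
  forall z, z \in idl_ff c -> Phi z = Psi z.
Proof.
move=> hPhi hPsi; apply: idealM_ind => [a b ha hb|x y hx hy|]; last by rewrite !raddf0.
  by rewrite (hPhi _ _ ha hb) (hPsi _ _ ha hb).
by rewrite (raddfB Phi) (raddfB Psi) hx hy.
Qed.

Lemma rel2B z w t s : rel2 z t -> rel2 w s -> rel2 (z - w) (t - s).
Proof.
move=> [y [y' [y'' [[hy hy' hy''] <- hA hB [Phi hPhi <-]]]]].
move=> [x [x' [x'' [[hx hx' hx''] <- kA kB [Psi hPsi <-]]]]].
exists (y - x), (y' - x'), (y'' - x''); split.
- by split; apply: rpredB.
- exact: raddfB.
- by rewrite raddfB subrACA rpredB.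
- by rewrite raddfB subrACA rpredB.
- exists Phi => //; rewrite (tens2_uniq hPsi hPhi); last exact: rpredB.
  by rewrite subrACA; exact: (raddfB Phi).
Qed.

Lemma main_ff (c : pres G) z : z \in idl_main c -> z \in idl_ff c.
Proof. by move=> h; apply/A_ff/main_A. Qed.

Lemma rel2_total (z : Z 2) : z \in idl_main (cp 2) -> dz S 2 z = 0 -> exists t, rel2 z t.
Proof.
move=> hz hd; have zE := dz_cycle hd.
have yff := zkill_ff (main_ff hz).
have hd' : dz S 1 (zkill S 1 z) \in idl_main (cp 2) by rewrite -zE.
have [y' [hy' yA]] := A_acyclicS yff (main_A hd').
have [y'' [hy'' yB]] := B_acyclicS yff (main_B hd').
have [X [g gB]] := sc_basis S 0; have [Phi hPhi] := tens2_ex gB.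
exists (Phi (y' - y'')), (zkill S 1 z), y', y''; split => //.
by exists Phi.
Qed.

Lemma rel2_0 (k : Z 1) t : k \in idl_main (cp 1%N) -> rel2 (dz S 1 k) t -> t = 0.
Proof.
move=> hk [y [y' [y'' [[hy hy' hy''] ed hA hB [Phi hPhi <-]]]]].
have hyk : dz S 1 (y - k) = 0 by rewrite raddfB ed subrr.
(* [e] is a primitive of [y] modulo [I], hence modulo both [A] and [B]; primitives in degree zero
   are unique there by acyclicity, so [y'] and [y''] both agree with [e]. *)
pose e := zkill S 0 (y - k).
have eff : e \in idl_ff (cp 0%N) by apply/zkill_ff/rpredB => //; apply: main_ff.
have eE : y = dz S 0 e + k by rewrite /e -(dz_cycle hyk) subrK.
have eA : y' - e \in idl_A (cp 0%N).
  apply: (A_acyclic0 (rpredB hy' eff)); rewrite raddfB.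
  rewrite (_ : _ - _ = k - (y - dz S 0 y')); last by rewrite [in RHS]eE; exact: subr_swap.
  by apply: rpredB => //; apply: main_A.
have eB : y'' - e \in idl_B (cp 0%N).
  apply: (B_acyclic0 (rpredB hy'' eff)); rewrite raddfB.
  rewrite (_ : _ - _ = k - (y - dz S 0 y'')); last by rewrite [in RHS]eE; exact: subr_swap.
  by apply: rpredB => //; apply: main_B.
apply: (tens2_AB hPhi).
have -> : y' - y'' = (y' - e) - (y'' - e) by rewrite subrACA subrr subr0.
by apply: rpredB; [exact: A_AB|exact: B_AB].
Qed.

Lemma rel2_inj (z : Z 2) : rel2 z 0 -> z \in idl_main (cp 2) ->
  exists k, k \in idl_main (cp 1%N) /\ dz S 1 k = z.
Proof.
move=> [y [y' [y'' [[hy hy' hy''] <- hA hB [Phi hPhi h0]]]]] hz.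
have hAB := tens2_eq0 hPhi (rpredB hy' hy'') h0.
have [w [hw wA wB]] := glue hy' hA hB hAB.
have [|k [kA kB hk]] := main_const wA wB; first by rewrite raddfB dz_dz subr0.
by exists (y - dz S 0 w - dz S 0 k); split => //; rewrite !raddfB !dz_dz !subr0.
Qed.

Lemma rel2_surj t : exists z, [/\ z \in idl_main (cp 2), dz S 2 z = 0 & rel2 z t].
Proof.
have [X [g gB]] := sc_basis S 0; have [Phi hPhi] := tens2_ex gB.
have [m [hm <-]] := tens2_surj hPhi t.
(* The summand [b] is congruent to [dz S 0 m] modulo [A] and to [0] modulo [B], so it has primitives
   [m] and [0]. Its coboundary lies in [A] and in [B], and [k] corrects it into [I]. *)
have /asboolP[a [b [ha hb e]]] : dz S 0 m \in idl_AB (cp 1%N) by rewrite dz0E; apply: ff_parallel.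
have dbA : dz S 1 b \in idl_A (cp 2).
  have -> : dz S 1 b = - dz S 1 a.
    by apply/eqP; rewrite -addr_eq0 addrC -raddfD -e dz_dz.
  by rewrite rpredN; apply: A_dz.
have [|k [kA kB hk]] := main_const dbA (B_dz hb); first by rewrite dz_dz rpred0.
exists (dz S 1 (b - k)); split; [by rewrite raddfB|exact: dz_dz|].
exists (b - k), m, 0; split=> //.
- by split => //; [apply: rpredB; exact: B_ff|exact: rpred0].
- have -> : b - k - dz S 0 m = - (a + k).
    by rewrite e [a + b]addrC opprD addrACA subrr add0r -opprD [k + a]addrC.
  by rewrite rpredN rpredD.
- by rewrite raddf0 subr0 rpredB.
- by exists Phi; rewrite ?subr0.
Qed.
End SecondLimit.

Lemma additive_bij (A B : zmodType) (f : {additive A -> B}) :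
  (forall a, f a = 0 -> a = 0) -> (forall b, exists a, f a = b) -> bijective f.
Proof.
move=> fI fS; pose g b := sval (cid (fS b)).
have gK b : f (g b) = b by rewrite /g; case: cid.
exists g => // a; apply/eqP; rewrite -subr_eq0; apply/eqP/fI.
by rewrite raddfB gK subrr.
Qed.

Lemma chain_idxE p q : chain_idx p q = (p + q)%N.
Proof. by elim: p q => //= p ih q; rewrite ih addnS. Qed.

Section HigherLimits.
Variables (G : smallGroup) (S : std_copowers G).
Local Notation cp n := (cp_ob (sc_cp S) n : pres G).
Local Notation Z n := (zgring (pres_src (cp n))).
Local Notation C n := (subz (idl_main (cp n))).

Lemma cobd_main0 n (y : C n) : cobd S (main_functor G) n y = 0 -> dz S n (val y) = 0.
Proof. by move=> h; rewrite -(dz_main y) h. Qed.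

Lemma cob_mainP n (y : C n.+1) :
  cob (c := S) (F := main_functor G) y <->
  exists k, k \in idl_main (cp n) /\ dz S n k = val y.
Proof.
split=> [[y' <-]|[k [hk e]]].
  by exists (val y'); split; [exact: valP|rewrite -(dz_main y')].
by exists (Sub k hk); apply: val_inj; apply: etrans (dz_main _) _.
Qed.

Lemma main_cob m (y : C m) : (3 <= m)%N ->
  cobd S (main_functor G) m y = 0 -> cob (c := S) (F := main_functor G) y.
Proof.
case: m y => [|[|[|n]]] // y _ /cobd_main0 hd; apply/cob_mainP.
have zE := dz_cycle hd; have yff := zkill_ff (main_ff (valP y)).
have hd' : dz S n.+2 (zkill S n.+2 (val y)) \in idl_main (cp n.+3) by rewrite -zE; exact: valP.
have [w [hw hk]] := main_vanish yff hd'.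
exists (zkill S n.+2 (val y) - dz S n.+1 w); split=> //.
by rewrite raddfB dz_dz subr0 -zE.
Qed.

Variable R : inj_res (main_functor G).

Lemma limD_vanish i (x : limD R i) : (3 <= i)%N -> x = 0.
Proof.
case: i x => [//|p] x hp; have [y hy] := lim_rel_total S x.
apply/(lim_rel0 hy)/main_cob; last exact: lim_rel_cocycle hy.
by rewrite chain_idxE addn1.
Qed.

Definition phi_rel (x : limD R 2) (t : tensorZ (Gab G) (Gab G)) : Prop :=
  exists y : C 2, lim_rel (c := S) (p := 1) x y /\ rel2 (S := S) (val y) t.

Lemma phi_ex : exists phi : {additive limD R 2 -> tensorZ (Gab G) (Gab G)},
  (forall x, phi_rel x (phi x)) /\ forall x t, phi_rel x t -> phi x = t.
Proof.
apply: graph_map => [x x' t t' [y [hy ht]] [y' [hy' ht']]|x|t [y [hy ht]]].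
- by exists (y - y'); split; [exact: lim_relB|rewrite (raddfB val); exact: rel2B].
- have [y hy] := lim_rel_total S (p := 1) x.
  have [t ht] := rel2_total (valP y) (cobd_main0 (lim_rel_cocycle hy)).
  by exists t, y.
- have /cob_mainP[k [hk e]] := (lim_rel0 hy).1 erefl.
  by apply: (rel2_0 hk); rewrite e.
Qed.

Lemma phi_bij phi : (forall x, phi_rel x (phi x)) ->
  (forall x t, phi_rel x t -> phi x = t) ->
  forall f : {additive limD R 2 -> tensorZ (Gab G) (Gab G)}, f =1 phi -> bijective f.
Proof.
move=> hphi uphi f fE; apply: additive_bij => [x|t].
  rewrite fE => x0; have [y [hy ht]] := hphi x; rewrite x0 in ht.
  by apply/(lim_rel0 hy)/cob_mainP/rel2_inj; last exact: valP.
have [z [hz hd ht]] := rel2_surj S t.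
have hd' : cobd S (main_functor G) 2 (Sub z hz : C 2) = 0.
  by apply: val_inj; apply: etrans (dz_main _) _; exact: hd.
have [x hx] := lim_rel_surj R (p := 1) hd'.
by exists x; rewrite fE; apply: uphi; exists (Sub z hz).
Qed.
End HigherLimits.

Definition std (G : smallGroup) : std_copowers G := std_exists G.

Definition phi (G : smallGroup) (R : inj_res (main_functor G)) :
  {additive limD R 2 -> tensorZ (Gab G) (Gab G)} := sval (cid (phi_ex (std G) R)).

Lemma phi_relP G (R : inj_res (main_functor G)) x : phi_rel (std G) x (phi R x).
Proof. by rewrite /phi; case: cid => f []. Qed.
Lemma phi_eq G (R : inj_res (main_functor G)) x t : phi_rel (std G) x t -> phi R x = t.
Proof. by rewrite /phi; case: cid => f [] ? h /h. Qed.
Lemma phi_bijective G (R : inj_res (main_functor G)) : bijective (phi R).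
Proof. exact: (phi_bij (@phi_relP G R) (@phi_eq G R)). Qed.

(** * Naturality of the second limit in the group *)

Section Naturality.
Variables (G H : smallGroup) (f : {multiplicative G -> H}) (L : pres_lift f).
Variables (SG : std_copowers G) (SH : std_copowers H).
Local Notation cg n := (cp_ob (sc_cp SG) n : pres G).
Local Notation ch n := (cp_ob (sc_cp SH) n : pres H).
Variable v : forall n, hom (sc_cp SG n) (L (sc_cp SH n)).
Hypothesis vf : forall n (i : 'I_n.+2),
  compc (v n.+1) (face SG i) = compc (fun_hom L (face SH i)) (v n).

Fact pres_move_over n x :
  pres_map (ch n) ((po_map (pl_over L (ch n)) \o po_map (v n) :
    {multiplicative pres_src (cg n) -> pres_src (ch n)}) x) = f (pres_map (cg n) x).
Proof. by rewrite /= (po_over (pl_over L (ch n))) (po_over (v n)). Qed.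
Definition pres_move n : pres_over f (cg n) (ch n) := PresOver (@pres_move_over n).

Lemma zg_move n z : zg_map (pres_move n) z = zg_map (pl_over L (ch n)) (zg_map (v n) z).
Proof.
elim/zg_ind: z => [g|x y hx hy]; last by rewrite !zg_mapB hx hy.
by rewrite !zg_mapU.
Qed.

Lemma move_face n (i : 'I_n.+2) w :
  pres_move n.+1 (po_map (face SG i) w) = po_map (face SH i) (pres_move n w).
Proof.
have e := congr1 (fun h : pres_over _ _ _ => po_map h w) (vf i).
apply: etrans (congr1 (po_map (pl_over L (ch n.+1))) e) _.
exact: (pl_nat (p := L) (face SH i)).
Qed.

Lemma dz_move n z : zg_map (pres_move n.+1) (dz SG n z) = dz SH n (zg_map (pres_move n) z).
Proof.
have e i : zg_map (pres_move n.+1) (zg_map (face SG i : pres_over idfun (cg n) _) z) =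
    zg_map (face SH i : pres_over idfun (ch n) _) (zg_map (pres_move n) z).
  elim/zg_ind: z => [g|x y hx hy]; last by rewrite !zg_mapB hx hy.
  by rewrite !zg_mapU move_face.
pose pm : {additive zgring (pres_src (cg n.+1)) -> zgring (pres_src (ch n.+1))} :=
  zg_map (pres_move n.+1).
rewrite !dzE -[LHS]/(pm _) (raddf_sum pm); apply: eq_bigr => i _.
apply: etrans (raddfMz pm _ _) _.
by apply: (congr1 (fun a : zgring (pres_src (ch n.+1)) => a *~ sgn i)); exact: e.
Qed.

Lemma rel2_move z t : rel2 (S := SG) z t ->
  rel2 (S := SH) (zg_map (pres_move 2) z) (tensorZ_map (ab_map f) (ab_map f) t).
Proof.
move=> [y [y' [y'' [[hy hy' hy''] <- hA hB [Phi hPhi <-]]]]].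
exists (zg_map (pres_move 1) y), (zg_map (pres_move 0) y'), (zg_map (pres_move 0) y'').
split.
- by split; apply: ff_zg_map.
- by rewrite dz_move.
- by rewrite -dz_move -zg_mapB; apply: A_zg_map.
- by rewrite -dz_move -zg_mapB; apply: B_zg_map.
- have [X [g gB]] := sc_basis SH 0; have [Psi hPsi] := tens2_ex gB.
  exists Psi => //; rewrite -zg_mapB.
  by apply: tens2_nat => //; exact: rpredB.
Qed.

Lemma phi_rel_move (R : inj_res (main_functor G)) (T : inj_res (main_functor H))
    (m : res_map (main_lift L) R T) (x : limD R 2) t :
  phi_rel SG x t -> phi_rel SH (limD_map m 2 x) (tensorZ_map (ab_map f) (ab_map f) t).
Proof.
move=> [y [hy ht]].
exists (cmap v (main_lift L) 2 y); split; first exact: (lim_rel_map vf m hy).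
rewrite (_ : val _ = zg_map (pres_move 2) (val y)); first exact: rel2_move.
by rewrite zg_move.
Qed.
End Naturality.

Lemma phi_natural (G H : smallGroup) (f : {multiplicative G -> H}) (L : pres_lift f)
    (R : inj_res (main_functor G)) (T : inj_res (main_functor H))
    (m : res_map (main_lift L) R T) (x : limD R 2) :
  phi T (limD_map m 2 x) = tensorZ_map (ab_map f) (ab_map f) (phi R x).
Proof.
have [v vf] := copower_map L (std G) (std H).
by apply: phi_eq; apply: (phi_rel_move vf); apply: phi_relP.
Qed.

Lemma malg_torsion_free (K : choiceType) (v : {malg int[K]}) (n : int) :
  v *~ n = 0 -> n != 0 -> v = 0.
Proof.
move=> e n0; apply/malgP => k; have := congr1 (fun u : {malg int[K]} => u@_k) e.
rewrite /= mcoeff0 raddfMz => /eqP; rewrite -mulrzr mulf_eq0 intz (negbTE n0) orbF.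
by move/eqP.
Qed.

Lemma abs_reduce (n m : int) : m != 0 -> (absz m <= absz n)%N ->
  exists k : int, (absz (n - m * k)%R < absz n)%N.
Proof.
move=> m0 h; have [s|s] := boolP ((0 <= n) == (0 <= m)); [exists 1|exists (-1)]; lia.
Qed.

Lemma derivation_defect (V : zmodType) (l l' p a b o : V) :
  l + l' - (p - o) = (l - (a - o)) + (l' - (b - o)) - (p - (a + b - o)).
Proof.
have -> : (l - (a - o)) + (l' - (b - o)) = l + l' - ((a + b - o) - o).
  by rewrite addrACA -opprD addrACA -opprD -[X in _ = _ - X]addrA -opprD.
by rewrite -[RHS]addrA -opprD; congr (_ - _); rewrite [RHS]addrC addrA subrK.
Qed.

Lemma addrA_cancel (V : zmodType) (x y z : V) : x + y + (z - y) = z + x.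
Proof. by rewrite addrACA subrr addr0 addrC. Qed.

Lemma euclid_mul (R : pzRingType) (a b a' b' w : R) (e : int) :
  a * b + (a' * b' + w) = a' * (b' + b *~ e) + ((a - a' *~ e) * b + w).
Proof.
by rewrite !addrA; congr (_ + _); rewrite mulrDr mulrBl mulrzAl mulrzAr addrA_cancel.
Qed.

Lemma euclid_scale (V : zmodType) (b b' w : V) (a a' e : int) :
  b *~ a + (b' *~ a' + w) = (b' + b *~ e) *~ a' + (b *~ (a - a' * e) + w).
Proof.
rewrite !addrA; congr (_ + _).
by rewrite mulrzBr mulrzDl -!mulrzA [e * _]mulrC addrA_cancel.
Qed.

(** * The triple tensor product *)

Section FreePres.
Variables (G : smallGroup) (c : pres G).
Variables (X : choiceType) (gn : X -> pres_src c) (gnB : free_basis gn).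
Local Notation ZF := (zgring (pres_src c)).
Local Notation F := (pres_src c).
Local Notation f := (idl_f c).
Local Notation r := (idl_r c).
Local Notation V := {malg int[X]}.

Lemma lam_ex : exists lam : {additive ZF -> V},
  (forall x, lam (zgU (gn x)) = mkmalgU x 1) /\
  (forall y z, lam (y * z) = lam y *~ aug F z + lam z *~ aug F y).
Proof.
have [||D [Dg DM]] := @crossed_hom F X gn gnB V (fun _ => idfun) _ _ (fun x => mkmalgU x 1).
- by [].
- by [].
pose lam : {additive ZF -> V} := malg_ext D.
have lU w : lam (zgU w) = D w by exact: malg_extU.
exists lam; split=> [x|y z]; first by rewrite lU Dg.
elim/zg_ind: y => [u|y y' hy hy'].
  elim/zg_ind: z => [v|z z' hz hz'].
    by rewrite -(zgUM u v) !lU !aug_zgU !mulr1z DM.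
  by rewrite mulrBr (raddfB lam (zgU u * z)) hz hz' (raddfB lam z) augB mulrzBr mulrzBl
    opprD addrACA.
by rewrite mulrBl (raddfB lam (y * z)) hy hy' (raddfB lam y) augB mulrzBr mulrzBl
  opprD addrACA.
Qed.

(** These are the coordinates of [f / ff] in the basis given by the classes of [gn x - 1], extended
    to the group ring as a derivation along the augmentation. *)
Definition lam : {additive ZF -> V} := sval (cid lam_ex).
Lemma lamU x : lam (zgU (gn x)) = mkmalgU x 1.
Proof. by rewrite /lam; case: cid => l []. Qed.
Lemma lamM y z : lam (y * z) = lam y *~ aug F z + lam z *~ aug F y.
Proof. by rewrite /lam; case: cid => l []. Qed.

Lemma lam_fM a z : a \in f -> lam (a * z) = lam a *~ aug F z.
Proof. by move=> /mem_ker_aug h; rewrite lamM h mulr0z addr0. Qed.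
Lemma lam_Mf z b : b \in f -> lam (z * b) = lam b *~ aug F z.
Proof. by move=> /mem_ker_aug h; rewrite lamM h mulr0z add0r. Qed.

Lemma lam_ff z : z \in idl_ff c -> lam z = 0.
Proof.
move: z; apply: idealM_ind => [a b ha hb|x y hx hy|]; last exact: raddf0.
  by rewrite (lam_fM _ ha) (mem_ker_aug _).1.
by rewrite raddfB hx hy subrr.
Qed.

Lemma lam1 : lam 1 = 0.
Proof.
have a1 : aug F 1 = 1 by exact: aug_zgU.
by apply: (addrI (lam 1)); rewrite addr0 -{3}[1 : ZF]mulr1 lamM a1 !mulr1z.
Qed.

Definition lsec : {additive V -> ZF} := malg_ext (fun x => zgU (gn x) - 1).
Lemma lsecU x : lsec (mkmalgU x 1) = zgU (gn x) - 1.
Proof. exact: malg_extU. Qed.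

Lemma lsec_f v : lsec v \in f.
Proof.
elim/malg_ind: v => [x|x y hx hy|]; first by rewrite lsecU; exact: aug_zgUB.
  by rewrite raddfB rpredB.
by rewrite raddf0 rpred0.
Qed.

Lemma lsecK : cancel lsec lam.
Proof.
elim/malg_ind => [x|x y hx hy|]; last by rewrite !raddf0.
  by rewrite lsecU (raddfB lam) lamU lam1 subr0.
by rewrite (raddfB lsec) (raddfB lam) hx hy.
Qed.

Lemma lsec_lam z : z \in f -> lsec (lam z) - z \in idl_ff c.
Proof.
have f1 (w : F) : zgU w - 1 \in f by exact: aug_zgUB.
(* [E] measures the failure of [lsec] to invert [lam] on [w - 1]. By [EM] it is additive modulo
   [ff], and it vanishes on generators. *)
pose E (w : F) := lsec (lam (zgU w)) - (zgU w - 1).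
have EM u v : E (u * v)%g = E u + E v - (zgU u - 1) * (zgU v - 1).
  rewrite /E zgUM lamM !aug_zgU !mulr1z (raddfD lsec) mulB1B1.
  exact: derivation_defect.
have hM u v : (zgU u - 1) * (zgU v - 1) \in idl_ff c by apply: ffM; exact: f1.
have E1 : E 1%g = 0 by rewrite /E [lam _]lam1 raddf0 subrr subr0.
have hU w : E w \in idl_ff c.
  elim/(fb_ind gnB): w => [|x|u hu|u v hu hv].
  - by rewrite E1 rpred0.
  - by rewrite /E lamU lsecU subrr rpred0.
  - have := EM u u^-1%g; rewrite mulgV E1 => /esym/eqP.
    rewrite subr_eq0 => /eqP e.
    have -> : E u^-1%g = E u + E u^-1%g - E u by rewrite addrAC subrr add0r.
    by rewrite e; apply: rpredB => //; exact: hM.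
  - by rewrite EM; apply: rpredB; [exact: rpredD|exact: hM].
suff h : lsec (lam z) - (z - (aug F z)%:~R) \in idl_ff c.
  by move=> /mem_ker_aug zf; move: h; rewrite zf subr0.
elim/zg_ind: z => [w|x y hx hy]; first by rewrite aug_zgU; exact: hU.
have -> : lsec (lam (x - y)) - (x - y - (aug F (x - y))%:~R) =
    (lsec (lam x) - (x - (aug F x)%:~R)) - (lsec (lam y) - (y - (aug F y)%:~R)).
  by rewrite [RHS]subrACA (raddfB lam) (raddfB lsec) augB rmorphB [x - y - _]subrACA.
exact: rpredB.
Qed.

Lemma lam_eq0_ff z : z \in f -> lam z = 0 -> z \in idl_ff c.
Proof.
by move=> hf h0; have := lsec_lam hf; rewrite h0 raddf0 sub0r rpredN.
Qed.

(** The map [f / ff -> Gab] read in coordinates; its kernel [D / ff] is the other term of the free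
    resolution of [Gab]. *)
Definition rho : {additive V -> Gab G} := pab c \o lsec.

Lemma rho_lam z : z \in f -> rho (lam z) = pab c z.
Proof.
move=> hf; have := pab_ff (lsec_lam hf); rewrite (raddfB (pab c)) => /eqP.
by rewrite subr_eq0 => /eqP.
Qed.

Section RRff.
(* Euclid's algorithm on the coefficients at [x] of the left factors. *)
Variable K : zmodClosed ZF.
Hypothesis Kl : forall a b, a \in idl_ff c -> b \in r -> a * b \in K.
Hypothesis Kr : forall a b, a \in r -> b \in idl_ff c -> a * b \in K.

Let rr_seq (l : seq (ZF * ZF)) := forall p, p \in l -> p.1 \in r /\ p.2 \in r.
Let bal (l : seq (ZF * ZF)) := forall x, \sum_(p <- l) lam p.2 *~ (lam p.1)@_x = 0.

(** The image of [r] in the free abelian group [f / ff] is torsion-free, hence flat, so a tensor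
    over this image that vanishes in the tensor square of [f / ff] already vanishes. [bal] is this
    vanishing, read on the coordinates of the left factors, and [K] contains the products that
    become zero in the tensor square of the image. *)
Lemma rr_balanced (l : seq (ZF * ZF)) : rr_seq l -> bal l -> \sum_(p <- l) p.1 * p.2 \in K.
Proof.
have [n] := ubnP (size l); elim: n l => // n ihn l; rewrite ltnS => ln hr hb.
have [/allP h0|/allPn[p0 p0l n0]] := boolP (all (fun p => lam p.1 == 0) l).
  rewrite big_seq; apply: rpred_sum => p pl; have [h1 h2] := hr _ pl.
  by apply: Kl => //; apply: lam_eq0_ff; [exact: r_f|apply/eqP/h0].
have [x nx] : exists x, (lam p0.1)@_x != 0.
  apply: contrapT => hx; case/eqP: n0; apply/malgP => x; rewrite mcoeff0.
  by apply/eqP/negPn/negP => nx; apply: hx; exists x.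
have perm_rr l1 l2 : perm_eq l1 l2 -> rr_seq l1 -> rr_seq l2.
  by move=> h12 h p; rewrite -(perm_mem h12); apply: h.
have perm_bal l1 l2 : perm_eq l1 l2 -> bal l1 -> bal l2.
  by move=> h12 h y; rewrite -(perm_big _ h12); apply: h.
pose co (p : ZF * ZF) : int := (lam p.1)@_x.
(* The outer induction is on the length of the list; the inner one is on the sum of the absolute
   values of the coefficients at [x], with a nonzero coefficient kept at the head. *)
suff main k p l' : (\sum_(q <- p :: l') absz (co q) < k)%N -> (size (p :: l') <= n)%N ->
    co p != 0 -> rr_seq (p :: l') -> bal (p :: l') ->
    \sum_(q <- p :: l') q.1 * q.2 \in K.
  have hp := perm_to_rem p0l; rewrite (perm_big _ hp) /=.
  apply: (main (\sum_(q <- p0 :: rem p0 l) absz (co q)).+1) => //.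
  - by rewrite -(perm_size hp).
  - exact: perm_rr hp hr.
  - exact: perm_bal hp hb.
elim: k p l' => // k ihk p l'; rewrite ltnS => hk hs np hpr hpb.
have [/allP h0|/allPn[q ql' nq]] := boolP (all (fun q => co q == 0) l').
  have p2 : lam p.2 = 0.
    apply: (malg_torsion_free _ np); have := hpb x; rewrite big_cons big_seq.
    by rewrite big1 ?addr0 // => q /h0 /eqP; rewrite /co => ->; rewrite mulr0z.
  have [hp1 hp2] := hpr p (mem_head _ _).
  rewrite big_cons; apply: rpredD.
    by apply: Kr => //; apply: lam_eq0_ff p2; exact: r_f.
  apply: ihn; [exact: hs|by move=> q ql; apply: hpr; rewrite inE ql orbT|].
  by move=> y; have := hpb y; rewrite big_cons p2 mul0rz add0r.
have hp : perm_eq (p :: l') (p :: q :: rem q l') by rewrite perm_cons perm_to_rem.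
rewrite (perm_big _ hp); move: hk hs (perm_rr _ _ hp hpr) (perm_bal _ _ hp hpb).
rewrite (perm_big _ hp) (perm_size hp) /=.
move: (rem q l') => l'' {hp ql' hpr hpb l' ihn}.
have step (s t : ZF * ZF) : co t != 0 -> (absz (co t) <= absz (co s))%N ->
    (\sum_(q <- s :: t :: l'') absz (co q) <= k)%N -> ((size l'').+2 <= n)%N ->
    rr_seq (s :: t :: l'') -> bal (s :: t :: l'') ->
    \sum_(q <- s :: t :: l'') q.1 * q.2 \in K.
  move=> nt le_ts hk hs hpr hpb; have [e he] := abs_reduce nt le_ts.
  (* Subtracting [e] times the left factor of [t] from that of [s] is compensated by adding [e]
     times the right factor of [s] to that of [t]; the sum of products and the balance are
     unchanged. *)
  pose s' := (s.1 - t.1 *~ e, s.2); pose t' := (t.1, t.2 + s.2 *~ e).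
  have coM (u : V) y : (u *~ e)@_y = u@_y * e by rewrite raddfMz /= mulrzz.
  have cos : co s' = co s - co t * e.
    by rewrite /co /= (raddfB lam) (raddfMz lam) mcoeffB coM.
  have -> : \sum_(q <- s :: t :: l'') q.1 * q.2 = \sum_(q <- t' :: s' :: l'') q.1 * q.2.
    by rewrite 4!big_cons; apply: euclid_mul.
  apply: ihk => //.
  - by move: hk he; rewrite !big_cons cos /co /=; lia.
  - have [hp1 hp2] := hpr s (mem_head _ _).
    have [hq1 hq2] : t.1 \in r /\ t.2 \in r by apply: hpr; rewrite !inE eqxx orbT.
    move=> u; rewrite !inE => /or3P[/eqP->|/eqP->|ul] /=.
    + by split; [exact: hq1|exact: (rpredD hq2 (rpredMz e hp2))].
    + by split; [exact: (rpredB hp1 (rpredMz e hq1))|exact: hp2].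
    + by apply: hpr; rewrite !inE ul !orbT.
  - move=> y; apply: etrans _ (hpb y); rewrite 4!big_cons; apply: esym.
    rewrite (raddfD lam) (raddfB lam) !(raddfMz lam) mcoeffB coM.
    exact: euclid_scale.
move=> hk hs hpr hpb; case: (leqP (absz (co q)) (absz (co p))) => [le|/ltnW le].
  exact: step.
have hp : perm_eq (p :: q :: l'') (q :: p :: l'').
  by rewrite -(cat1s p) -(cat1s q l'') perm_catCA.
rewrite (perm_big _ hp); apply: step => //.
- by rewrite -(perm_big _ hp).
- exact: perm_rr hp hpr.
- exact: perm_bal hp hpb.
Qed.
End RRff.
End FreePres.

Section TripleProducts.
Variables (R : nzRingType) (K : zmodClosed R).
Implicit Types a b g : R.

Lemma qpi_mul3Dl s a a' b g : (s - (a + a')) * b * g \in K ->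
  qpi K (s * b * g) = qpi K (a * b * g) + qpi K (a' * b * g).
Proof. by move=> h; rewrite -raddfD; apply/qpi_eq; rewrite -!mulrDl -!mulrBl. Qed.
Lemma qpi_mul3Dm s a b b' g : a * (s - (b + b')) * g \in K ->
  qpi K (a * s * g) = qpi K (a * b * g) + qpi K (a * b' * g).
Proof. by move=> h; rewrite -raddfD; apply/qpi_eq; rewrite -mulrDl -mulrBl -mulrDr -mulrBr. Qed.
Lemma qpi_mul3Dr s a b g g' : a * b * (s - (g + g')) \in K ->
  qpi K (a * b * s) = qpi K (a * b * g) + qpi K (a * b * g').
Proof. by move=> h; rewrite -raddfD; apply/qpi_eq; rewrite -mulrDr -mulrBr. Qed.

Lemma qpi_mul3_bal12 s t a b x g : (s - a * x) * b * g \in K -> a * (x * b - t) * g \in K ->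
  qpi K (s * b * g) = qpi K (a * t * g).
Proof.
move=> h1 h2; apply/qpi_eq; rewrite -mulrBl.
have -> : s * b - a * t = (s - a * x) * b + a * (x * b - t).
  by rewrite mulrBl mulrBr -!mulrA addrA subrK.
by rewrite mulrDl rpredD.
Qed.

Lemma qpi_mul3_bal23 s t a b x g : a * (s - b * x) * g \in K -> a * b * (x * g - t) \in K ->
  qpi K (a * s * g) = qpi K (a * b * t).
Proof.
move=> h1 h2; apply/qpi_eq.
have -> : a * s * g - a * b * t = a * (s - b * x) * g + a * b * (x * g - t).
  by rewrite mulrBr mulrBl mulrBr -!mulrA addrA subrK.
exact: rpredD.
Qed.

Lemma qpi_mul3 a a' b b' g g' :
  (a - a') * b * g \in K -> a' * (b - b') * g \in K -> a' * b' * (g - g') \in K ->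
  qpi K (a * b * g) = qpi K (a' * b' * g').
Proof. by move=> h1 h2 h3; apply/qpi_eq; rewrite mul3_diff !rpredD. Qed.
End TripleProducts.

Section TripleTensor.
Variables (G : smallGroup) (c : pres G).
Variables (X : choiceType) (gn : X -> pres_src c) (gnB : free_basis gn).
Local Notation ZF := (zgring (pres_src c)).
Local Notation F := (pres_src c).
Local Notation f := (idl_f c).
Local Notation r := (idl_r c).
Local Notation p := (zg_map (pres_map c)).
Local Notation tp2 := (tpure (@augI_ract G) (@augI_lact G)).
Local Notation tp3 := (tpure (@augI2_ract G) (@augI_lact G)).

Fact gz_subproof (z : ZF) : p z - (aug F z)%:~R \in ker (aug G).
Proof.
apply/mem_ker_aug; rewrite augB aug_zg_map.
have -> : aug G (aug F z)%:~R = aug F z.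
  by apply: etrans (rmorph_int (aug G) _) _; rewrite intz.
exact: subrr.
Qed.

(** Subtracting the augmentation extends the map from [f] to the augmentation ideal of [Z[G]]
    additively to the whole ring, the domain of the pairings in [fox_lift]. *)
Definition gz_fun (z : ZF) : augI G := Sub (p z - (aug F z)%:~R) (gz_subproof z).
Fact gz_additive : zmod_morphism gz_fun.
Proof.
move=> x y; apply: val_inj; rewrite (raddfB val) !SubK zg_mapB augB rmorphB.
exact: subrACA.
Qed.
HB.instance Definition _ := GRing.isZmodMorphism.Build ZF (augI G) gz_fun gz_additive.
Definition gz : {additive ZF -> augI G} := gz_fun.

Lemma val_gz z : z \in f -> val (gz z) = p z.
Proof. by move=> /mem_ker_aug h; rewrite [LHS]SubK h subr0. Qed.

Lemma gz_mulr a w : a \in f -> gz (a * w) = augI_ract (gz a) (p w).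
Proof.
move=> ha; apply: val_inj; rewrite (val_gz (f_mulr w ha)) zg_map_mul.
by apply: (congr1 (fun x => x * p w)); rewrite val_gz.
Qed.

Lemma gz_mull w b : b \in f -> gz (w * b) = augI_lact (p w) (gz b).
Proof.
move=> hb; apply: val_inj; rewrite (val_gz (f_mull w hb)) zg_map_mul.
by apply: (congr1 (fun x => p w * x)); rewrite val_gz.
Qed.

Lemma gz_r a : a \in r -> gz a = 0.
Proof.
move=> ha; apply: val_inj; rewrite (val_gz (r_f ha)).
by move/mem_ker_zg: ha.
Qed.

Lemma p_surj x : exists z, p z = x.
Proof.
elim/zg_ind: x => [g|x y [z <-] [w <-]]; last by exists (z - w); rewrite zg_mapB.
by have [w hw] := pres_surj c g; exists (zgU w); rewrite zg_mapU hw.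
Qed.

Definition psc (x : zgring G) : ZF := sval (cid (p_surj x)).
Lemma pscE x : p (psc x) = x.
Proof. by rewrite /psc; case: cid. Qed.

Definition gsec (x : augI G) : ZF := psc (val x).
Lemma gsec_f x : gsec x \in f.
Proof.
apply/mem_ker_aug; rewrite -(aug_zg_map (pres_map c)) pscE.
exact/mem_ker_aug/valP.
Qed.
Lemma gsecE x : gz (gsec x) = x.
Proof. by apply: val_inj; rewrite (val_gz (gsec_f x)) pscE. Qed.

Lemma gsec_r x z : p z = val x -> gsec x - z \in r.
Proof. by move=> h; apply: r_diff; rewrite h pscE. Qed.

Lemma p_gsec x : p (gsec x) = val x. Proof. exact: pscE. Qed.

Lemma gsecD x y : gsec (x + y) - (gsec x + gsec y) \in r.
Proof.
apply: gsec_r; apply: etrans (raddfD p _ _) _.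
exact: (congr2 +%R (p_gsec x) (p_gsec y)).
Qed.

Lemma g2_ex : exists Phi : {additive ZF -> augI2 G},
  forall a b, a \in f -> b \in f -> Phi (a * b) = tp2 (gz a) (gz b).
Proof.
apply: (@fox_lift _ _ _ gnB _ (fun a b => tp2 (gz a) (gz b)) _ _ (fun a => a \in f)).
- by move=> x x' y; rewrite (raddfB gz) tpureBl.
- by move=> x y y'; rewrite (raddfB gz) tpureBr.
- by move=> a w; apply: f_mulr.
- by move=> a w y ha hy; rewrite (gz_mulr _ ha) (gz_mull _ hy) tpureA.
Qed.

Definition Phi2 : {additive ZF -> augI2 G} := sval (cid g2_ex).
Lemma Phi2E a b : a \in f -> b \in f -> Phi2 (a * b) = tp2 (gz a) (gz b).
Proof. by rewrite /Phi2; case: cid => Q h; apply: h. Qed.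

Lemma augI2_ractE (x y : augI G) a : augI2_ract (tp2 x y) a = tp2 x (augI_ract y a).
Proof. exact: tensor_liftE. Qed.

Lemma augI2_ractB (x y : augI2 G) a : augI2_ract (x - y) a = augI2_ract x a - augI2_ract y a.
Proof. exact: raddfB. Qed.

Lemma Phi2_mulr z w : z \in idl_ff c -> Phi2 (z * w) = augI2_ract (Phi2 z) (p w).
Proof.
move: z; apply: idealM_ind => [a b ha hb|x y hx hy|].
- by rewrite -mulrA (Phi2E ha (f_mulr w hb)) (Phi2E ha hb) augI2_ractE gz_mulr.
- by rewrite mulrBl (raddfB Phi2 (x * w)) hx hy (raddfB Phi2 x) augI2_ractB.
- by rewrite mul0r (raddf0 Phi2); apply/esym/(raddf0 (augI2_ract_map _)).
Qed.

Lemma ff_mulr a w : a \in idl_ff c -> a * w \in idl_ff c.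
Proof. by apply: idealM_mulr => x y; apply: f_mulr. Qed.

(** Here the set [U] of [fox_lift] is [ff], where [Phi2] is right linear over [Z[F]] and the pairing
    is therefore balanced. *)
Lemma g3_ex : exists Phi : {additive ZF -> augI3 G},
  forall a b, a \in idl_ff c -> b \in f -> Phi (a * b) = tp3 (Phi2 a) (gz b).
Proof.
apply: (@fox_lift _ _ _ gnB _ (fun a b => tp3 (Phi2 a) (gz b)) _ _ (fun a => a \in idl_ff c)).
- by move=> x x' y; rewrite (raddfB Phi2) tpureBl.
- by move=> x y y'; rewrite (raddfB gz) tpureBr.
- by move=> a w; apply: ff_mulr.
- by move=> a w y ha hy; rewrite (Phi2_mulr _ ha) (gz_mull _ hy) tpureA.
Qed.

Definition Phi3 : {additive ZF -> augI3 G} := sval (cid g3_ex).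
Lemma Phi3E z b : z \in idl_ff c -> b \in f -> Phi3 (z * b) = tp3 (Phi2 z) (gz b).
Proof. by rewrite /Phi3; case: cid => Q h; apply: h. Qed.

Lemma Phi3_abr a b d : a \in f -> b \in f -> d \in r -> Phi3 (a * b * d) = 0.
Proof. by move=> ha hb hd; rewrite (Phi3E (ffM ha hb) (r_f hd)) (gz_r hd) tpure0r. Qed.
Lemma Phi3_arb a b d : a \in f -> b \in r -> d \in f -> Phi3 (a * b * d) = 0.
Proof.
move=> ha hb hd; rewrite (Phi3E (ffM ha (r_f hb)) hd) (Phi2E ha (r_f hb)) (gz_r hb).
by rewrite tpure0r tpure0l.
Qed.
Lemma Phi3_rab a b d : a \in r -> b \in f -> d \in f -> Phi3 (a * b * d) = 0.
Proof.
move=> ha hb hd; rewrite (Phi3E (ffM (r_f ha) hb) hd) (Phi2E (r_f ha) hb) (gz_r ha).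
by rewrite !tpure0l.
Qed.

Lemma Phi3_ff_r a b : a \in idl_ff c -> b \in r -> Phi3 (a * b) = 0.
Proof. by move=> ha hb; rewrite (Phi3E ha (r_f hb)) (gz_r hb) tpure0r. Qed.
Lemma Phi3_r_ff a b : a \in r -> b \in idl_ff c -> Phi3 (a * b) = 0.
Proof.
move=> ha; move: b; apply: idealM_ind => [x y hx hy|x y hx hy|].
- by rewrite mulrA Phi3_rab.
- by rewrite mulrBr (raddfB Phi3) hx hy subrr.
- by rewrite mulr0 raddf0.
Qed.

(** This is the component at [x], in the left factor, of the map from [ff] to the tensor square of
    [f / ff]. It kills [fff], which yields the balance hypothesis of [rr_balanced]. *)
Lemma coef_ex (x : X) : exists Phi : {additive ZF -> {malg int[X]}},
  forall a b, a \in f -> b \in f -> Phi (a * b) = lam gnB b *~ (lam gnB a)@_x.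
Proof.
apply: (@fox_lift _ _ _ gnB _ (fun a b => lam gnB b *~ (lam gnB a)@_x) _ _ (fun a => a \in f)).
- by move=> y y' z; rewrite (raddfB (lam gnB)) mcoeffB mulrzBr.
- by move=> y z z'; rewrite (raddfB (lam gnB)) mulrzBl.
- by move=> a w; apply: f_mulr.
- by move=> a w y ha hy; rewrite (lam_fM gnB _ ha) (lam_Mf gnB _ hy) aug_zgU !mulr1z.
Qed.

Lemma rr_fff_Phi3 (l : seq (ZF * ZF)) :
    (forall q, q \in l -> q.1 \in r /\ q.2 \in r) ->
  \sum_(q <- l) q.1 * q.2 \in idl_fff c -> Phi3 (\sum_(q <- l) q.1 * q.2) = 0.
Proof.
move=> hl hs; suff : \sum_(q <- l) q.1 * q.2 \in ker Phi3 by move/mem_ker.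
apply: (@rr_balanced _ _ _ _ gnB (ker Phi3)) => //.
- by move=> a b ha hb; apply/mem_ker/Phi3_ff_r.
- by move=> a b ha hb; apply/mem_ker/Phi3_r_ff.
move=> x; have [Phi PhiE] := coef_ex x.
have Phi0 z : z \in idl_fff c -> Phi z = 0.
  move: z; apply: idealM_ind => [a b ha hb|u v hu hv|]; last exact: raddf0.
    by rewrite (PhiE _ _ (ff_f ha) hb) (lam_ff gnB ha) mcoeff0 mulr0z.
  by rewrite (raddfB Phi) hu hv subrr.
apply: etrans _ (Phi0 _ hs); rewrite (raddf_sum Phi) !big_seq; apply: eq_bigr => q /hl[h1 h2].
by rewrite (PhiE _ _ (r_f h1) (r_f h2)).
Qed.

(** The summands [ffr], [frf] and [rff] lie in [fff] and are killed by [Phi3] at sight. The rest of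
    [z] is a list of products from [rr], whose sum then lies in [fff] as well, so that [rr_fff_Phi3]
    applies. *)
Lemma main_fff_Phi3 z : z \in idl_main c -> z \in idl_fff c -> Phi3 z = 0.
Proof.
move=> hm hf; suff [l [hl h1 h2]] : exists l : seq (ZF * ZF),
    [/\ forall q, q \in l -> q.1 \in r /\ q.2 \in r,
        z - \sum_(q <- l) q.1 * q.2 \in idl_fff c & Phi3 (z - \sum_(q <- l) q.1 * q.2) = 0].
  have := h2; rewrite (raddfB Phi3) rr_fff_Phi3 ?subr0 //.
  exact: rpred_subr hf h1.
have triv x : x \in idl_fff c -> Phi3 x = 0 -> exists l : seq (ZF * ZF),
    [/\ forall q, q \in l -> q.1 \in r /\ q.2 \in r,
        x - \sum_(q <- l) q.1 * q.2 \in idl_fff c & Phi3 (x - \sum_(q <- l) q.1 * q.2) = 0].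
  by move=> hx h0; exists [::]; rewrite big_nil subr0; split.
move: z hm {hf}; apply: idl_main_ind.
- move=> a b d ha hb hd; apply: triv; first exact: fffM ha hb (r_f hd).
  exact: Phi3_abr.
- move=> a b d ha hb hd; apply: triv; first exact: fffM ha (r_f hb) hd.
  exact: Phi3_arb.
- move=> a b d ha hb hd; apply: triv; first exact: fffM (r_f ha) hb hd.
  exact: Phi3_rab.
- move=> a b ha hb; exists [:: (a, b)]; rewrite big_seq1 subrr; split.
  + by move=> q; rewrite inE => /eqP ->.
  + exact: rpred0.
  + exact: raddf0.
- move=> x y [l [hl h1 h2]] [k [hk k1 k2]].
  have e : x - y - \sum_(q <- l ++ [seq (- q.1, q.2) | q <- k]) q.1 * q.2 =
      (x - \sum_(q <- l) q.1 * q.2) - (y - \sum_(q <- k) q.1 * q.2).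
    rewrite [RHS]subrACA; congr (_ - _); rewrite big_cat big_map -sumrN; congr (_ + _).
    by apply: eq_bigr => q _; rewrite mulNr.
  exists (l ++ [seq (- q.1, q.2) | q <- k]); rewrite e; split.
  + move=> q; rewrite mem_cat => /orP[/hl //|/mapP[s /hk[s1 s2] ->]].
    by split; [rewrite rpredN; exact: s1|exact: s2].
  + exact: rpredB.
  + by rewrite (raddfB Phi3) h2 k2 subrr.
- by apply: triv; [exact: rpred0|exact: raddf0].
Qed.

(** The inverse of [Phi3] multiplies three lifts along [gsec]; changing one lift by an element of
    [r] moves the product inside [rff], [frf] or [ffr]. *)
Lemma Phi3_main z : z \in idl_fff c -> Phi3 z = 0 -> z \in idl_main c.
Proof.
pose K := idl_main c; pose Q : zmodType := Quotient.quot K.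
(* [g] is the last of the three factors. It is fixed first, so that the inner tensor square is
   lifted before the outer product. *)
pose b2 (g a b : augI G) : Q := qpi K (gsec a * gsec b * gsec g).
have b2Dl g a a' b : b2 g (a + a') b = b2 g a b + b2 g a' b.
  apply: qpi_mul3Dl.
  by apply: main_rff; [exact: gsecD|exact: gsec_f|exact: gsec_f].
have b2Dr g a b b' : b2 g a (b + b') = b2 g a b + b2 g a b'.
  apply: qpi_mul3Dm.
  by apply: main_frf; [exact: gsec_f|exact: gsecD|exact: gsec_f].
have b2Dg g g' a b : b2 (g + g') a b = b2 g a b + b2 g' a b.
  apply: qpi_mul3Dr.
  by apply: main_ffr; [exact: gsec_f|exact: gsec_f|exact: gsecD].
have sr a x : gsec (augI_ract a x) - gsec a * psc x \in r.
  by apply: gsec_r; rewrite zg_map_mul p_gsec pscE.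
have sl a x : psc x * gsec a - gsec (augI_lact x a) \in r.
  by rewrite -opprB rpredN; apply: gsec_r; rewrite zg_map_mul p_gsec pscE.
have b2A g a x b : b2 g (augI_ract a x) b = b2 g a (augI_lact x b).
  apply: (qpi_mul3_bal12 (x := psc x)).
    by apply: main_rff; [exact: sr|exact: gsec_f|exact: gsec_f].
  by apply: main_frf; [exact: gsec_f|exact: sl|exact: gsec_f].
pose Psi2 g : {additive augI2 G -> Q} := tensor_lift (b2Dl g) (b2Dr g) (b2A g).
have Psi2E g a b : Psi2 g (tp2 a b) = b2 g a b by exact: tensor_liftE.
pose b3 t g := Psi2 g t.
have b3Dl t t' g : b3 (t + t') g = b3 t g + b3 t' g by exact: raddfD.
have b3Dr t g g' : b3 t (g + g') = b3 t g + b3 t g'.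
  rewrite /b3; elim/tensor_ind: t => [a b|t t' ht ht']; first by rewrite !Psi2E.
  by rewrite !(raddfB (Psi2 _)) ht ht' opprD addrACA.
have b3A t x g : b3 (augI2_ract t x) g = b3 t (augI_lact x g).
  rewrite /b3; elim/tensor_ind: t => [a b|t t' ht ht'].
    rewrite augI2_ractE !Psi2E; apply: (qpi_mul3_bal23 (x := psc x)).
      by apply: main_frf; [exact: gsec_f|exact: sr|exact: gsec_f].
    by apply: main_ffr; [exact: gsec_f|exact: gsec_f|exact: sl].
  by rewrite augI2_ractB !(raddfB (Psi2 _)) ht ht'.
pose Psi3 : {additive augI3 G -> Q} := tensor_lift b3Dl b3Dr b3A.
have Psi3E t g : Psi3 (tp3 t g) = Psi2 g t by exact: tensor_liftE.
move=> hz z0; apply/qpi_eq0; rewrite -(raddf0 Psi3) -z0; apply/esym.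
have gsr a : a \in f -> gsec (gz a) - a \in r by move=> ha; apply: gsec_r; rewrite val_gz.
move: z {z0} hz; apply: idl_fff_ind => [a b d ha hb hd|x y hx hy|]; last by rewrite !raddf0.
  rewrite (Phi3E (ffM ha hb) hd) (Phi2E ha hb) Psi3E Psi2E; apply: qpi_mul3.
  - by apply: main_rff; [exact: gsr|exact: gsec_f|exact: gsec_f].
  - by apply: main_frf; [exact: ha|exact: gsr|exact: gsec_f].
  - by apply: main_ffr; [exact: ha|exact: hb|exact: gsr].
by rewrite (raddfB Phi3) (raddfB Psi3) hx hy -raddfB.
Qed.

Lemma Phi3_surj t : exists z, z \in idl_fff c /\ Phi3 z = t.
Proof.
have surj2 s : exists z, z \in idl_ff c /\ Phi2 z = s.
  elim/tensor_ind: s => [a b|s s' [z [hz <-]] [z' [hz' <-]]].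
    exists (gsec a * gsec b); split; first by apply: ffM; exact: gsec_f.
    by rewrite (Phi2E (gsec_f a) (gsec_f b)) !gsecE.
  by exists (z - z'); split; [exact: rpredB|rewrite raddfB].
elim/tensor_ind: t => [s a|s s' [z [hz <-]] [z' [hz' <-]]].
  have [z [hz <-]] := surj2 s; exists (z * gsec a).
  split; first by apply: mem_idealM => //; exact: gsec_f.
  by rewrite (Phi3E hz (gsec_f a)) gsecE.
by exists (z - z'); split; [exact: rpredB|rewrite raddfB].
Qed.
End TripleTensor.

Lemma corestrict (A B : zmodType) (f : {additive A -> B}) (I : zmodClosed B) :
  (forall a, f a \in I) -> exists f' : {additive A -> subz I}, forall a, val (f' a) = f a.
Proof.
move=> h; pose g a : subz I := Sub (f a) (h a).
have gB : zmod_morphism g by move=> x y; apply: val_inj; rewrite (raddfB val) !SubK raddfB.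
by exists (HB.pack_for {additive A -> subz I} g (GRing.isZmodMorphism.Build A (subz I) g gB)).
Qed.

Local Notation "x ⊗ y" := (tpure _ _ x y : tensorZ _ _) (at level 40).

Section TensorZ.
Implicit Types M N : zmodType.

Fact tpr_additive M N (m : M) : zmod_morphism (fun n : N => m ⊗ n).
Proof. by move=> x y; apply: tpureBr. Qed.

Lemma tpure_sumr M N (I : Type) (s : seq I) (m : M) (g : I -> N) :
  m ⊗ (\sum_(i <- s) g i) = \sum_(i <- s) m ⊗ g i.
Proof.
pose t : {additive N -> tensorZ M N} := HB.pack_for {additive N -> tensorZ M N}
  (fun n : N => m ⊗ n) (GRing.isZmodMorphism.Build _ _ _ (tpr_additive m)).
exact: (raddf_sum t).
Qed.

Lemma tens_map_surj M N N' (g : {additive N -> N'}) : (forall y, exists x, g x = y) ->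
  forall t : tensorZ M N', exists s : tensorZ M N,
    tensorZ_map (idfun : {additive M -> M}) g s = t.
Proof.
move=> gS; apply: tensor_ind => [m n|_ _ [s <-] [s' <-]]; last by exists (s - s'); rewrite raddfB.
by have [x <-] := gS n; exists (m ⊗ x); rewrite tensorZ_map_pure.
Qed.

Lemma malg_ext_id (K : choiceType) (v : {malg int[K]}) :
  malg_ext (fun x => mkmalgU x 1 : {malg int[K]}) v = v.
Proof.
elim/malg_ind: v => [x|x y hx hy|]; [exact: malg_extU| |exact: raddf0].
by rewrite (raddfB (malg_ext _)) hx hy.
Qed.

Section FreeFactor.
Variable X : choiceType.
Local Notation V := {malg int[X]}.
Local Notation idX := (idfun : {additive V -> V}).

Lemma tcoef_ex M (x : X) : exists k : {additive tensorZ M V -> M},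
  forall m v, k (m ⊗ v) = m *~ v@_x.
Proof.
apply: tensorZ_lift => [m m' v|m v v']; first by rewrite mulrzDl.
by rewrite mcoeffD mulrzDr.
Qed.

Definition tcoef M x : {additive tensorZ M V -> M} := sval (cid (tcoef_ex M x)).
Lemma tcoefE M x (m : M) v : tcoef M x (m ⊗ v) = m *~ v@_x.
Proof. by rewrite /tcoef; case: cid. Qed.

(** Allowing every larger finite set lets two tensors be expanded over a common support. *)
Lemma tcoef_sum M (t : tensorZ M V) : exists s : {fset X}, forall s' : {fset X},
  (s `<=` s')%fset -> t = \sum_(x <- s') tcoef M x t ⊗ mkmalgU x 1.
Proof.
elim/tensor_ind: t => [m v|t t' [s hs] [s' hs']].
  exists (msupp v) => s' hs'.
  have vE : v = \sum_(x <- s') mkmalgU x 1 *~ v@_x.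
    by rewrite -[LHS]malg_ext_id; apply: (malg_ext_funEw (fun x => mkmalgU x 1 : V) hs').
  rewrite {1}vE tpure_sumr; apply: eq_bigr => x _.
  by rewrite tcoefE -tpureA.
exists (s `|` s')%fset => s'' h.
have e := hs s'' (fsubset_trans (fsubsetUl _ _) h).
have e' := hs' s'' (fsubset_trans (fsubsetUr _ _) h).
apply: etrans (congr2 (fun a b : tensorZ M V => a - b) e e') _.
rewrite -sumrB; apply: eq_bigr => x _.
by rewrite (raddfB (tcoef M x)) tpureBl.
Qed.

Lemma tcoef_nat M N (h : {additive M -> N}) x t :
  tcoef N x (tensorZ_map h idX t) = h (tcoef M x t).
Proof.
elim/tensor_ind: t => [m v|t t' ht ht'].
  by rewrite tensorZ_map_pure !tcoefE raddfMz.
by rewrite !raddfB ht ht'.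
Qed.

(** Preimages are taken coordinate by coordinate in the basis of the free factor, and only finitely
    many are needed. *)
Lemma tens_free_exact M1 M2 M0 (g : {additive M2 -> M1}) (h : {additive M1 -> M0}) :
  (forall m, h m = 0 -> exists y, g y = m) ->
  forall t, tensorZ_map h idX t = 0 -> exists t', tensorZ_map g idX t' = t.
Proof.
move=> ex t t0; have [s hs] := tcoef_sum t.
have hx x : exists y, g y = tcoef M1 x t.
  by apply: ex; rewrite -tcoef_nat t0 raddf0.
exists (\sum_(x <- s) sval (cid (hx x)) ⊗ mkmalgU x 1).
rewrite (raddf_sum (tensorZ_map g idX)) [RHS](hs s) //; apply: eq_bigr => x _.
by rewrite tensorZ_map_pure; case: cid => y /= ->.
Qed.
End FreeFactor.
End TensorZ.

(** * The torsion product *)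

Section TorComparison.
Variables (G : smallGroup) (c : pres G).
Variables (X : choiceType) (gn : X -> pres_src c) (gnB : free_basis gn).
Local Notation ZF := (zgring (pres_src c)).
Local Notation f := (idl_f c).
Local Notation r := (idl_r c).
Local Notation V := {malg int[X]}.
Local Notation lam := (lam gnB).
Local Notation lsec := (lsec gn).
Local Notation rho := (rho gn).
Variable P : proj_res (Gab G).
Local Notation aug := (pr_aug P).
Local Notation d0 := (pr_d P 0%N).
Local Notation d1 := (pr_d P 1%N).
Local Notation idV := (idfun : {additive V -> V}).
Local Notation idG := (idfun : {additive Gab G -> Gab G}).

Lemma rho_surj g : exists v, rho v = g.
Proof. by have [z [hz <-]] := pab_surj c g; exists (lam z); rewrite (rho_lam gnB). Qed.

Lemma q0_ex : exists q : {additive V -> P 0%N}, forall v, aug (q v) = rho v.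
Proof.
have h x : exists y : P 0%N, aug y = rho (mkmalgU x 1) by exact: pr_aug_surj.
exists (malg_ext (fun x => sval (cid (h x)))) => v.
elim/malg_ind: v => [x|x y hx hy|]; last by rewrite !raddf0.
  by rewrite (malg_extU (fun x => sval (cid (h x)))); case: cid.
by rewrite (raddfB (malg_ext _)) (raddfB aug) hx hy (raddfB rho).
Qed.
Definition q0 : {additive V -> P 0%N} := sval (cid q0_ex).
Lemma q0E v : aug (q0 v) = rho v.
Proof. by rewrite /q0; case: cid. Qed.

Lemma j0_ex : exists j : {additive P 0%N -> V}, forall y, rho (j y) = aug y.
Proof. exact: (@pr_proj _ P 0%N _ _ rho aug rho_surj). Qed.
Definition j0 : {additive P 0%N -> V} := sval (cid j0_ex).
Lemma j0E y : rho (j0 y) = aug y.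
Proof. by rewrite /j0; case: cid. Qed.

Lemma aug_d0 y : aug (d0 y) = 0.
Proof. by apply/pr_exact0; exists y. Qed.
Lemma d0_d1 y : d0 (d1 y) = 0.
Proof. by apply/pr_exact; exists y. Qed.

(** Both [q0 \o j0] and the identity lie over [Gab], so their difference maps into the image of
    [d0]; projectivity of the degree-zero term lifts it. *)
Lemma homotopy_ex : exists k : {additive P 0%N -> P 1%N}, forall y, d0 (k y) = q0 (j0 y) - y.
Proof.
have h1 y : d0 y \in ker aug by apply/mem_ker/aug_d0.
have [d0' d0E] := corestrict h1.
have h2 y : ((q0 \o j0) \- idfun : {additive P 0%N -> P 0%N}) y \in ker aug.
  by apply/mem_ker; rewrite /= (raddfB aug) q0E j0E subrr.
have [g gE] := corestrict h2.
have d0S y : exists x, d0' x = y.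
  have /mem_ker/pr_exact0[x hx] := valP y.
  by exists x; apply: val_inj; rewrite d0E.
have [k kE] := @pr_proj _ P 0%N _ _ d0' g d0S.
by exists k => y; rewrite -d0E kE gE.
Qed.
Definition kap : {additive P 0%N -> P 1%N} := sval (cid homotopy_ex).
Lemma d0_kap y : d0 (kap y) = q0 (j0 y) - y.
Proof. by rewrite /kap; case: cid. Qed.

Lemma tq_ex : exists Phi : {additive ZF -> tensorZ (P 0%N) V},
  forall a b, a \in f -> b \in f -> Phi (a * b) = q0 (lam a) ⊗ lam b.
Proof.
apply: (@fox_lift _ _ _ gnB _ (fun a b => q0 (lam a) ⊗ lam b) _ _ (fun a => a \in f)).
- by move=> x x' y; rewrite (raddfB lam) (raddfB q0) tpureBl.
- by move=> x y y'; rewrite (raddfB lam) tpureBr.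
- by move=> a w; apply: f_mulr.
- by move=> a w y ha hy; rewrite (lam_fM gnB _ ha) (lam_Mf gnB _ hy) aug_zgU !mulr1z.
Qed.
Definition tq : {additive ZF -> tensorZ (P 0%N) V} := sval (cid tq_ex).
Lemma tqE a b : a \in f -> b \in f -> tq (a * b) = q0 (lam a) ⊗ lam b.
Proof. by rewrite /tq; case: cid => Q h; apply: h. Qed.

Lemma tq_fff z : z \in idl_fff c -> tq z = 0.
Proof.
move: z; apply: idealM_ind => [a b ha hb|x y hx hy|]; last exact: raddf0.
  by rewrite (tqE (ff_f ha) hb) (lam_ff gnB ha) raddf0 tpure0l.
by rewrite (raddfB tq) hx hy subrr.
Qed.

Definition rg M : {additive tensorZ M V -> tensorZ M (Gab G)} :=
  tensorZ_map (idfun : {additive M -> M}) rho.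
Lemma rgE (M : zmodType) (m : M) v : rg M (m ⊗ v) = m ⊗ rho v.
Proof. exact: tensorZ_map_pure. Qed.

Lemma rg_nat (M N : zmodType) (h : {additive M -> N}) t :
  rg N (tensorZ_map h idV t) = tensorZ_map h idG (rg M t).
Proof.
elim/tensor_ind: t => [m v|t t' ht ht']; last by rewrite !raddfB ht ht'.
by rewrite tensorZ_map_pure !rgE tensorZ_map_pure.
Qed.

Lemma rg_surj (M : zmodType) t : exists s, rg M s = t.
Proof. exact: tens_map_surj rho_surj t. Qed.

Lemma q0_r a : a \in r -> exists y, d0 y = q0 (lam a).
Proof.
move=> ha; apply/pr_exact0.
by rewrite q0E (rho_lam gnB (r_f ha)) (pab_r ha).
Qed.

Lemma rho_lam_r b : b \in r -> rho (lam b) = 0.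
Proof. by move=> hb; rewrite (rho_lam gnB (r_f hb)) (pab_r hb). Qed.

(** This is the snake construction: membership of [z] in [A] lifts [tq z] along [d0] to [t], and
    membership in [B] makes the image of [t] over [Gab] a cycle, whose class is [tau]. *)
Definition theta_rel (z : ZF) (tau : Tor P (Gab G)) : Prop :=
  exists t (x : subz (ker (tensorZ_map d0 idG))),
    [/\ tensorZ_map d0 idV t = tq z, val x = rg _ t
       & qpi (bnd (tensorZ_map d1 idG) (tensorZ_map d0 idG)) x = tau].

Lemma theta_relB z w s t : theta_rel z s -> theta_rel w t -> theta_rel (z - w) (s - t).
Proof.
move=> [u [x [h1 h2 <-]]] [u' [x' [h1' h2' <-]]]; exists (u - u'), (x - x'); split.
- by rewrite (raddfB (tensorZ_map d0 idV)) h1 h1' (raddfB tq).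
- apply: etrans (raddfB val x x') _; rewrite (raddfB (rg _)).
  exact: (congr2 (fun a b => a - b) h2 h2').
- exact: raddfB.
Qed.

Lemma theta_total z : z \in idl_A c -> z \in idl_B c -> exists tau, theta_rel z tau.
Proof.
move=> hA hB.
have [t ht] : exists t, tensorZ_map d0 idV t = tq z.
  move: z hA {hB}; apply: idl_A_ind => [a b ha hb|x hx|x y [s hs] [t ht]|].
  - have [y hy] := q0_r ha; exists (y ⊗ lam b).
    by rewrite tensorZ_map_pure hy (tqE (r_f ha) hb).
  - by exists 0; rewrite raddf0 tq_fff.
  - by exists (s - t); rewrite raddfB hs ht (raddfB tq).
  - by exists 0; rewrite !raddf0.
have rB w : w \in idl_B c -> rg _ (tq w) = 0.
  move: w; apply: idl_B_ind => [a b ha hb|x hx|x y hx hy|]; last by rewrite !raddf0.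
  - by rewrite (tqE ha (r_f hb)) rgE rho_lam_r // tpure0r.
  - by rewrite tq_fff // raddf0.
  - by rewrite (raddfB tq) (raddfB (rg _)) hx hy subrr.
have hx : rg _ t \in ker (tensorZ_map d0 idG) by apply/mem_ker; rewrite -rg_nat ht rB.
pose x : subz (ker (tensorZ_map d0 idG)) := Sub (rg _ t) hx.
by exists (qpi (bnd (tensorZ_map d1 idG) (tensorZ_map d0 idG)) x), t, x.
Qed.

Lemma theta_N z tau : z \in idl_N c -> theta_rel z tau -> tau = 0.
Proof.
move=> hz [t [x [ht hx <-]]]; apply/qpi_eq0/asboolP.
(* For [z] in [fff + rr] there is a lift [t'] that dies over [Gab]. The difference [t - t'] comes
   from the next term of the resolution tensored with a free group, so the class of [t] is a
   boundary. *)
have [t' [ht' rt']] : exists t', tensorZ_map d0 idV t' = tq z /\ rg _ t' = 0.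
  move: z hz {ht}; apply: (@idealD_ind _ _ _ (fun z => exists t', tensorZ_map d0 idV t' = tq z /\ rg _ t' = 0))
    => [z hz|z|z w [s [hs rs]] [s' [hs' rs']]].
  - by exists 0; rewrite !raddf0 tq_fff.
  - move: z; apply: (@idealM_ind _ _ _ (fun z => exists t', tensorZ_map d0 idV t' = tq z /\ rg _ t' = 0)) => [a b ha hb|u v [s [hs rs]] [s' [hs' rs']]|].
    + have [y hy] := q0_r ha; exists (y ⊗ lam b).
      by rewrite tensorZ_map_pure hy (tqE (r_f ha) (r_f hb)) rgE rho_lam_r // tpure0r.
    + exists (s - s'); rewrite (raddfB (tensorZ_map d0 idV)) hs hs' (raddfB tq).
      by rewrite (raddfB (rg _)) rs rs' subrr.
    + by exists 0; rewrite !raddf0.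
  - exists (s + s'); rewrite (raddfD (tensorZ_map d0 idV)) hs hs' (raddfD tq).
    by rewrite (raddfD (rg _)) rs rs' addr0.
have [||w hw] := @tens_free_exact X _ _ _ d1 d0 _ (t - t').
- by move=> m /pr_exact.
- by rewrite (raddfB (tensorZ_map d0 idV)) ht ht' subrr.
exists (rg _ w); rewrite -rg_nat hw (raddfB (rg _)) rt' subr0.
exact: esym hx.
Qed.

Lemma lsec_D v : rho v = 0 -> lsec v \in idl_D c.
Proof. by move=> h; apply: D_pab; [exact: lsec_f|exact: h]. Qed.

Lemma psec_lsec v : psec c (rho v) - lsec v \in idl_D c.
Proof. by apply: psec_pab; exact: lsec_f. Qed.

Lemma psecDD (s : ZF) g g' (K : zmodClosed ZF) :
  (forall x, x \in idl_D c -> s * x \in K) ->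
  s * (psec c (g + g') - (psec c g + psec c g')) \in K.
Proof. by apply; exact: psecD. Qed.

Lemma jj_ex : exists j : {additive tensorZ (P 0%N) V -> ZF},
  forall y v, j (y ⊗ v) = lsec (j0 y) * lsec v.
Proof.
apply: tensorZ_lift => [m m' v|m v v'].
  by rewrite (raddfD j0) (raddfD lsec) mulrDl.
by rewrite (raddfD lsec) mulrDr.
Qed.
(** A map back from the resolution to the ideals, inverse to [tq] up to [N] on [B]; it turns
    boundaries into elements of [A], and tensors that vanish over [Gab] into elements of [B]. *)
Definition jj : {additive tensorZ (P 0%N) V -> ZF} := sval (cid jj_ex).
Lemma jjE y v : jj (y ⊗ v) = lsec (j0 y) * lsec v.
Proof. by rewrite /jj; case: cid. Qed.

Lemma d0_D y : lsec (j0 (d0 y)) \in idl_D c.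
Proof. by apply: lsec_D; rewrite j0E aug_d0. Qed.

Lemma jj_A t : jj (tensorZ_map d0 idV t) \in idl_A c.
Proof.
elim/tensor_ind: t => [m v|s t hs ht].
  by rewrite tensorZ_map_pure jjE; apply: Df_A; [exact: d0_D|exact: lsec_f].
by rewrite (raddfB (tensorZ_map d0 idV)) (raddfB jj) rpredB.
Qed.

Lemma jj_B s : rg _ s = 0 -> jj s \in idl_B c.
Proof.
have h0 m m' n : (lsec (j0 (m + m')) - (lsec (j0 m) + lsec (j0 m'))) * psec c n \in idl_B c.
  by rewrite (raddfD j0) (raddfD lsec) subrr mul0r rpred0.
have [J JE] := @tensorZ_quot_lift _ (idl_B c) (P 0%N) (Gab G) (fun y => lsec (j0 y)) (psec c)
  h0
  (fun m n n' => psecDD n n' (fun x => fD_B (lsec_f gn (j0 m)))).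
move=> s0; apply/qpi_eq0; rewrite -(raddf0 J) -s0.
elim/tensor_ind: s {s0} => [m v|s t hs ht].
  rewrite jjE rgE JE; apply/qpi_eq; rewrite -mulrBr -opprB mulrN rpredN.
  by apply: fD_B; [exact: lsec_f|exact: psec_lsec].
by rewrite (raddfB jj) (raddfB (qpi _)) hs ht (raddfB (rg _)) (raddfB J).
Qed.

(** On a product from [f r] the left factor changes by an element of [D] and the right one by an
    element of [ff]; the errors lie in [D D] and in [f ff], both inside [N]. *)
Lemma jj_tq z : z \in idl_B c -> jj (tq z) - z \in idl_N c.
Proof.
move: z; apply: idl_B_ind => [a b ha hb|x hx|x y hx hy|].
- rewrite (tqE ha (r_f hb)) jjE mul2_diff; apply: rpredD.
    apply: DD_N; last by apply: lsec_D; exact: rho_lam_r.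
    apply: D_pab; first by apply: rpredB => //; exact: lsec_f.
    rewrite (raddfB (pab c)) -(rho_lam gnB ha).
    by rewrite [pab c _](j0E (q0 (lam a))) q0E subrr.
  by apply/fff_N/f_ff_fff; [exact: ha|exact: lsec_lam (r_f hb)].
- by rewrite tq_fff // raddf0 sub0r rpredN fff_N.
- by rewrite (raddfB tq) (raddfB jj) subrACA rpredB.
- by rewrite (raddf0 tq) (raddf0 jj) subrr rpred0.
Qed.

(** The map [J] kills boundaries and, on the image of a lift of [tq z], equals [jj (tq z)] modulo
    [N]. A trivial class therefore puts [jj (tq z)] in [N], and [jj_tq] transfers this to [z]. *)
Lemma theta_inj z : z \in idl_A c -> z \in idl_B c -> theta_rel z 0 -> z \in idl_N c.
Proof.
move=> hA hB [t [x [ht hx /qpi_eq0/asboolP[w hw]]]].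
have h0 m m' n : (lsec (j0 (d0 (m + m'))) - (lsec (j0 (d0 m)) + lsec (j0 (d0 m')))) * psec c n
    \in idl_N c.
  by rewrite (raddfD d0) (raddfD j0) (raddfD lsec) subrr mul0r rpred0.
have [J JE] := @tensorZ_quot_lift _ (idl_N c) (P 1%N) (Gab G) (fun y => lsec (j0 (d0 y))) (psec c)
  h0
  (fun m n n' => psecDD n n' (fun x => DD_N (d0_D m))).
have J1 s : J (tensorZ_map d1 idG s) = 0.
  elim/tensor_ind: s => [m n|s s' hs hs'].
    by rewrite tensorZ_map_pure JE d0_d1 !raddf0 mul0r raddf0.
  by rewrite (raddfB (tensorZ_map d1 idG)) (raddfB J) hs hs' subrr.
have J2 s : J (rg _ s) = qpi (idl_N c) (jj (tensorZ_map d0 idV s)).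
  elim/tensor_ind: s => [m v|s s' hs hs'].
    rewrite rgE JE tensorZ_map_pure jjE; apply/qpi_eq; rewrite -mulrBr.
    by apply: DD_N; [exact: d0_D|exact: psec_lsec].
  by rewrite (raddfB (rg _)) (raddfB J) hs hs' (raddfB (tensorZ_map d0 idV)) (raddfB jj)
    (raddfB (qpi _)).
have /qpi_eq0 h : qpi (idl_N c) (jj (tq z)) = 0 by rewrite -ht -J2 -hx -hw J1.
exact: rpred_subr h (jj_tq hB).
Qed.

Lemma theta_surj tau : exists z, [/\ z \in idl_A c, z \in idl_B c & theta_rel z tau].
Proof.
elim/qpi_ind: tau => x; have /mem_ker x0 := valP x.
have [t ht] := rg_surj (val x).
pose s := tensorZ_map d0 idV t.
have rs : rg _ s = 0 by rewrite /s rg_nat ht.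
exists (jj s); split; [exact: jj_A|exact: jj_B|].
(* [tq (jj s)] exceeds [s] by the image under [d0] of the homotopy applied to [s], so the lift [t]
   is corrected by that term; the correction vanishes over [Gab], as [s] does. *)
exists (t + tensorZ_map kap idV s), x; split=> //.
- have jjs u : tq (jj u) = u + tensorZ_map d0 idV (tensorZ_map kap idV u).
    elim/tensor_ind: u => [m v|u u' hu hu'].
      rewrite jjE (tqE (lsec_f gn (j0 m)) (lsec_f gn v)) !(lsecK gnB) !tensorZ_map_pure d0_kap.
      by rewrite tpureBl addrC subrK.
    rewrite (raddfB jj) (raddfB tq) hu hu' (raddfB (tensorZ_map kap idV)).
    by rewrite (raddfB (tensorZ_map d0 idV)) opprD addrACA.
  by rewrite (raddfD (tensorZ_map d0 idV)) jjs.
- by rewrite (raddfD (rg _)) rg_nat rs raddf0 addr0 ht.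
Qed.
End TorComparison.

Lemma N_main_fff (G : smallGroup) (c : pres G) z : z \in idl_N c ->
  exists k, k \in idl_main c /\ z - k \in idl_fff c.
Proof.
move=> /asboolP[a [k [ha hk ->]]]; exists k; split; last by rewrite addrK.
by move: k {a ha} hk; apply: rr_sub => a b; apply: main_rr.
Qed.

(** * The first limit and its short exact sequence *)

Section FirstLimit.
Variables (G : smallGroup) (S : std_copowers G) (R : inj_res (main_functor G)).
Local Notation c := (cp_ob (sc_cp S) 0%N : pres G).
Local Notation c1 := (cp_ob (sc_cp S) 1%N : pres G).
Local Notation Z := (zgring (pres_src c)).

(** This is the connecting isomorphism read backwards: a degree-one cocycle of [I] is the coboundary
    of a unique [y] in [ff], which the acyclicity of [ff / A] and [ff / B] forces into both [A] and
    [B]. *)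
Definition rel1 (x : limD R 1) (y : Z) : Prop :=
  y \in idl_ff c /\ exists2 z : subz (idl_main c1),
    lim_rel (c := S) (p := 0) x z & val z = dz S 0 y.

Lemma rel1B x x' y y' : rel1 x y -> rel1 x' y' -> rel1 (x - x') (y - y').
Proof.
move=> [hy [z hz e]] [hy' [z' hz' e']]; split; first exact: (rpredB hy hy').
exists (z - z'); first exact: lim_relB.
apply: etrans (raddfB val _ _) _; apply: etrans (esym (raddfB (dz S 0) _ _)).
exact: (congr2 (fun a b : zgring (pres_src c1) => a - b) e e').
Qed.

Lemma rel1_total x : exists y, rel1 x y.
Proof.
have [z hz] := lim_rel_total S (p := 0) x.
have e := dz_cycle (cobd_main0 (lim_rel_cocycle hz)).
exists (zkill S 0 (val z)); split; first exact: (zkill_ff (main_ff (valP z))).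
by exists z.
Qed.

Lemma rel1_A x y : rel1 x y -> y \in idl_A c.
Proof.
move=> [hy [z _ e]]; apply: (A_acyclic0 hy); rewrite -e.
exact: (main_A (valP z)).
Qed.

Lemma rel1_B x y : rel1 x y -> y \in idl_B c.
Proof.
move=> [hy [z _ e]]; apply: (B_acyclic0 hy); rewrite -e.
exact: (main_B (valP z)).
Qed.

Lemma rel1_surj y : y \in idl_A c -> y \in idl_B c -> exists x, rel1 x y.
Proof.
move=> hA hB; have [X [g gB]] := sc_basis S 0.
have hd : dz S 0 y \in idl_main c1 by rewrite dz0E; exact: (AB_parallel _ _ gB hA hB).
have h0 : cobd S (main_functor G) 1 (Sub (dz S 0 y) hd : subz (idl_main c1)) = 0.
  by apply: val_inj; apply: etrans (dz_main _) _; exact: dz_dz.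
have [x hx] := lim_rel_surj R (p := 0) h0.
exists x; split; first exact: (A_ff hA).
by exists (Sub (dz S 0 y) hd : subz (idl_main c1)).
Qed.

Lemma rel1_eq0 x y : rel1 x y -> x = 0 <-> y \in idl_main c.
Proof.
move=> [hy [z hz e]]; split.
  move=> /(lim_rel0 hz)/cob_mainP[k [hk ek]].
  suff -> : y = k by [].
  apply/eqP; rewrite -subr_eq0; apply/eqP/(@dz_inj0 _ S).
    exact: (rpredB (ff_f hy) (ff_f (main_ff hk))).
  by rewrite (raddfB (dz S 0)) ek e subrr.
by move=> hk; apply/(lim_rel0 hz)/cob_mainP; exists y.
Qed.

Lemma limD1_short_exact (P : proj_res (Gab G)) :
  exists (a : {additive augI3 G -> limD R 1}) (b : {additive limD R 1 -> Tor P (Gab G)}),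
    short_exact a b.
Proof.
have [X [g gB]] := sc_basis S 0.
pose ra (t : augI3 G) (x : limD R 1) :=
  exists y, [/\ y \in idl_fff c, rel1 x y & Phi3 gB y = t].
pose rb (x : limD R 1) (s : Tor P (Gab G)) := exists2 y, rel1 x y & theta_rel gB y s.
have [a [ha ua]] : exists a : {additive augI3 G -> limD R 1},
    (forall t, ra t (a t)) /\ (forall t x, ra t x -> a t = x).
  apply: graph_map => [t t' x x' [y [h1 h2 h3]] [y' [h1' h2' h3']]|t|x [y [h1 h2 h3]]].
  - exists (y - y'); split; [exact: (rpredB h1 h1')|exact: rel1B|].
    by rewrite (raddfB (Phi3 gB)) h3 h3'.
  - have [y [h1 h2]] := Phi3_surj gB t.
    have [x hx] := rel1_surj (fff_A h1) (fff_B h1).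
    by exists x, y.
  - exact: (rel1_eq0 h2).2 (Phi3_main h1 h3).
have [b [hb ub]] : exists b : {additive limD R 1 -> Tor P (Gab G)},
    (forall x, rb x (b x)) /\ (forall x s, rb x s -> b x = s).
  apply: graph_map => [x x' s s' [y h1 h2] [y' h1' h2']|x|s [y h1 h2]].
  - by exists (y - y'); [exact: rel1B|exact: theta_relB].
  - have [y h1] := rel1_total x.
    by have [s hs] := theta_total gB P (rel1_A h1) (rel1_B h1); exists s, y.
  - exact: theta_N (main_N ((rel1_eq0 h1).1 erefl)) h2.
exists a, b; split.
- have a0 t : a t = 0 -> t = 0.
    move=> at0; have [y [h1 h2 <-]] := ha t.
    exact: main_fff_Phi3 ((rel1_eq0 h2).1 at0) h1.
  by move=> t t' e; apply/eqP; rewrite -subr_eq0; apply/eqP/a0; rewrite raddfB e subrr.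
- move=> x; split=> [bx0|[t <-]].
    have [y h1 h2] := hb x; rewrite bx0 in h2.
    (* A trivial Tor class puts [y] in [N]. Subtracting [k], which lies in [I], moves [y] into [fff]
       without changing its class in the limit. *)
    have [k [hk hyk]] := N_main_fff (theta_inj (rel1_A h1) (rel1_B h1) h2).
    have [x' hx'] := rel1_surj (main_A hk) (main_B hk).
    exists (Phi3 gB (y - k)); apply: ua; exists (y - k); split=> //.
    have x'0 := (rel1_eq0 hx').2 hk.
    by have := rel1B h1 hx'; rewrite x'0 subr0.
  have [y [h1 h2 _]] := ha t; have [s hs] := theta_total gB P (rel1_A h2) (rel1_B h2).
  by rewrite (ub _ s); [exact: theta_N (fff_N h1) hs|exists y].
- move=> s; have [y [hA hB hs]] := theta_surj gB s.
  by have [x hx] := rel1_surj hA hB; exists x; apply: ub; exists y.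
Qed.
End FirstLimit.

Theorem mainTheorem11 :
  (forall (G : smallGroup) (R : inj_res (main_functor G)),
     (forall P : proj_res (Gab G),
        exists (a : {additive augI3 G -> limD R 1})
               (b : {additive limD R 1 -> Tor P (Gab G)}),
          short_exact a b)
     /\ (forall i : nat, (3 <= i)%N -> forall x : limD R i, x = 0))
  /\
  (exists phi : forall (G : smallGroup) (R : inj_res (main_functor G)),
       {additive limD R 2 -> tensorZ (Gab G) (Gab G)},
     (forall (G : smallGroup) (R : inj_res (main_functor G)),
        bijective (phi G R))
     /\ (forall (G H : smallGroup) (f : {multiplicative G -> H})
                (L : pres_lift f)
                (R : inj_res (main_functor G)) (S : inj_res (main_functor H))
                (m : res_map (main_lift L) R S) (x : limD R 2),
           phi H S (limD_map m 2 x)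
           = tensorZ_map (ab_map f) (ab_map f) (phi G R x))).
Proof.
split=> [G R|]; first split=> [P|i hi x].
- exact: limD1_short_exact (std G) R P.
- exact: (limD_vanish (std G) x hi).
- exists phi; split; [exact: phi_bijective|exact: phi_natural].
Qed.
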